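(* Let $(\mathbf{k},\phi)$ be a difference field of characteristic zero such that $\mathbf{k}$ is a real field and its field of constants $C:=\mathbf{k}^{\phi}$ is real closed, and let $A\in\mathrm{GL}_n(\mathbf{k})$. Let $(R,\phi)$ be a real Picard-Vessiot extension for $\phi Y=AY$ over $(\mathbf{k},\phi)$ with total ring of fractions $K$. Let $\mathcal{F}$ be the set of difference rings $F$ with $\mathbf{k}\subset F\subset K$ such that every non-zero-divisor of $F$ is a unit of $F$. Let $G$ be the real difference Galois group, identified (via a fundamental solution) with a linear algebraic subgroup of $\mathrm{GL}_n(C[i])$ defined over $C$, and let $\mathcal{G}$ be the set of linear algebraic subgroups of $G$. Then: (1) for any $F\in\mathcal{F}$, the group $G(K/F)$ of elements of $G$ leaving $F$ pointwise invariant belongs to $\mathcal{G}$; (2) for any $H\in\mathcal{G}$, the ring $K^{H}:=\{k\in K:\varphi(k)=k \text{ for all }\varphi\in H\}$ belongs to $\mathcal{F}$; (3) the maps $\alpha:\mathcal{F}\to\mathcal{G}$, $F\mapsto G(K/F)$, and $\beta:\mathcal{G}\to\mathcal{F}$, $H\mapsto K^{H}$, are inverse to each other.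
   Context: A difference ring $(R,\phi)$ is a ring with an automorphism $\phi$ (a difference subring is a subring stable under $\phi$ and $\phi^{-1}$); it is simple if its only $\phi$-stable ideals are $(0)$ and $R$. A field is real if $0$ is not a sum of squares of nonzero elements; real closed if it has no proper real algebraic extension. A Picard-Vessiot extension for $\phi Y=AY$ over $(\mathbf{k},\phi)$ is a difference ring extension $(R,\phi)$ of $(\mathbf{k},\phi)$ such that there exists $U\in\mathrm{GL}_n(R)$ with $\phi(U)=AU$, $R$ is generated as a $\mathbf{k}$-algebra by the entries of $U$ and $\det(U)^{-1}$, and $(R,\phi)$ is simple. Such $R$ is a finite direct sum of integral domains $R=\bigoplus_{j}R_j$; its total ring of fractions is $K=\bigoplus_j K_j$, $K_j$ the fraction field of $R_j$, with the induced automorphism. $R$ is real if each $K_j$ is a real field; a real Picard-Vessiot extension is a real Picard-Vessiot extension that is real. For a ring $S$ with no $x$ satisfying $x^2+1=0$, $S[i]:=S[X]/(X^2+1)$ with $\phi(i)=i$. The real difference Galois group is $G:=\{\varphi|_R:\varphi\in G_{R[i]}\}$, where $G_{R[i]}$ is the group of difference ring automorphisms of $R[i]$ fixing $\mathbf{k}[i]$ pointwise; each element of $G$ extends uniquely to a difference automorphism of $K[i]$ fixing $\mathbf{k}[i]$ (with $i\mapsto i$ and acting on fractions), which is how $G$ acts on $K$. For a fundamental solution $U\in\mathrm{GL}_n(R)$, the map $\varphi\mapsto U^{-1}\varphi(U)$ is an injective group morphism $G\to\mathrm{GL}_n(C[i])$ whose image is a linear algebraic subgroup defined over $C$; $G$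 is identified with this image.
   Formalization: The set 𝒢 is taken to consist of the linear algebraic subgroups of G defined over C (zero sets of polynomials with coefficients in C); for subgroups closed only over C[i], such as {(z, iz)} in C[i]², K^H = K^{conj H} and (3) fails. *)

(* Defs.v *)
From HB Require Import structures.
From mathcomp Require Import all_boot all_order all_algebra.
From mathcomp Require Import complex.
From mathcomp Require Import mpoly.

Set Implicit Arguments.
Unset Strict Implicit.
Unset Printing Implicit Defensive.

Import Order.TTheory GRing.Theory Num.Theory.
Local Open Scope ring_scope.
Local Open Scope complex_scope.

(* S[i] := S[X]/(X^2+1) for a commutative (nonzero) ring S, realised as *)
(* pairs a + i b with the usual multiplication (basis 1, X).           *)
Definition cpx (S : Type) := complex S.

Section Cpx.
Variable S : comNzRingType.
HB.instance Definition _ := GRing.Zmodule.copy (cpx S) (complex S).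

Lemma cpx_mul1 : left_id (Complex (1 : S) 0) (@ComplexField.mulc S).
Proof. by move=> [a b] /=; rewrite !mul1r !mul0r subr0 addr0. Qed.

Lemma cpx_mulDl : left_distributive (@ComplexField.mulc S) (@ComplexField.addc S).
Proof.
move=> [a b] [c d] [e f] /=; rewrite !mulrDl !opprD -!addrA.
by congr ((_ + _) +i* (_ + _)); rewrite addrCA.
Qed.

Lemma cpx_nz : Complex (1 : S) 0 != Complex 0 0.
Proof. by rewrite eq_complex /= oner_eq0. Qed.

HB.instance Definition _ := GRing.Zmodule_isComNzRing.Build (cpx S)
  (@ComplexField.mulcA S) (@ComplexField.mulcC S) cpx_mul1 cpx_mulDl cpx_nz.
End Cpx.

Definition cpx_of (S : Type) (zero : S) (a : S) : cpx S := Complex a zero.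
Definition cpx_map (S T : Type) (f : S -> T) (z : cpx S) : cpx T :=
  let: Complex a b := z in Complex (f a) (f b).

Definition real_field (F : fieldType) : Prop :=
  forall s : seq F, s != [::] -> all (fun x => x != 0) s ->
    \sum_(x <- s) x ^+ 2 != 0.

(* For K = (+)_j K_j a finite product of fields (the total ring of      *)
(* fractions of a PV ring), the factors K_j are exactly the rings e K   *)
(* with e a nonzero idempotent such that e K is a field.  K is real iff *)
(* each such factor e K is a real field.                                 *)
Definition ideal_factor_is_field (K : comNzRingType) (e : K) : Prop :=
  e * e = e /\ e != 0 /\
  (forall x : K, e * x != 0 -> exists y : K, (e * x) * (e * y) = e).

Definition real_tot_ring (K : comNzRingType) : Prop :=
  forall e : K, ideal_factor_is_field e ->
    forall s : seq K, s != [::] -> all (fun x => e * x != 0) s ->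
      \sum_(x <- s) (e * x) ^+ 2 != 0.

Definition nzd (S : comNzRingType) (s : S) : Prop :=
  forall y : S, s * y = 0 -> y = 0.

Definition is_ideal (S : comNzRingType) (I : S -> Prop) : Prop :=
  I 0 /\ (forall x y, I x -> I y -> I (x + y)) /\
  (forall r x, I x -> I (r * x)).

Definition simple_diff_ring (S : comNzRingType) (phi : S -> S) : Prop :=
  forall I : S -> Prop, is_ideal I -> (forall x, I x -> I (phi x)) ->
    (forall x, I x -> x = 0) \/ (forall x, I x).

Definition is_subring (S : comNzRingType) (P : S -> Prop) : Prop :=
  P 0 /\ P 1 /\ (forall x y, P x -> P y -> P (x - y)) /\
  (forall x y, P x -> P y -> P (x * y)).

Definition total_ring_of_fractions (R K : comNzRingType) (iR : R -> K) : Prop :=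
  injective iR /\
  (forall s : R, nzd s -> exists y : K, iR s * y = 1) /\
  (forall x : K, exists a s : R, nzd s /\ x * iR s = iR a).

Definition PV_extension (k : fieldType) (phik : k -> k) (n : nat)
    (A : 'M[k]_n) (R : comNzRingType) (phiR : {rmorphism R -> R})
    (ik : {rmorphism k -> R}) (U : 'M[R]_n) : Prop :=
  bijective phiR /\ injective ik /\ (forall c, phiR (ik c) = ik (phik c)) /\
  (exists V : 'M[R]_n, U *m V = 1%:M /\ V *m U = 1%:M) /\
  map_mx phiR U = map_mx ik A *m U /\
  (exists d : R, d * \det U = 1 /\
     forall P : R -> Prop, is_subring P -> (forall c, P (ik c)) ->
       (forall i j, P (U i j)) -> P d -> forall x, P x) /\
  simple_diff_ring phiR.

(* Real difference Galois group.  An element of G_{R[i]} is a difference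
   ring automorphism sigma of R[i] fixing k[i] pointwise (with phi(i)=i,
   i.e. phi acts componentwise).  Its restriction to R determines it.  *)
Definition is_real_gal (k : fieldType) (R : comNzRingType)
    (phiR : R -> R) (ik : k -> R) (sigma : {rmorphism cpx R -> cpx R}) : Prop :=
  bijective sigma /\
  (forall z, sigma (cpx_map phiR z) = cpx_map phiR (sigma z)) /\
  (forall a b : k, sigma (Complex (ik a) (ik b)) = Complex (ik a) (ik b)).

Definition mx_CiR (C : rcfType) (k : fieldType) (R : comNzRingType)
    (iC : C -> k) (ik : k -> R) (n : nat) (M : 'M[complex C]_n) : 'M[cpx R]_n :=
  map_mx (fun z : complex C => let: Complex a b := z in Complex (ik (iC a)) (ik (iC b))) M.

Definition realizes (C : rcfType) (k : fieldType) (R : comNzRingType)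
    (iC : C -> k) (ik : k -> R) (n : nat) (U : 'M[R]_n)
    (sigma : {rmorphism cpx R -> cpx R}) (M : 'M[complex C]_n) : Prop :=
  map_mx sigma (map_mx (cpx_of 0) U) = map_mx (cpx_of 0) U *m mx_CiR iC ik M.

Definition Gmat (C : rcfType) (k : fieldType) (R : comNzRingType)
    (phiR : R -> R) (iC : C -> k) (ik : k -> R) (n : nat) (U : 'M[R]_n)
    (M : 'M[complex C]_n) : Prop :=
  exists sigma, is_real_gal phiR ik sigma /\ realizes iC ik U sigma M.

(* the element M of G fixes f in K: the (unique) extension tau of the
   corresponding sigma to K[i] maps f to f *)
Definition fixes_in_K (C : rcfType) (k : fieldType) (R K : comNzRingType)
    (phiR : R -> R) (iC : C -> k) (ik : k -> R) (iR : R -> K) (n : nat)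
    (U : 'M[R]_n) (M : 'M[complex C]_n) (f : K) : Prop :=
  forall sigma, is_real_gal phiR ik sigma -> realizes iC ik U sigma M ->
    forall tau : {rmorphism cpx K -> cpx K},
      (forall z : cpx R, tau (cpx_map iR z) = cpx_map iR (sigma z)) ->
      tau (cpx_of 0 f) = cpx_of 0 f.

Definition in_calF (k : fieldType) (K : comNzRingType) (phiK : K -> K)
    (ikK : k -> K) (F : K -> Prop) : Prop :=
  is_subring F /\ (forall c, F (ikK c)) /\
  (forall x, F x -> F (phiK x)) /\ (forall x, F (phiK x) -> F x) /\
  (forall x, F x -> (forall y, F y -> x * y = 0 -> y = 0) ->
     exists z, F z /\ x * z = 1).

Definition is_subgroup_GL (C : rcfType) (n : nat)
    (H : 'M[complex C]_n -> Prop) : Prop :=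
  (forall M, H M -> M \in unitmx) /\ H 1%:M /\
  (forall M N, H M -> H N -> H (M *m N)) /\
  (forall M, H M -> H (invmx M)).

Definition zariski_closed_over_C (C : rcfType) (n : nat)
    (H : 'M[complex C]_n -> Prop) : Prop :=
  exists S : {mpoly C[n * n]} -> Prop,
    forall M : 'M[complex C]_n, M \in unitmx ->
      (H M <-> forall p, S p ->
         (map_mpoly (real_complex C) p).@[fun j => mxvec M 0 j] = 0).

Definition lin_alg_subgroup_C (C : rcfType) (n : nat)
    (H : 'M[complex C]_n -> Prop) : Prop :=
  is_subgroup_GL H /\ zariski_closed_over_C H.

(* Main.v *)
Require Import Defs.
From HB Require Import structures.
From mathcomp Require Import all_boot all_order all_algebra.
From mathcomp Require Import all_field complex boolp.
From mathcomp Require Import mpoly.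
From mathcomp Require classical_sets monalg finmap.
From mathcomp Require Import ring.

Set Implicit Arguments.
Unset Strict Implicit.
Unset Printing Implicit Defensive.

Import Order.TTheory GRing.Theory Num.Theory.
Local Open Scope ring_scope.

(* Normal forms of vectors modulo a submodule of K^N (echelon form with idempotent
   pivots) are unique, hence commute with every automorphism preserving the submodule.
   Applied to phi, this shows that phi-invariant linear relations are spanned by
   relations over the constants, and K^phi = C since C is real closed and K is real.

   Let H be a closed subgroup.  The polynomials vanishing on U H form a space stable
   under H, hence, by normal forms again, spanned by polynomials over K^H.  If M fixes
   K^H, these polynomials vanish at U M as they vanish at U, so M lies in H.

   Conversely, let x be in K but not in F.  By separability x (x) 1 - 1 (x) x is not
   nilpotent in the tensor square of K over F, so there are two homomorphisms j1, j2
   from K to a field which agree on F but not at x.  The matrix j1(U)^-1 j2(U)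
   satisfies the equations over C that define G(K/F), and it specializes to a matrix
   over C[i] which still satisfies them and moves x. *)

(** The link between relations over [K] and equations over [C] is an expansion Q(U Z) = sum of e_i
    P_i(Z), with e_i in [K] linearly independent over [C] and P_i with coefficients in [C].
    Independence persists from [K] to K[i], so for M over C[i] the single condition Q(U M) = 0
    amounts to all P_i(M) = 0. In the target field of j1 and j2 independence may be lost; there the
    P_i vanish at j1(U)^-1 j2(U) because that matrix is invariant under phi. Since [K] and the rings
    F are only products of fields, pivots cannot be inverted; ideals generated by idempotents and
    quasi-inverses take the place of division. Reality of [K] serves three ends: K[i] is again a
    product of fields, R[i] stays simple, and roots in C[i] outside [C] give no new constants, [C]
    not being algebraically closed. Being fixed is stated through extensions to K[i], so the
    existence of these extensions is part of the proof. *)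

(** * Morphisms given by their graphs, quotients by prime ideals, subrings as types *)

(** Morphisms defined through representatives (fractions, polynomial expressions in generators,
    elements of a subring) are given by their graph: choice yields the function, and functionality
    of the graph makes it a morphism. *)
Lemma rmorph_of_rel (S T : nzRingType) (Rel : S -> T -> Prop) :
  (forall x, exists y, Rel x y) ->
  (forall x y y', Rel x y -> Rel x y' -> y = y') ->
  Rel 1 1 ->
  (forall x y x' y', Rel x y -> Rel x' y' -> Rel (x - x') (y - y')) ->
  (forall x y x' y', Rel x y -> Rel x' y' -> Rel (x * x') (y * y')) ->
  exists f : {rmorphism S -> T}, forall x, Rel x (f x).
Proof.
move=> tot fn R1 RB RM; have [f fP] := choice tot.
have fB : zmod_morphism f by move=> x y; apply: (fn (x - y)) (fP _) _; exact: RB.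
have fM : monoid_morphism f.
  split; first exact: fn (fP _) R1.
  by move=> x y; apply: (fn (x * y)) (fP _) _; exact: RM.
pose mB := GRing.isZmodMorphism.Build S T f fB.
pose mM := GRing.isMonoidMorphism.Build S T f fM.
pose g : {rmorphism S -> T} := HB.pack f mB mM.
by exists g.
Qed.

Section IdomainOf.
Variable D : comNzRingType.
Hypothesis dom : forall x y : D, x * y = 0 -> x = 0 \/ y = 0.

(** The carrier of [D'] is [D] itself; what has to be supplied is an inverse operation, which is
    chosen classically. *)
Lemma idomain_of_comNzRing :
  exists (D' : idomainType) (f : {rmorphism D -> D'}), bijective f.
Proof.
pose un : pred D := fun x => `[< exists y, y * x = 1 >].
have [iv ivP] : exists iv : D -> D,
    forall x, (un x -> iv x * x = 1) /\ (~~ un x -> iv x = x).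
  suff : forall x, exists y, (un x -> y * x = 1) /\ (~~ un x -> y = x).
    by move/choice=> [iv ?]; exists iv.
  move=> x; case: (boolP (un x)) => [/asboolP [y yx]|nu]; last by exists x.
  by exists y.
have mulV : {in un, left_inverse 1 iv *%R} by move=> x ux; apply: (ivP x).1.
have unitP (x y : D) : y * x = 1 -> un x by move=> yx; apply/asboolP; exists y.
have invout : {in [predC un], iv =1 id} by move=> x ux; apply: (ivP x).2.
pose mU := GRing.ComNzRing_hasMulInverse.Build D mulV unitP invout.
pose DU : comUnitRingType := HB.pack D mU.
have int : GRing.integral_domain_axiom DU.
  by move=> x y /dom [] ->; rewrite eqxx ?orbT.
pose mI := GRing.ComUnitRing_isIntegral.Build DU int.
pose DI : idomainType := HB.pack DU mI.
exists DI.
have fB : @zmod_morphism D DI id by [].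
have fM : @monoid_morphism D DI id by [].
pose mB := GRing.isZmodMorphism.Build D DI id fB.
pose mM := GRing.isMonoidMorphism.Build D DI id fM.
pose g : {rmorphism D -> DI} := HB.pack (id : D -> DI) mB mM.
by exists g; exists id.
Qed.
End IdomainOf.

Definition prime_ideal (S : comNzRingType) (P : S -> Prop) : Prop :=
  is_ideal P /\ ~ P 1 /\ (forall x y, P (x * y) -> P x \/ P y).

Section QuotientByPrime.
Local Open Scope quotient_scope.
Variables (S : comNzRingType) (P : S -> Prop).
Hypothesis primeP : prime_ideal P.

(** The [let] makes the predicate depend on the proof [primeP], so that this proof can be recovered
    from the predicate when its ideal structure is inferred. *)
Definition prime_pred : {pred S} := fun x => let _ := primeP in `[< P x >].

Lemma prime_predE x : (x \in prime_pred) = `[< P x >].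
Proof. by []. Qed.

Lemma prime_pred_idealr : idealr_closed prime_pred.
Proof.
have [[P0 [PD PM]] [P1 _]] := primeP.
split; first by rewrite prime_predE; apply/asboolP.
  by rewrite prime_predE; apply/asboolP.
move=> a x y; rewrite !prime_predE => /asboolP Px /asboolP Py.
by apply/asboolP; apply: PD => //; apply: PM.
Qed.

HB.instance Definition _ := isIdealr.Build S prime_pred prime_pred_idealr.

Lemma prime_ideal_field_hom :
  exists (M : fieldType) (f : {rmorphism S -> M}), forall x, f x = 0 <-> P x.
Proof.
pose Q := {ideal_quot prime_pred} : comNzRingType.
pose p : {rmorphism S -> Q} := \pi_Q.
have p0 x : p x = 0 <-> P x.
  have := Quotient.idealrBE prime_pred x 0; rewrite subr0 prime_predE => E.
  have -> : (p x = 0) <-> (x == 0 %[mod {ideal_quot prime_pred}]).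
    rewrite -(rmorph0 p); split=> [/eqP|/eqP]; exact.
  by rewrite -E; split=> /asboolP.
have surj (x : Q) : exists y, x = p y by exists (repr x); rewrite /p /= reprK.
have [D [f [g fK gK]]] : exists (D' : idomainType) (f : {rmorphism Q -> D'}), bijective f.
  apply: idomain_of_comNzRing => x y.
  have [x' ->] := surj x; have [y' ->] := surj y.
  rewrite -rmorphM => /p0 /primeP.2.2 [] /p0; [by left|by right].
exists {fraction D}, (@FracField.tofrac D \o f \o p) => x /=.
rewrite -p0; split=> [/eqP|->]; last by rewrite !rmorph0.
by rewrite tofrac_eq0 -(rmorph0 f) (can_eq fK) => /eqP.
Qed.
End QuotientByPrime.

(** An ideal maximal among those that contain [I] and no power of [b] is prime: adjoining either of
    two outside elements brings in a power of [b], and the product of these two powers would lie in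
    the ideal as soon as the product of the elements does. *)
Lemma exists_prime_avoiding (S : comNzRingType) (I : S -> Prop) (b : S) :
  is_ideal I -> (forall m, ~ I (b ^+ m)) ->
  exists P : S -> Prop, prime_ideal P /\ (forall x, I x -> P x) /\ ~ P b.
Proof.
move=> idI nI.
(* The candidates are sets whose union with [I] is an ideal, not ideals themselves: the union of the
   empty chain is empty and has to be admissible. *)
pose ok (A : classical_sets.set S) :=
  is_ideal (fun x => I x \/ A x) /\ forall m, ~ (I (b ^+ m) \/ A (b ^+ m)).
have [|A [[idA nA] maxA]] := @classical_sets.Zorn_bigcup S ok.
  move=> F Fok Ftot; split; last first.
    move=> m [/nI//|[X FX Xb]]; have [_ /(_ m)] := Fok X FX; apply; by right.
  split; first by left; case: idI.
  split.
    have key X Y x y : F X -> F Y -> X x -> Y y ->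
        I (x + y) \/ (classical_sets.bigcup F id) (x + y).
      move=> FX FY Xx Yy.
      wlog XY : X Y x y FX FY Xx Yy / classical_sets.subset X Y.
        move=> H; case: (Ftot _ _ FX FY) => XY; first exact: (H X Y).
        by rewrite addrC; apply: (H Y X).
      have [[_ [YD _]] _] := Fok Y FY.
      have [|Z] := YD x y (or_intror (XY _ Xx)) (or_intror Yy); first by left.
      by right; exists Y.
    move=> x y [Ix|[X FX Xx]] [Iy|[Y FY Yy]].
    - by left; apply: idI.2.1.
    - have [[_ [YD _]] _] := Fok Y FY.
      have [|Z] := YD x y (or_introl Ix) (or_intror Yy); first by left.
      by right; exists Y.
    - have [[_ [YD _]] _] := Fok X FX.
      have [|Z] := YD x y (or_intror Xx) (or_introl Iy); first by left.
      by right; exists X.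
    - exact: (key X Y).
  move=> r x [Ix|[X FX Xx]]; first by left; apply: idI.2.2.
  have [[_ [_ XM]] _] := Fok X FX.
  have [|Z] := XM r x (or_intror Xx); first by left.
  by right; exists X.
pose J x := I x \/ A x.
have max (J' : S -> Prop) : is_ideal J' -> (forall x, J x -> J' x) ->
    (forall m, ~ J' (b ^+ m)) -> forall x, J' x -> J x.
  move=> idJ' JJ' nJ'; apply: contrapT => nJJ'.
  have IJ x : I x \/ J' x -> J' x by move=> [Ix|//]; apply: JJ'; left.
  apply: (maxA J').
    split; first by move=> x Ax; apply: JJ'; right.
    by move=> J'A; apply: nJJ' => x /J'A; right.
  split; last by move=> m /IJ /nJ'.
  split; first by right; case: idJ'.
  split; first by move=> x y /IJ Jx /IJ Jy; right; apply: idJ'.2.1.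
  by move=> r x /IJ Jx; right; apply: idJ'.2.2.
have [J0 [JD JM]] := idA.
have step x : ~ J x -> exists m r j, J j /\ b ^+ m = r * x + j.
  move=> nJx; apply: contrapT => nex; apply: nJx.
  apply: (max (fun z => exists r j, J j /\ z = r * x + j)).
  - split; first by exists 0, 0; rewrite mul0r addr0.
    split.
      move=> _ _ [r [j [Jj ->]]] [r' [j' [Jj' ->]]].
      exists (r + r'), (j + j'); split; first exact: JD.
      by rewrite mulrDl addrACA.
    move=> s _ [r [j [Jj ->]]]; exists (s * r), (s * j); split; first exact: JM.
    by rewrite mulrDr mulrA.
  - by move=> j Jj; exists 0, j; rewrite mul0r add0r.
  - move=> m [r [j [Jj E]]]; apply: nex; by exists m, r, j.
  - by exists 1, 0; rewrite mul1r addr0.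
exists J; split; last first.
  by split=> [x Ix|Jb]; [left | apply: (nA 1%N); rewrite expr1].
split=> //; split; first by move=> J1; apply: (nA 0%N); rewrite expr0.
move=> x y Jxy; apply: contrapT => /not_orP [/step [m [r [j [Jj E]]]]].
move=> /step [m' [r' [j' [Jj' E']]]]; apply: (nA (m + m')%N).
rewrite exprD E E' -/(J _).
have -> : (r * x + j) * (r' * y + j') = (r * r') * (x * y) + ((r * x + j) * j' + (r' * y) * j).
  by ring.
by apply: (JD); [apply: JM | apply: (JD); apply: JM].
Qed.

Section SubringType.
Variables (S : comNzRingType) (P : S -> Prop).
Hypothesis subP : is_subring P.

Definition subring_pred : {pred S} := fun x => let _ := subP in `[< P x >].

Lemma subring_predE x : (x \in subring_pred) = `[< P x >].
Proof. by []. Qed.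

Lemma subring_pred_closed : subring_closed subring_pred.
Proof.
have [_ [P1 [PB PM]]] := subP.
split; first by rewrite subring_predE; apply/asboolP.
  by move=> x y; rewrite !subring_predE => /asboolP ? /asboolP ?; apply/asboolP; apply: PB.
by move=> x y; rewrite !subring_predE => /asboolP ? /asboolP ?; apply/asboolP; apply: PM.
Qed.

HB.instance Definition _ := GRing.isSubringClosed.Build S subring_pred subring_pred_closed.

Record subring_type := SubringType { subring_val : S ; _ : subring_val \in subring_pred }.
HB.instance Definition _ := [isSub of subring_type for subring_val].
HB.instance Definition _ := [Choice of subring_type by <:].
HB.instance Definition _ := [SubChoice_isSubComNzRing of subring_type by <:].

Lemma subring_hom :
  exists (A : comNzRingType) (f : {rmorphism A -> S}), injective f /\
    forall x, P x <-> exists a, x = f a.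
Proof.
exists subring_type, (val : subring_type -> S); split; first exact: val_inj.
move=> x; split=> [Px|[a ->]].
  have Px' : x \in subring_pred by rewrite subring_predE; apply/asboolP.
  by exists (SubringType Px').
by have := valP a; rewrite subring_predE => /asboolP.
Qed.
End SubringType.

Lemma subring_idomain (S : idomainType) (P : S -> Prop) : is_subring P ->
  exists (A : idomainType) (f : {rmorphism A -> S}), injective f /\
    forall x, P x <-> exists a, x = f a.
Proof.
move=> /subring_hom [A [f [finj fP]]].
have [A' [g [h gK hK]]] : exists (A' : idomainType) (g : {rmorphism A -> A'}), bijective g.
  apply: idomain_of_comNzRing => x y /(congr1 f); rewrite rmorphM rmorph0 => /eqP.
  by rewrite mulf_eq0 -!(rmorph0 f) !(inj_eq finj) => /orP [] /eqP; [left|right].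
have [|x y y'||||h' h'P] := @rmorph_of_rel A' A (fun x y => x = g y).
- by move=> x; exists (h x).
- by move=> -> /(can_inj gK).
- by rewrite rmorph1.
- by move=> x y x' y' -> ->; rewrite rmorphB.
- by move=> x y x' y' -> ->; rewrite rmorphM.
exists A', (f \o h'); split.
  by move=> x y /= /finj E; rewrite (h'P x) (h'P y) E.
move=> x; rewrite fP; split=> [[a ->]|[a ->]]; last by exists (h' a).
exists (g a) => /=; congr (f _).
by apply: (can_inj gK); rewrite -h'P.
Qed.

(** * Noetherian rings *)

Definition ideal_gen (S : comNzRingType) (A : S -> Prop) (x : S) : Prop :=
  forall I : S -> Prop, is_ideal I -> (forall y, A y -> I y) -> I x.

Lemma ideal_gen_ideal (S : comNzRingType) (A : S -> Prop) : is_ideal (ideal_gen A).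
Proof.
split; first by move=> I idI AI; case: idI.
split=> [x y Ax Ay I idI AI|r x Ax I idI AI].
  by apply: idI.2.1; [apply: Ax | apply: Ay].
by apply: idI.2.2; apply: Ax.
Qed.

Lemma ideal_gen_sub (S : comNzRingType) (A : S -> Prop) x : A x -> ideal_gen A x.
Proof. by move=> Ax I idI AI; apply: AI. Qed.

Lemma ideal_gen_mono (S : comNzRingType) (A B : S -> Prop) x :
  (forall y, A y -> ideal_gen B y) -> ideal_gen A x -> ideal_gen B x.
Proof. by move=> AB; apply=> //; exact: ideal_gen_ideal. Qed.

Lemma is_idealN (S : comNzRingType) (I : S -> Prop) x : is_ideal I -> I x -> I (- x).
Proof. by move=> [_ [_ IM]] Ix; rewrite -mulN1r; apply: IM. Qed.

Lemma is_idealB (S : comNzRingType) (I : S -> Prop) x y :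
  is_ideal I -> I x -> I y -> I (x - y).
Proof. by move=> idI Ix Iy; apply: idI.2.1 => //; apply: is_idealN. Qed.

(* A form of the ascending chain condition which avoids quantifying over ideals. *)
Definition noetherian (S : comNzRingType) : Prop :=
  forall a : nat -> S, exists n,
    ideal_gen (fun y => exists2 i, (i < n)%N & y = a i) (a n).

Lemma noetherian_field (k : fieldType) : noetherian k.
Proof.
move=> a; have [a0|a0] := eqVneq (a 0%N) 0.
  by exists 0%N; rewrite a0; case: (ideal_gen_ideal (fun y => exists2 i, (i < 0)%N & y = a i)).
exists 1%N; rewrite -[a 1%N](mulfVK a0).
by apply: (ideal_gen_ideal _).2.2; apply: ideal_gen_sub; exists 0%N.
Qed.

Lemma noetherian_image (S T : comNzRingType) (f : {rmorphism S -> T}) :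
  (forall y, exists x, y = f x) -> noetherian S -> noetherian T.
Proof.
move=> /choice [g gK] noS a; have [n an] := noS (g \o a); exists n.
move=> I idI aI; rewrite [a n]gK; apply: (an (fun x => I (f x))).
  split; first by rewrite rmorph0; case: idI.
  split=> [x y Ix Iy|r x Ix]; first by rewrite rmorphD; apply: idI.2.1.
  by rewrite rmorphM; apply: idI.2.2.
by move=> _ [i ilt ->]; rewrite /= -[f _]gK; apply: aI; exists i.
Qed.

Lemma classical_min (T : Type) (P : T -> Prop) (m : T -> nat) :
  (exists x, P x) -> exists x, P x /\ forall y, P y -> (m x <= m y)%N.
Proof.
move=> [x0 Px0].
have ex : exists n, `[< exists x, P x /\ m x = n >].
  by exists (m x0); apply/asboolP; exists x0.
have [n /asboolP [x [Px mx]] min] := ex_minnP ex.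
exists x; split=> // y Py; rewrite mx; apply: min.
by apply/asboolP; exists y.
Qed.

(* Successively choose elements of least degree outside the ideal generated by
   the previous choices. *)
Lemma noetherian_poly (S : comNzRingType) : noetherian S -> noetherian {poly S}.
Proof.
move=> noS f; apply: contrapT => nf.
pose I := ideal_gen (fun y => exists i, y = f i).
pose fl N := ideal_gen (fun y => exists2 i, (i < N)%N & y = f i).
pose sp (s : seq {poly S}) := ideal_gen (fun y => y \in s).
have flmono N N' x : (N <= N')%N -> fl N x -> fl N' x.
  move=> le; apply: ideal_gen_mono => y [i ilt ->].
  by apply: ideal_gen_sub; exists i => //; apply: leq_trans le.
have Ifl y : I y -> exists N, fl N y.
  move=> /(_ (fun y => exists N, fl N y)); apply.
    split; first by exists 0%N; case: (ideal_gen_ideal (fun y => exists2 i, (i < 0)%N & y = f i)).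
    split=> [x z [N xN] [N' zN]|r x [N xN]].
      exists (maxn N N'); apply: (ideal_gen_ideal _).2.1.
        exact: flmono (leq_maxl _ _) xN.
      exact: flmono (leq_maxr _ _) zN.
    by exists N; apply: (ideal_gen_ideal _).2.2.
  by move=> _ [i ->]; exists i.+1; apply: ideal_gen_sub; exists i.
(* If the ideal of the finite list [s] were all of [I], then [s] would lie in some [fl N], and [f N]
   would be generated by earlier terms. The value 0 is a default for lists that are not contained in
   [I]. *)
have bad s : exists h, (forall y, y \in s -> I y) ->
    I h /\ ~ sp s h /\ forall h', I h' -> ~ sp s h' -> (size h <= size h')%N.
  case: (pselect (forall y, y \in s -> I y)) => [sI|nsI]; last by exists 0.
  have [|h [[Ih nh] min]] := @classical_min _ (fun h => I h /\ ~ sp s h) (fun h => size h).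
    apply: contrapT => nex.
    have [N sN] : exists N, forall y, y \in s -> fl N y.
      elim: s sI {nex} => [|x s IH] sI; first by exists 0%N.
      have [|N sN] := IH; first by move=> y ys; apply: sI; rewrite inE ys orbT.
      have [N' xN] := Ifl _ (sI x (mem_head _ _)).
      exists (maxn N N') => y; rewrite inE => /orP [/eqP ->|/sN].
        exact: flmono (leq_maxr _ _) xN.
      exact: flmono (leq_maxl _ _).
    apply: nf; exists N; apply: (ideal_gen_mono sN); apply: contrapT => nsp.
    by apply: nex; exists (f N); split=> //; apply: ideal_gen_sub; exists N.
  by exists h => _; split=> //; split=> // h' Ih' nh'; apply: min.
have [next nextP] := choice bad.
pose s_ n := iter n (fun s => rcons s (next s)) [::].
pose g n := next (s_ n).
have sP n y : y \in s_ n -> exists2 i, (i < n)%N & y = g i.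
  elim: n => [//|n IH]; rewrite /s_ iterS mem_rcons inE => /orP [/eqP ->|/IH [i ilt ->]].
    by exists n.
  by exists i => //; apply: ltnW.
have gs n i : (i < n)%N -> g i \in s_ n.
  elim: n => [//|n IH]; rewrite ltnS leq_eqVlt /s_ iterS mem_rcons inE => /orP [/eqP ->|/IH ->].
    by rewrite eqxx.
  by rewrite orbT.
have sI n : forall y, y \in s_ n -> I y.
  elim: n => [//|n IH] y; rewrite /s_ iterS mem_rcons inE => /orP [/eqP ->|/IH //].
  by case: (nextP _ IH).
have gI n : I (g n) by case: (nextP _ (sI n)).
have gn n : ~ sp (s_ n) (g n) by case: (nextP _ (sI n)) => _ [].
have gmin n h : I h -> ~ sp (s_ n) h -> (size (g n) <= size h)%N.
  by case: (nextP _ (sI n)) => _ [_]; apply.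
have ids n := ideal_gen_ideal (fun y => y \in s_ n).
have [n lg] := noS (fun n => lead_coef (g n)).
pose d := size (g n).
have g0 : g n != 0 by apply: contra_notN (gn n) => /eqP ->; case: (ids n).
have d0 : (0 < d)%N by rewrite size_poly_gt0.
(* This ideal of coefficients directly yields an [h] in the ideal of [s_ n] that cancels the leading
   term of [g n]. The earlier [g i] are shifted by a power of the variable up to size [d], their
   sizes being at most [d] by minimality. *)
have [|_ [i ilt ->]|h [hsp [hsz hd]]] := lg (fun c => exists h, sp (s_ n) h /\ (size h <= d)%N /\ h`_d.-1 = c).
- split.
    by exists 0; rewrite size_poly0 coef0; split=> //; case: (ids n).
  split=> [_ _ [h [hsp [hsz <-]]] [h' [hsp' [hsz' <-]]]|r _ [h [hsp [hsz <-]]]].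
    exists (h + h'); rewrite coefD; split; first exact: (ids n).2.1.
    by split=> //; apply: leq_trans (size_polyD _ _) _; rewrite geq_max hsz.
  exists (r%:P * h); rewrite coefCM; split; first exact: (ids n).2.2.
  by split=> //; rewrite mul_polyC; apply: leq_trans (size_scale_leq _ _) hsz.
- have gi0 : g i != 0.
    by apply: contra_notN (gn i) => /eqP ->; case: (ids i).
  have le : (size (g i) <= d)%N.
    apply: gmin => // gsi; apply: (gn n); apply: ideal_gen_mono gsi => y /sP [j jlt ->].
    by apply: ideal_gen_sub; apply: gs; apply: ltn_trans ilt.
  exists ('X^(d - size (g i)) * g i); split.
    by apply: (ids n).2.2; apply: ideal_gen_sub; apply: gs.
  rewrite mulrC; split; first by rewrite size_Mmonic ?monicXn // size_polyXn addnS /= subnKC.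
  have si0 : (0 < size (g i))%N by rewrite size_poly_gt0.
  rewrite coefMXn lead_coefE.
  have -> : (d.-1 < d - size (g i))%N = false.
    by apply/negbTE; rewrite -leqNgt; rewrite leq_subLR -(prednK si0) addSn -{1}(prednK d0) ltnS leq_addl.
  by congr (_`_ _); rewrite -subn1 subnAC subKn // subn1.
have Ih : I h by apply: hsp; [exact: ideal_gen_ideal | exact: sI].
have Igh : I (g n - h) by exact: (is_idealB (ideal_gen_ideal _) (gI n) Ih).
have nsp : ~ sp (s_ n) (g n - h).
  by move=> sph; apply: (gn n); rewrite -[g n](subrK h); apply: (ids n).2.1.
suff : (size (g n - h)%R < d)%N by rewrite ltnNge (gmin n _ Igh nsp).
rewrite -(prednK d0) ltnS; apply/leq_sizeP => j; rewrite leq_eqVlt => /orP [/eqP <-|lt].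
  by rewrite coefB hd lead_coefE subrr.
have lt' : (d <= j)%N by rewrite -(prednK d0).
by rewrite coefB !nth_default ?subrr // (leq_trans hsz).
Qed.

(** Each generator is the image of the variable of a polynomial ring over the ring built so far, so
    the basis theorem is applied once per generator. *)
Lemma noetherian_fg (k : fieldType) (R : comNzRingType) (ik : {rmorphism k -> R}) (ys : seq R) :
  (forall P : R -> Prop, is_subring P -> (forall c, P (ik c)) ->
     (forall y, y \in ys -> P y) -> forall x, P x) -> noetherian R.
Proof.
move=> gen.
have [S [f [noS [fk fy]]]] : exists (S : comNzRingType) (f : {rmorphism S -> R}),
    noetherian S /\ (forall c, exists s, f s = ik c) /\ (forall y, y \in ys -> exists s, f s = y).
  elim: ys {gen} => [|y ys [S [f [noS [fk fy]]]]].
    exists k, ik; split; first exact: noetherian_field.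
    by split=> // c; exists c.
  exists {poly S}, (horner_eval y \o map_poly f); split; first exact: noetherian_poly.
  split=> [c|z].
    by have [s <-] := fk c; exists s%:P; rewrite /= /horner_eval map_polyC hornerC.
  rewrite inE => /orP [/eqP ->|/fy [s <-]].
    by exists 'X; rewrite /= /horner_eval map_polyX hornerX.
  by exists s%:P; rewrite /= /horner_eval map_polyC hornerC.
apply: (noetherian_image (f := f)) noS; apply: gen.
- split; first by exists 0; rewrite rmorph0.
  split; first by exists 1; rewrite rmorph1.
  split=> _ _ [a ->] [b ->]; first by exists (a - b); rewrite rmorphB.
  by exists (a * b); rewrite rmorphM.
- by move=> c; have [s <-] := fk c; exists s.
- by move=> y /fy [s <-]; exists s.
Qed.

(** * Extension of homomorphisms into fields *)

Definition char0 (S : nzRingType) : Prop := forall n : nat, n.+1%:R != 0 :> S.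

Definition root_closed (Om : fieldType) : Prop :=
  forall p : {poly Om}, (1 < size p)%N -> exists x, root p x.

Lemma char0_hom (F L : fieldType) (f : {rmorphism F -> L}) : char0 F -> char0 L.
Proof. by move=> c n; rewrite -(rmorph_nat f) fmorph_eq0. Qed.

Lemma char0_nonroot (F : fieldType) (p : {poly F}) : char0 F -> p != 0 ->
  exists n : nat, p.[n%:R] != 0.
Proof.
move=> cF p0; apply: contrapT => nex.
have inj : injective (fun n : nat => n%:R : F).
  suff lt_neq m n : (m < n)%N -> (m%:R : F) != n%:R.
    by move=> m n /eqP; case: (ltngtP m n) => // /lt_neq; last rewrite eq_sym; move=> /negbTE ->.
  move=> mn; have -> : n = (m + (n - m.+1).+1)%N by rewrite subnSK // subnKC // ltnW.
  by rewrite natrD addrC -subr_eq0 opprD addrCA subrr addr0 oppr_eq0.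
pose rs : seq F := [seq n%:R | n <- iota 0 (size p)].
have all_rs : all (root p) rs.
  by apply/allP => _ /mapP [n _ ->]; rewrite /root; apply/negPn/negP => pn; apply: nex; exists n.
have uniq_rs : uniq rs by rewrite map_inj_uniq // iota_uniq.
by have := max_poly_roots p0 all_rs uniq_rs; rewrite size_map size_iota ltnn.
Qed.

Lemma irreducible_factor (F : fieldType) (p : {poly F}) : (1 < size p)%N ->
  exists q, irreducible_poly q /\ q %| p.
Proof.
move=> sp.
have [|q [[sq qp] min]] := @classical_min _ (fun q : {poly F} => (1 < size q)%N /\ q %| p) (fun q => size q).
  by exists p.
exists q; split=> //; split=> // r r1 rq.
have q0 : q != 0 by rewrite -size_poly_gt0; apply: leq_trans sq.
have r0 : r != 0 by apply: contraNneq q0 => r0; rewrite r0 dvd0p in rq.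
rewrite -dvdp_size_eqp // eqn_leq dvdp_leq //=; apply: min.
split; last exact: dvdp_trans rq qp.
by rewrite ltn_neqAle eq_sym r1 size_poly_gt0.
Qed.

(** A root closed field is kept as it is, so a chain of adjunctions that starts from such a field
    retracts onto it. In the end this brings points back to C[i]. *)
Lemma adjoin_root (Om : fieldType) (p : {poly Om}) : (1 < size p)%N ->
  exists (Om' : fieldType) (io : {rmorphism Om -> Om'}),
    (exists x, root (map_poly io p) x) /\
    (root_closed Om -> root_closed Om' /\ exists r : {rmorphism Om' -> Om}, cancel io r).
Proof.
move=> sp; case: (pselect (root_closed Om)) => [cl|ncl].
  have [x px] := cl p sp.
  exists Om, idfun; split; first by exists x; rewrite map_poly_id.
  by split=> //; exists idfun.
have [q [qirr qp]] := irreducible_factor sp.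
have [L _ [z qz _]] := irredp_FAdjoin qirr.
exists L, (GRing.in_alg L); split=> //; exists z.
by have /dvdpP [s ->] := qp; rewrite rmorphM rootM qz orbT.
Qed.

Section HomExt1.
Variables (A B : idomainType) (i : {rmorphism A -> B}) (y : B).
Hypothesis injI : injective i.
Hypothesis genY : forall x, exists g : {poly A}, x = (map_poly i g).[y].

Lemma hom_adjoin (Om : fieldType) (psi : {rmorphism A -> Om}) (eta : Om) :
  (forall g, (map_poly i g).[y] = 0 -> (map_poly psi g).[eta] = 0) ->
  exists psi' : {rmorphism B -> Om}, forall g, psi' (map_poly i g).[y] = (map_poly psi g).[eta].
Proof.
move=> wd.
have [|x z z'||||psi' psiP] := @rmorph_of_rel B Om (fun x w => exists g, x = (map_poly i g).[y] /\ w = (map_poly psi g).[eta]).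
- by move=> x; have [g ->] := genY x; exists (map_poly psi g).[eta], g.
- move=> [g [-> ->]] [g' [E ->]]; apply/eqP; rewrite -subr_eq0 -hornerN -hornerD -rmorphB.
  by apply/eqP; apply: wd; rewrite rmorphB hornerD hornerN E subrr.
- by exists 1; rewrite !rmorph1 !hornerC.
- by move=> _ _ _ _ [g [-> ->]] [g' [-> ->]]; exists (g - g'); rewrite !rmorphB !hornerE.
- by move=> _ _ _ _ [g [-> ->]] [g' [-> ->]]; exists (g * g'); rewrite !rmorphM !hornerE.
exists psi' => g; have [g' [E ->]] := psiP (map_poly i g).[y].
apply/eqP; rewrite -subr_eq0 -hornerN -hornerD -rmorphB; apply/eqP; apply: wd.
by rewrite rmorphB hornerD hornerN E subrr.
Qed.

(** Let b' be a polynomial with b = b'(y). For [y] algebraic over [A], take f of least size with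
    f(y) = 0: the ideal of A[X] generated by f and b' contains a nonzero constant rho, and sending
    [y] to a root of f keeps [b] nonzero wherever rho and the leading coefficient of f survive. For
    [y] transcendental, [y] goes to an integer that is not a root of the image of b'; characteristic
    zero provides one. *)
Lemma hom_ext1 (b : B) : b != 0 ->
  exists alpha : A, alpha != 0 /\
    forall (Om : fieldType) (psi : {rmorphism A -> Om}), char0 Om -> psi alpha != 0 ->
    exists (Om' : fieldType) (io : {rmorphism Om -> Om'}) (psi' : {rmorphism B -> Om'}),
      [/\ forall a, psi' (i a) = io (psi a), psi' b != 0 &
        root_closed Om -> root_closed Om' /\ exists r : {rmorphism Om' -> Om}, cancel io r].
Proof.
move=> b0; have [b' Eb] := genY b.
have b'0 : b' != 0 by apply: contraNneq b0 => b'0; rewrite Eb b'0 rmorph0 horner0.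
case: (pselect (exists f : {poly A}, f != 0 /\ (map_poly i f).[y] = 0)) => [/(classical_min (fun g : {poly A} => size g))|ntr].
  move=> [f [[f0 fy] min]].
  have small g : (map_poly i g).[y] = 0 -> (size g < size f)%N -> g = 0.
    move=> gy lt; apply/eqP/negPn/negP => g0.
    by have := min g (conj g0 gy); rewrite leqNgt lt.
  have sf : (1 < size f)%N.
    rewrite ltnNge; apply/negP => /size1_polyC Ef; move: fy f0.
    rewrite Ef map_polyC hornerC => /eqP; rewrite -(rmorph0 i) (inj_eq injI) => /eqP ->.
    by rewrite eqxx.
  (* An element [g0] of least size divides [b'] and [f] up to scalars, by pseudo-division. It does
     not vanish at [y] since [b] is nonzero, so its cofactor in [f] does, and minimality of [f]
     makes [g0] constant. *)
  pose J (g : {poly A}) := exists u v, g = u * b' + v * f.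
  have [|g0 [[g00 Jg0] ming0]] := @classical_min _ (fun g => g != 0 /\ J g) (fun g => size g).
    by exists f; split=> //; exists 0, 1; rewrite mul0r add0r mul1r.
  have g0div g : J g -> exists q, lead_coef g0 ^+ scalp g g0 *: g = q * g0.
    move=> [u [v Eg]]; exists (g %/ g0); rewrite Pdiv.Idomain.divp_eq.
    suff -> : g %% g0 = 0 by rewrite addr0.
    apply/eqP/negPn/negP => r0.
    have := ming0 (g %% g0); rewrite leqNgt Pdiv.Idomain.ltn_modpN0 // => H.
    suff: false by []; apply: H; split=> //.
    have [u0 [v0 E0]] := Jg0.
    set c := lead_coef g0 ^+ scalp g g0.
    exists (c%:P * u - g %/ g0 * u0), (c%:P * v - g %/ g0 * v0).
    have -> : g %% g0 = c%:P * g - g %/ g0 * g0.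
      by rewrite mul_polyC Pdiv.Idomain.divp_eq addrAC subrr add0r.
    move: c (g %/ g0) => c q; rewrite E0 Eg; ring.
  have lc0 n : lead_coef g0 ^+ n != 0 by rewrite expf_neq0 // lead_coef_eq0.
  have Jf : J f by exists 0, 1; rewrite mul0r add0r mul1r.
  have Jb : J b' by exists 1, 0; rewrite mul0r addr0 mul1r.
  have [qf Ef] := g0div f Jf.
  have [qb Ebq] := g0div b' Jb.
  have g0y : (map_poly i g0).[y] != 0.
    apply: contraNneq b0 => g0y.
    have : (map_poly i (lead_coef g0 ^+ scalp b' g0 *: b')).[y] = 0.
      by rewrite Ebq rmorphM hornerM g0y mulr0.
    rewrite -mul_polyC rmorphM hornerM /= map_polyC hornerC -Eb => /eqP.
    by rewrite mulf_eq0 -{1}(rmorph0 i) (inj_eq injI) (negbTE (lc0 _)).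
  have qf0 : qf != 0.
    apply: contraNneq (lc0 (scalp f g0)) => qf0; move: Ef; rewrite qf0 mul0r => /eqP.
    by rewrite -mul_polyC mulf_eq0 (negbTE f0) orbF polyC_eq0.
  have qfy : (map_poly i qf).[y] = 0.
    have : (map_poly i (qf * g0)).[y] = 0.
      by rewrite -Ef -mul_polyC rmorphM hornerM fy mulr0.
    by rewrite rmorphM hornerM => /eqP; rewrite mulf_eq0 (negbTE g0y) orbF => /eqP.
  have s0 : size g0 = 1%N.
    have := min qf (conj qf0 qfy).
    have : size f = size (qf * g0) by rewrite -Ef size_scale.
    rewrite size_mul // => ->.
    have : (0 < size g0)%N by rewrite size_poly_gt0.
    have : (0 < size qf)%N by rewrite size_poly_gt0.
    case: (size qf) => [//|n] _; case: (size g0) => [//|[//|m]] _.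
    by rewrite addSn /= -[n.+1]addn1 leq_add2l.
  have Erho : g0 = (g0`_0)%:P by apply: size1_polyC; rewrite s0.
  have rho0 : g0`_0 != 0 by apply: contraNneq g00 => r0; rewrite Erho r0.
  exists (lead_coef f * g0`_0); split; first by rewrite mulf_neq0 // lead_coef_eq0.
  move=> Om psi cOm; rewrite rmorphM mulf_eq0 negb_or => /andP [lf rho].
  have [|Om' [io [[eta feta] cl]]] := @adjoin_root Om (map_poly psi f).
    by rewrite size_map_poly_id0.
  have lfn m : psi (lead_coef f ^+ m) != 0.
    by elim: m => [|m IHm]; rewrite ?rmorph1 ?oner_eq0 // exprS rmorphM mulf_neq0.
  have fe : (map_poly (io \o psi) f).[eta] = 0 by rewrite map_poly_comp; apply/eqP.
  have [|psi' psiP] := @hom_adjoin Om' (io \o psi) eta.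
    move=> g gy.
    have E := Pdiv.Idomain.divp_eq g f.
    have r0 : g %% f = 0.
      apply: small; last exact: Pdiv.Idomain.ltn_modpN0.
      move/eqP: E; rewrite addrC -subr_eq => /eqP <-.
      by rewrite -mul_polyC rmorphB !rmorphM hornerD hornerN !hornerM gy fy !mulr0 subr0.
    move: E; rewrite r0 addr0 => /(congr1 (fun h => (map_poly (io \o psi) h).[eta])).
    rewrite -mul_polyC !rmorphM !hornerM fe mulr0 /= map_polyC hornerC => /eqP.
    by rewrite mulf_eq0 fmorph_eq0 (negbTE (lfn _)) => /eqP.
  exists Om', io, psi'; split=> //.
    by move=> a; have := psiP a%:P; rewrite !map_polyC !hornerC.
  rewrite Eb psiP; apply: contraNneq rho => be.
  have [u [v E0]] := Jg0.
  have := congr1 (fun h => (map_poly (io \o psi) h).[eta]) E0.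
  rewrite Erho rmorphD !rmorphM hornerD !hornerM be fe !mulr0 addr0 /= map_polyC hornerC /= coefC eqxx.
  by move/eqP; rewrite fmorph_eq0.
exists (lead_coef b'); split; first by rewrite lead_coef_eq0.
move=> Om psi cOm lb.
have [|m be] := @char0_nonroot _ (map_poly psi b') cOm.
  by rewrite map_poly_eq0_id0.
have [|psi' psiP] := @hom_adjoin Om psi m%:R.
  move=> g gy; have -> : g = 0; last by rewrite rmorph0 horner0.
  by apply/eqP/negPn/negP => g0; apply: ntr; exists g.
exists Om, idfun, psi'; split.
- by move=> a; have := psiP a%:P; rewrite !map_polyC !hornerC.
- by rewrite Eb psiP.
- by move=> cl; split=> //; exists idfun.
Qed.
End HomExt1.

Definition generated_over (A B : comNzRingType) (i : A -> B) (ys : seq B) : Prop :=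
  forall P : B -> Prop, is_subring P -> (forall a, P (i a)) ->
    (forall y, y \in ys -> P y) -> forall x, P x.

(* Stands in for the Nullstellensatz. *)
Lemma hom_ext (B : idomainType) (ys : seq B) :
  forall (A : idomainType) (i : {rmorphism A -> B}) (b : B),
  injective i -> generated_over i ys -> b != 0 ->
  exists alpha : A, alpha != 0 /\
    forall (Om : fieldType) (psi : {rmorphism A -> Om}), char0 Om -> psi alpha != 0 ->
    exists (Om' : fieldType) (io : {rmorphism Om -> Om'}) (psi' : {rmorphism B -> Om'}),
      [/\ forall a, psi' (i a) = io (psi a), psi' b != 0 &
        root_closed Om -> exists r : {rmorphism Om' -> Om}, cancel io r].
Proof.
elim: ys => [|y ys IH] A i b injI gen b0.
  have surj x : exists a, x = i a.
    apply: (gen (fun x => exists a, x = i a)) => //; last by move=> a; exists a.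
    split; first by exists 0; rewrite rmorph0.
    split; first by exists 1; rewrite rmorph1.
    split=> _ _ [a ->] [a' ->]; first by exists (a - a'); rewrite rmorphB.
    by exists (a * a'); rewrite rmorphM.
  have [alpha Ea] := surj b; exists alpha; split.
    by apply: contraNneq b0 => a0; rewrite Ea a0 rmorph0.
  move=> Om psi _ psia.
  have [|x z z'||||psi' psiP] := @rmorph_of_rel B Om (fun x w => exists a, x = i a /\ w = psi a).
  - by move=> x; have [a ->] := surj x; exists (psi a), a.
  - by move=> [a [-> ->]] [a' [/injI -> ->]].
  - by exists 1; rewrite !rmorph1.
  - by move=> _ _ _ _ [a [-> ->]] [a' [-> ->]]; exists (a - a'); rewrite !rmorphB.
  - by move=> _ _ _ _ [a [-> ->]] [a' [-> ->]]; exists (a * a'); rewrite !rmorphM.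
  have psiE a : psi' (i a) = psi a by have [a' [/injI <- ->]] := psiP (i a).
  exists Om, idfun, psi'; split=> //; first by rewrite Ea psiE.
  by move=> _; exists idfun.
(* The ring A[y] inside [B] becomes the base of the induction hypothesis, which handles the other
   generators; [hom_ext1] then descends from A[y] to [A]. *)
pose P1 x := exists g : {poly A}, x = (map_poly i g).[y].
have subP1 : is_subring P1.
  split; first by exists 0; rewrite rmorph0 horner0.
  split; first by exists 1; rewrite rmorph1 hornerC.
  split=> _ _ [g ->] [g' ->]; first by exists (g - g'); rewrite rmorphB !hornerE.
  by exists (g * g'); rewrite rmorphM !hornerE.
have [A1 [i1 [injI1 imI1]]] := subring_idomain subP1.
have [|x z z'||||i' iP] := @rmorph_of_rel A A1 (fun x w => i1 w = i x).
- move=> x; have /imI1 [w E] : P1 (i x) by exists x%:P; rewrite map_polyC hornerC.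
  by exists w.
- by move=> E /esym; rewrite -E => /injI1.
- by rewrite !rmorph1.
- by move=> x z x' z'; rewrite !rmorphB => -> ->.
- by move=> x z x' z'; rewrite !rmorphM => -> ->.
have injI' : injective i' by move=> x z /(congr1 i1); rewrite !iP => /injI.
have [y1 Ey1] : exists y1, y = i1 y1 by apply/imI1; exists 'X; rewrite map_polyX hornerX.
have gen1 x : exists g : {poly A}, x = (map_poly i' g).[y1].
  have /imI1 [g E] : exists a, i1 x = i1 a by exists x.
  exists g; apply: injI1; rewrite E -horner_map -map_poly_comp -Ey1; congr (_.[_]).
  by apply: eq_map_poly => a /=; rewrite iP.
have [alpha1 [a10 ext1]] : exists alpha : A1, alpha != 0 /\
    forall (Om : fieldType) (psi : {rmorphism A1 -> Om}), char0 Om -> psi alpha != 0 ->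
    exists (Om' : fieldType) (io : {rmorphism Om -> Om'}) (psi' : {rmorphism B -> Om'}),
      [/\ forall a, psi' (i1 a) = io (psi a), psi' b != 0 &
        root_closed Om -> exists r : {rmorphism Om' -> Om}, cancel io r].
  apply: IH => // P subP Pi Py; apply: gen => //.
    by move=> a; rewrite -iP.
  by move=> z; rewrite inE => /orP [/eqP ->|/Py //]; rewrite Ey1.
have [alpha [a0 ext]] := hom_ext1 injI' gen1 a10.
exists alpha; split=> // Om psi cOm psia.
have [Om1 [io1 [psi1 [psi1E psi1a cl1]]]] := ext Om psi cOm psia.
have [Om2 [io2 [psi2 [psi2E psi2b cl2]]]] := ext1 Om1 psi1 (char0_hom io1 cOm) psi1a.
exists Om2, (io2 \o io1), psi2; split=> //.
  by move=> a /=; rewrite -iP psi2E psi1E.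
move=> /cl1 [/cl2 [r2 r2K] [r1 r1K]]; exists (r1 \o r2).
by move=> x /=; rewrite r2K r1K.
Qed.

(** * Finite products of fields *)

(** The generator [e] lies in [J], hence is idempotent. In a product of fields this replaces
    division by a pivot. *)
Definition idem_gen (S : comNzRingType) (F : S -> Prop) : Prop :=
  forall J : S -> Prop, J 0 -> (forall x y, J x -> J y -> J (x + y)) ->
    (forall a x, F a -> J x -> J (a * x)) -> (forall x, J x -> F x) ->
    exists e, J e /\ forall x, J x -> e * x = x.

(** Zero is allowed among the [e i]; the last condition is then vacuous for that index. *)
Definition field_dec (S : comNzRingType) (r : nat) (e : 'I_r -> S) : Prop :=
  [/\ forall i j, e i * e j = if i == j then e i else 0, \sum_i e i = 1 &
    forall i x, e i * x != 0 -> exists y, e i * x * y = e i].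

(** The second equation makes [y] unique, so a morphism that fixes [x] also fixes its
    quasi-inverse. *)
Definition quasi_inverse (S : comNzRingType) (x y : S) : Prop :=
  x * (x * y) = x /\ y * (x * y) = y.

Lemma quasi_inverse_unique (S : comNzRingType) (x y z : S) :
  quasi_inverse x y -> quasi_inverse x z -> y = z.
Proof.
move=> [xy yx] [xz zx].
have E : x * y = x * z.
  transitivity ((x * y) * (x * z)); first by rewrite -{1}xz; ring.
  by rewrite -{3}xy; ring.
transitivity (y * (x * z)); first by rewrite -E yx.
by transitivity (z * (x * y)); [ring | rewrite E zx].
Qed.

Section FieldDec.
Variables (S : comNzRingType) (r : nat) (e : 'I_r -> S).
Hypothesis dec : field_dec e.

Lemma dec_id i : e i * e i = e i.
Proof. by have [-> _ _] := dec; rewrite eqxx. Qed.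

Lemma dec_ext (a b : S) : (forall i, e i * a = e i * b) -> a = b.
Proof.
move=> ab; have [_ e1 _] := dec.
by rewrite -[a]mul1r -[b]mul1r -e1 !mulr_suml; apply: eq_bigr.
Qed.

Lemma dec_neq0 (a : S) : a != 0 -> exists i, e i * a != 0.
Proof.
move=> a0; apply: contrapT => nex; move/eqP: a0; apply; apply: dec_ext => i.
by rewrite mulr0; apply/eqP/negPn/negP => ea; apply: nex; exists i.
Qed.

Lemma dec_sum (y : 'I_r -> S) i : e i * \sum_j e j * y j = e i * y i.
Proof.
have [eij _ _] := dec.
rewrite mulr_sumr (bigD1 i) //= big1 ?addr0 ?mulrA ?dec_id // => j ji.
by rewrite mulrA eij eq_sym (negbTE ji) mul0r.
Qed.

Lemma dec_dom i (x y : S) : e i * (x * y) = 0 -> e i * x = 0 \/ e i * y = 0.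
Proof.
have [_ _ fld] := dec => exy; case: (eqVneq (e i * x) 0) => [|/fld [z ez]]; first by left.
by right; rewrite -ez -mulrA; transitivity (e i * (x * y) * z); [ring | rewrite exy mul0r].
Qed.

Lemma dec_regular (x : S) : exists y, quasi_inverse x y.
Proof.
have [_ _ fld] := dec.
have ex_y i : exists y, (e i * x != 0 -> e i * x * y = e i) /\ (e i * x = 0 -> y = 0).
  have [->|/[dup] n0 /fld [y ey]] := eqVneq (e i * x) 0.
    by exists 0.
  by exists y; split=> // E; rewrite E eqxx in n0.
have [y yP] := choice ex_y.
exists (\sum_i e i * y i); split; apply: dec_ext => i.
  have [ex|ex] := eqVneq (e i * x) 0; first by rewrite mulrA ex mul0r.
  transitivity ((e i * x) * (e i * \sum_j e j * y j) * x).
    by rewrite -{1}(dec_id i); ring.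
  rewrite dec_sum; transitivity ((e i * x * y i) * (e i * x)); first by ring.
  by rewrite ((yP i).1 ex) mulrA dec_id.
have [ex|ex] := eqVneq (e i * x) 0.
  by rewrite dec_sum (yP i).2 // mulr0 mulrA dec_sum (yP i).2 // mulr0 mul0r.
transitivity ((e i * \sum_j e j * y j) * x * (e i * \sum_j e j * y j)).
  by rewrite -{1}(dec_id i); ring.
rewrite dec_sum; transitivity ((e i * x * y i) * (e i * y i)); first by ring.
by rewrite ((yP i).1 ex) mulrA dec_id.
Qed.

Lemma dec_reduced (x : S) : x * x = 0 -> x = 0.
Proof. by move=> xx; have [y [<- _]] := dec_regular x; rewrite mulrA xx mul0r. Qed.

Lemma dec_idem_gen : idem_gen (fun _ : S => True).
Proof.
move=> J J0 JD JM _; have [_ _ fld] := dec.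
have JS (a x : S) : J x -> J (a * x) by apply: JM.
pose ok i := `[< exists2 z, J z & e i * z != 0 >].
exists (\sum_(i | ok i) e i); split.
  elim/big_ind: _ => // i /asboolP [z Jz /fld [y <-]].
  by rewrite mulrAC; apply: JS.
move=> x Jx; apply: dec_ext => i.
have E : \sum_(j | ok j) e j = \sum_j e j * (if ok j then 1 else 0).
  by rewrite big_mkcond; apply: eq_bigr => j _; case: ifP; rewrite ?mulr1 ?mulr0.
rewrite mulrA E dec_sum; case: (boolP (ok i)) => [_|nok]; first by rewrite mulr1.
rewrite mulr0 mul0r; apply/esym/eqP/negPn/negP => ex.
by move/negP: nok; apply; apply/asboolP; exists x.
Qed.

Lemma dec_component i : e i != 0 ->
  exists (M : fieldType) (f : {rmorphism S -> M}), forall x, f x = 0 <-> e i * x = 0.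
Proof.
move=> ei; apply: prime_ideal_field_hom; split.
  split; first by rewrite mulr0.
  split=> [x y ex ey|s x ex]; first by rewrite mulrDr ex ey addr0.
  by rewrite mulrCA ex mulr0.
by split; [rewrite mulr1; apply/eqP | move=> x y; apply: dec_dom].
Qed.

Lemma dec_field_hom (z : S) : z != 0 ->
  exists (M : fieldType) (f : {rmorphism S -> M}), f z != 0.
Proof.
move=> /dec_neq0 [i ez]; have [|M [f fP]] := @dec_component i.
  by apply: contraNneq ez => ->; rewrite mul0r.
by exists M, f; apply: contraNneq ez => /fP ->.
Qed.

Definition supp (x : S) : {set 'I_r} := [set i | e i * x != 0].

Lemma supp_lt (z w : S) : z * w = 0 -> w != 0 -> (#|supp z| < #|supp (z + w)%R|)%N.
Proof.
move=> zw /dec_neq0 [i0 ew].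
have zw' i : e i * z != 0 -> e i * w = 0.
  move=> ez; have [|ez0|//] := @dec_dom i z w; first by rewrite zw mulr0.
  by rewrite ez0 eqxx in ez.
apply: proper_card; apply/properP; split.
  by apply/subsetP => i; rewrite !inE mulrDr => ez; rewrite (zw' i ez) addr0.
have ez0 : e i0 * z = 0 by apply/eqP/negPn/negP => /zw' E; rewrite E eqxx in ew.
by exists i0; rewrite !inE ?mulrDr ez0 ?add0r ?eqxx.
Qed.

Lemma supp_max (P : S -> Prop) : (exists x, P x) ->
  exists x, P x /\ forall y, P y -> (#|supp y| <= #|supp x|)%N.
Proof.
move=> /(classical_min (fun x => (r - #|supp x|)%N)) [x [Px min]]; exists x; split=> // y /min.
have le z : (#|supp z| <= r)%N by rewrite -[X in (_ <= X)%N]card_ord max_card.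
by rewrite leq_sub2lE.
Qed.

Section TotalSubring.
Variable F : S -> Prop.
Hypothesis subF : is_subring F.
Hypothesis totF : forall x, F x -> (forall y, F y -> x * y = 0 -> y = 0) ->
  exists z, F z /\ x * z = 1.

Lemma subring0 : F 0. Proof. by case: subF. Qed.
Lemma subring1 : F 1. Proof. by case: subF => _ []. Qed.
Lemma subringB x y : F x -> F y -> F (x - y).
Proof. by case: subF => _ [_ [H _]]; apply: H. Qed.
Lemma subringM x y : F x -> F y -> F (x * y).
Proof. by case: subF => _ [_ [_ H]]; apply: H. Qed.
Lemma subringN x : F x -> F (- x).
Proof. by move=> Fx; rewrite -[- x]add0r; apply: subringB => //; apply: subring0. Qed.
Lemma subringD x y : F x -> F y -> F (x + y).
Proof. by move=> Fx Fy; rewrite -[y]opprK; apply: subringB => //; apply: subringN. Qed.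

(** Adding to [x] an element z of [F] that annihilates it and has maximal support gives a
    non-zero-divisor of [F]: whatever x + z kills is killed by x and by z, and could be added to z.
    The inverse u of x + z satisfies x (x u) = x. *)
Lemma total_subring_regular (x : S) : F x -> exists y, F y /\ quasi_inverse x y.
Proof.
move=> Fx; have [|z [[Fz xz] max]] := @supp_max (fun z => F z /\ x * z = 0).
  by exists 0; rewrite mulr0; split=> //; apply: subring0.
have [||u [Fu xzu]] := totF (x := x + z); first exact: subringD.
  move=> w Fw xzw; apply/eqP/negPn/negP => w0.
  have xw : x * w = 0.
    apply: dec_reduced; transitivity ((x + z) * w * (x * w) - (x * z) * w * w); first by ring.
    by rewrite xzw xz !mul0r subr0.
  have zw : z * w = 0 by rewrite -xzw mulrDl xw add0r.
  have : (#|supp (z + w)%R| <= #|supp z|)%N.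
    by apply: max; rewrite mulrDr xz xw addr0; split=> //; apply: subringD.
  by rewrite leqNgt supp_lt.
have id1 : x * (x * u) = x.
  transitivity (x * ((x + z) * u) - (x * z) * u); first by ring.
  by rewrite xzu xz mul0r subr0 mulr1.
exists (u * (x * u)); split; first by do !apply: subringM.
split; first by transitivity (x * (x * u) * (x * u) ); [ring | rewrite id1 id1].
transitivity (u * (x * (x * u)) * (x * u) * u); first by ring.
by rewrite id1; transitivity (u * (x * (x * u)) * u); [ring | rewrite id1; ring].
Qed.

(** An element of [J] of maximal support, multiplied by its quasi-inverse, is the generator: a part
    of [J] outside this support could be added to the element. *)
Lemma total_subring_idem_gen : idem_gen F.
Proof.
move=> J J0 JD JM JF; have [|z [Jz max]] := @supp_max J; first by exists 0.
have [y [Fy [zy yz]]] := total_subring_regular (JF _ Jz).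
have Jzy : J (z * y) by rewrite mulrC; apply: JM.
exists (z * y); split=> // x Jx; apply/eqP; rewrite eq_sym -subr_eq0.
apply/negPn/negP => n0.
have Jx' : J (x - z * y * x).
  apply: JD => //; rewrite -mulNr; apply: JM => //.
  by apply: subringN; apply: JF.
have := max _ (JD _ _ Jz Jx'); rewrite leqNgt supp_lt //.
by rewrite mulrBr -{1}zy; ring.
Qed.
End TotalSubring.
End FieldDec.

(** Separability in characteristic zero is used in this form: once l + 1 is invertible, the
    coefficient below the leading one recovers [x]. *)
Lemma coef_XsubC_exp_pred (S : comNzRingType) (x : S) l :
  (('X - x%:P) ^+ l.+1)`_l = - (l.+1%:R * x).
Proof.
elim: l => [|l IH]; first by rewrite expr1 coefB coefX coefC mul1r sub0r.
have lc : (('X - x%:P) ^+ l.+1)`_l.+1 = 1.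
  have := monic_exp l.+1 (monicXsubC x) => /monicP; rewrite lead_coefE.
  by rewrite size_exp_XsubC.
by rewrite exprS mulrBl coefB coefXM coefCM IH lc /= mulr1 -[l.+2]addn1 natrD mulrDl mul1r opprD.
Qed.

(* If x were not in F, some nonzero idempotent part of x would have a minimal
   polynomial over F which is a power of T - x, contradicting separability. *)
Lemma nilpotent_diff_in_subring (S : comNzRingType) (F : S -> Prop) (x : S) (m r : nat)
    (c : 'I_r -> S) (g : 'I_r -> {poly S}) :
  (forall z : S, z != 0 -> exists (M : fieldType) (f : {rmorphism S -> M}), f z != 0) ->
  is_subring F -> (forall y, F y -> exists z, F z /\ quasi_inverse y z) -> idem_gen F ->
  (forall n, exists2 d, F d & d * n.+1%:R = 1) ->
  (forall k i, F (g k)`_i) -> (forall k, (g k).[x] = 0) ->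
  ('X - x%:P) ^+ m = \sum_k c k *: g k -> F x.
Proof.
move=> sep subF regF idF invF gF gx Em; apply: contrapT => nFx.
have F0 := subring0 subF; have F1 := subring1 subF; have FB := subringB subF.
have FM := subringM subF; have FN := subringN subF; have FD := subringD subF.
(* The idempotent [e] cuts out the part where [x] already lies in [F]. On the complement [u], an
   element f of [F] with f x in [F] has to vanish. *)
have [||||e [[Fe Fex] eP]] := idF (fun f => F f /\ F (f * x)).
- by rewrite mul0r.
- by move=> y z [Fy Fyx] [Fz Fzx]; rewrite mulrDl; split; apply: FD.
- by move=> a y Fa [Fy Fyx]; rewrite -mulrA; split; apply: FM.
- by move=> y [].
pose u := 1 - e.
have Fu : F u by apply: FB.
have u0 : u != 0.
  by apply/negP; rewrite subr_eq0 => /eqP e1; apply: nFx; move: Fex; rewrite -e1 mul1r.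
have uP f : F f -> u * f = f -> F (f * x) -> f = 0.
  by move=> Ff uf Ffx; rewrite -[LHS]uf mulrBl mul1r eP // subrr.
have uu : u * u = u.
  by rewrite {1}/u mulrBl mul1r /u mulrBr mulr1 eP ?subrr ?subr0.
(* Such a minimal polynomial exists: if [u] killed all the [g k], it would kill the monic polynomial
   (X - x)^m. *)
have [|g0 [[g0F g0x ug0 g00] min]] := @classical_min _ (fun g : {poly S} =>
    [/\ forall i, F g`_i, g.[x] = 0, u *: g = g & g != 0]) (fun g => size g).
  apply: contrapT => nex.
  have ug k : u *: g k = 0.
    apply/eqP/negPn/negP => n0; apply: nex; exists (u *: g k); split=> //.
    - by move=> i; rewrite coefZ; apply: FM.
    - by rewrite hornerZ gx mulr0.
    - by rewrite scalerA uu.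
  have : u *: ('X - x%:P) ^+ m = 0.
    rewrite Em scaler_sumr big1 // => k _; rewrite scalerA mulrC -scalerA ug scaler0 //.
  move/(congr1 (fun p : {poly S} => p`_m)); rewrite coefZ coef0.
  have := monic_exp m (monicXsubC x) => /monicP; rewrite lead_coefE size_exp_XsubC /= => ->.
  by rewrite mulr1 => /eqP; rewrite (negbTE u0).
pose a := lead_coef g0.
have Fa : F a by apply: g0F.
have a0 : a != 0 by rewrite lead_coef_eq0.
have ua : u * a = a by rewrite /a lead_coefE -coefZ ug0.
(* The leading coefficient need not be invertible; its quasi-inverse turns it into an idempotent
   [f], and [g1] is monic over that part, which is enough for division. *)
have [a' [Fa' [aa' a'a]]] := regF a Fa.
pose f := a * a'.
have ff : f * f = f by rewrite /f -{3}aa'; ring.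
have f0 : f != 0 by apply: contraNneq a0 => f0; rewrite -aa' -/f f0 mulr0.
have uf : u * f = f by rewrite /f mulrA ua.
have Ff : F f by apply: FM.
pose g1 := a' *: g0.
have fg1 : f *: g1 = g1 by rewrite scalerA mulrC a'a.
have [l sg0] : exists l, size g0 = l.+1.
  by exists (size g0).-1; rewrite prednK // size_poly_gt0.
have g1l : g1`_l = f by rewrite coefZ mulrC /f /a lead_coefE sg0.
have sg1 : (size g1 <= l.+1)%N by rewrite -sg0 size_scale_leq.
have g1F i : F g1`_i by rewrite coefZ; apply: FM.
have g1x : g1.[x] = 0 by rewrite hornerZ g0x mulr0.
have div n : forall h : {poly S}, (size h <= n)%N -> (forall i, F h`_i) -> h.[x] = 0 ->
    f *: h = h -> exists q, h = q * g1.
  elim: n => [|n IH] h sh hF hx fh.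
    by exists 0; rewrite mul0r; apply/eqP; rewrite -size_poly_leq0.
  have [->|h0] := eqVneq h 0; first by exists 0; rewrite mul0r.
  have lh : (l.+1 <= size h)%N.
    rewrite -sg0; apply: min; split=> //.
    by rewrite -{1}fh scalerA uf.
  have [s Es] : exists s, (size h).-1 = (s + l)%N.
    by exists ((size h).-1 - l)%N; rewrite subnK // -ltnS prednK // (leq_trans _ lh).
  have sz : size h = (s + l).+1 by rewrite -Es prednK // (leq_trans _ lh).
  pose b := lead_coef h.
  have fb : f * b = b by rewrite /b lead_coefE -coefZ fh.
  pose h' := h - b *: (g1 * 'X^s).
  have [||||q Eq] := IH h'.
  - have sh' : (size h' <= (s + l).+1)%N.
      apply: leq_trans (size_polyD _ _) _; rewrite size_polyN geq_max sz leqnn /=.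
      apply: leq_trans (size_scale_leq _ _) _.
      apply: leq_trans (size_polyMleq _ _) _.
      by rewrite size_polyXn addnS /= addnC -addnS leq_add2l.
    have hl : h'`_(s + l) = 0.
      rewrite coefB coefZ coefMXn ltnNge leq_addr /= addKn g1l mulrC fb /b lead_coefE Es.
      by rewrite subrr.
    have le : (s + l <= n)%N by rewrite -ltnS -sz.
    apply/leq_sizeP => j; rewrite leq_eqVlt => /orP [/eqP <-|lt].
      move: le; rewrite leq_eqVlt => /orP [/eqP <- //|lt].
      by apply/(leq_sizeP _ _ sh').
    by apply/(leq_sizeP _ _ sh'); apply: leq_ltn_trans lt.
  - move=> i; rewrite coefB coefZ coefMXn; apply: FB => //; apply: FM; first exact: hF.
    by case: ifP.
  - by rewrite hornerD hornerN hornerZ hornerM g1x mul0r mulr0 subr0.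
  - by rewrite scalerBr fh scalerA fb.
  exists (q + b *: 'X^s); rewrite mulrDl -Eq -scalerAl ['X^s * g1]mulrC.
  by rewrite subrK.
have [q Eq] : exists q, f *: ('X - x%:P) ^+ m = q * g1.
  have ex_q k : exists q, f *: g k = q * g1.
    apply: (div (size (f *: g k))) => //.
    - by move=> i; rewrite coefZ; apply: FM.
    - by rewrite hornerZ gx mulr0.
    - by rewrite scalerA ff.
  have [q qP] := choice ex_q.
  exists (\sum_k c k *: q k); rewrite Em scaler_sumr mulr_suml; apply: eq_bigr => k _.
  by rewrite scalerA mulrC -scalerA qP scalerAl.
(* The equality is tested in fields, where [f] becomes 0 or 1. If it becomes 1, the image of [g1] is
   a monic divisor of a power of X - x, hence itself such a power. *)
have Eg1 : g1 = f *: ('X - x%:P) ^+ l.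
  apply/polyP => i; apply/eqP; rewrite -subr_eq0 -coefB; apply/negPn/negP => /sep [M [p]].
  rewrite -coef_map => /eqP; apply.
  rewrite rmorphB /= -[f *: _]mul_polyC rmorphM rmorphXn rmorphB /= map_polyX !map_polyC /=.
  have pff : p f = 0 \/ p f = 1.
    have /eqP := congr1 p ff; rewrite rmorphM -subr_eq0 -{3}[p f]mulr1 -mulrBr mulf_eq0 subr_eq0.
    by move=> /orP [] /eqP; [left|right].
  case: pff => pf.
    by rewrite pf mul0r subr0 -fg1 -mul_polyC rmorphM /= map_polyC /= pf mul0r coef0.
  rewrite pf mul1r.
  have spg : (size (map_poly p g1) <= l.+1)%N by apply: leq_trans (size_poly _ _) sg1.
  have lpg : (map_poly p g1)`_l = 1 by rewrite coef_map g1l.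
  have spg' : size (map_poly p g1) = l.+1.
    apply/eqP; rewrite eqn_leq spg ltnNge; apply/negP => /leq_sizeP /(_ l (leqnn l)).
    by rewrite lpg => /eqP; rewrite oner_eq0.
  have mon : map_poly p g1 \is monic by apply/monicP; rewrite lead_coefE spg' lpg.
  have dv : map_poly p g1 %| ('X - (p x)%:P) ^+ m.
    apply/dvdpP; exists (map_poly p q); rewrite -rmorphM -Eq -mul_polyC rmorphM rmorphXn rmorphB /=.
    by rewrite map_polyX !map_polyC /= pf mul1r.
  have [j jm /[dup] ej /eqp_size] := dvdp_exp_XsubCP dv.
  rewrite spg' size_exp_XsubC => -[jl]; subst j.
  by move: ej; rewrite eqp_monic ?monic_exp ?monicXsubC // => /eqP ->; rewrite subrr coef0.
(* For exponent 0, vanishing of [g1] at [x] gives f = 0. Otherwise the coefficient below the leading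
   one is f x times an invertible integer, so f x lies in [F] and again f = 0. *)
case: l sg0 g1l sg1 div Eg1 => [|l] sg0 g1l sg1 div Eg1.
  by move: g1x f0; rewrite Eg1 expr0 hornerZ hornerC mulr1 => ->; rewrite eqxx.
have [d Fd dl] := invF l.
move/eqP: f0; apply; apply: uP => //.
have -> : f * x = - d * g1`_l.
  rewrite Eg1 coefZ coef_XsubC_exp_pred; transitivity ((d * l.+1%:R) * (f * x)); last by ring.
  by rewrite dl mul1r.
by apply: FM => //; apply: FN.
Qed.

(** * Normal forms *)

(* Normal form modulo a submodule W of S^N, in echelon form with idempotent
   pivots: uniqueness makes it commute with every automorphism preserving W. *)
Lemma normal_form (S : comNzRingType) (N : nat) (W : 'rV[S]_N -> Prop) :
  idem_gen (fun _ : S => True) ->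
  W 0 -> (forall u v, W u -> W v -> W (u + v)) -> (forall a u, W u -> W (a *: u)) ->
  exists M : 'M[S]_N,
    [/\ forall j, W (row j (1%:M - M)), forall w, W w -> w *m M = 0 &
      forall tau tau' : {rmorphism S -> S}, cancel tau' tau ->
        (forall v, W v -> W (map_mx tau v)) -> (forall v, W v -> W (map_mx tau' v)) ->
        map_mx tau M = M].
Proof.
move=> idS W0 WD WZ.
have WB u v : W u -> W v -> W (u - v) by move=> Wu Wv; rewrite -scaleN1r; apply: WD => //; apply: WZ.
(* The coefficients at place [l] of the vectors of [W] that start with [l] zeros form an ideal; its
   idempotent generator is the pivot [e l]. *)
pose lead (l : 'I_N) (w : 'rV[S]_N) := W w /\ forall i : 'I_N, (i < l)%N -> w 0 i = 0.
have lead_ex l : exists w, lead l w /\ forall v, lead l v -> w 0 l * v 0 l = v 0 l.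
  have [||||e [[w [lw <-]] eP]] := idS (fun c => exists w, lead l w /\ w 0 l = c) => //.
  - by exists 0; rewrite mxE; split=> //; split=> // i _; rewrite mxE.
  - move=> _ _ [u [[Wu u0] <-]] [v [[Wv v0] <-]]; exists (u + v); rewrite mxE; split=> //.
    by split=> [|i il]; [apply: WD | rewrite mxE u0 // v0 // addr0].
  - move=> a _ _ [u [[Wu u0] <-]]; exists (a *: u); rewrite mxE; split=> //.
    by split=> [|i il]; [apply: WZ | rewrite mxE u0 // mulr0].
  by exists w; split=> // v lv; apply: eP; exists v.
have [w wP] := choice lead_ex.
pose e l := w l 0 l.
pose red (v : 'rV[S]_N) := forall l, v 0 l * e l = 0.
have red_uniq v : W v -> red v -> v = 0.
  move=> Wv rv; suff v0 n : forall l : 'I_N, (l < n)%N -> v 0 l = 0.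
    by apply/rowP => l; rewrite mxE (v0 N).
  elim: n => [//|n IH] l; rewrite ltnS leq_eqVlt => /orP [/eqP ln|/IH //].
  rewrite -(wP l).2 ?[_ * v 0 l]mulrC ?rv //; split=> // i il; apply: IH.
  by rewrite -ln.
have red_ex v : exists v', W (v - v') /\ red v'.
  suff H n : (n <= N)%N -> exists v', W (v - v') /\ forall l : 'I_N, (l < n)%N -> v' 0 l * e l = 0.
    by have [v' [Wv' rv']] := H N (leqnn N); exists v'; split=> // l; apply: rv'.
  elim: n => [|n IH] nN; first by exists v; rewrite subrr; split.
  have [v' [Wv' rv']] := IH (ltnW nN).
  pose m := Ordinal nN.
  have [[Wm m0] mP] := wP m.
  exists (v' - v' 0 m *: w m); split.
    by rewrite opprB addrCA addrC; apply: WD => //; apply: WZ.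
  move=> l; rewrite ltnS leq_eqVlt => /orP [/eqP lm|lm].
    have -> : l = m by apply: val_inj.
    by rewrite !mxE mulrBl -mulrA [w m 0 m * _](mP (w m)) ?subrr //.
  by rewrite !mxE m0 // mulr0 subr0 rv'.
have [M MP] := choice (fun j => red_ex (row j (1%:M : 'M[S]_N))).
have redD u v : red u -> red v -> red (u + v) by move=> ru rv l; rewrite mxE mulrDl ru rv addr0.
have redZ a u : red u -> red (a *: u) by move=> ru l; rewrite mxE -mulrA ru mulr0.
have redB u v : red u -> red v -> red (u - v).
  by move=> ru rv; rewrite -scaleN1r; apply: redD => //; apply: redZ.
pose MM := \matrix_j M j.
have rowM j : row j MM = M j by rewrite rowK.
have redM v : red (v *m MM).
  rewrite mulmx_sum_row; elim/big_ind: _ => // [l|i _]; first by rewrite mxE mul0r.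
  by rewrite rowM; apply: redZ; have [] := MP i.
have subM v : W (v - v *m MM).
  rewrite -{1}[v]mulmx1 !mulmx_sum_row -sumrB; elim/big_ind: _ => // i _.
  by rewrite -scalerBr rowM; apply: WZ; have [] := MP i.
exists MM; split.
- by move=> j; rewrite linearB /= rowM; have [] := MP j.
- move=> v Wv; apply: red_uniq => //.
  by rewrite -[v *m MM](subKr v); apply: WB.
move=> tau tau' tK Wt Wt'.
(* An ideal has only one idempotent generator, and both [tau] and [tau'] preserve this ideal. *)
have lt l : tau (e l) = e l.
  have [[Wl l0] lP] := wP l.
  have E1 : e l * tau (e l) = tau (e l).
    have := lP (map_mx tau (w l)); rewrite mxE; apply; split; first exact: Wt.
    by move=> i il; rewrite mxE l0 // rmorph0.
  have E2 : e l * tau' (e l) = tau' (e l).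
    have := lP (map_mx tau' (w l)); rewrite mxE; apply; split; first exact: Wt'.
    by move=> i il; rewrite mxE l0 // rmorph0.
  by have := congr1 tau E2; rewrite rmorphM tK mulrC E1.
apply/row_matrixP => j; apply/eqP; rewrite -subr_eq0; apply/eqP.
have [Wj rj] := MP j.
have rt : red (map_mx tau (M j)).
  by move=> l; rewrite mxE -lt -rmorphM rj rmorph0.
have Wt1 := Wt _ Wj.
rewrite -map_row rowM; apply: red_uniq; last exact: redB.
have -> : map_mx tau (M j) - M j = (row j 1%:M - M j) - map_mx tau (row j 1%:M - M j).
  by rewrite map_mxB map_row map_mx1 opprB [RHS]addrC addrA subrK.
exact: WB.
Qed.

(** Take [w] in [W] whose coordinate is the idempotent generator of all coordinate values on [W],
    and subtract from each [g k] its coordinate times [w]. The corrections add up to the coordinate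
    of the whole sum times [w], which is zero, so the sum is unchanged. *)
Lemma eliminate_coords (K : comNzRingType) (F : K -> Prop) (V : lmodType K) (I : eqType)
    (phi : I -> V -> K) (L : seq I) :
  is_subring F -> idem_gen F ->
  (forall i a u v, phi i (a *: u + v) = a * phi i u + phi i v) ->
  forall (W : V -> Prop) (r : nat) (c : 'I_r -> K) (g : 'I_r -> V),
  W 0 -> (forall a u v, F a -> W u -> W v -> W (a *: u + v)) ->
  (forall i u, W u -> F (phi i u)) ->
  (forall k, W (g k)) ->
  (forall i, i \in L -> phi i (\sum_k c k *: g k) = 0) ->
  exists g' : 'I_r -> V,
    [/\ forall k, W (g' k), forall k i, i \in L -> phi i (g' k) = 0 &
      \sum_k c k *: g k = \sum_k c k *: g' k].
Proof.
move=> subF idF phiL; have F1 := subring1 subF; have FN := subringN subF.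
have phi0 i : phi i 0 = 0.
  have := phiL i 1 0 0; rewrite scale1r addr0 mul1r => /eqP.
  by rewrite -subr_eq0 opprD addNKr oppr_eq0 => /eqP.
have phiD i u v : phi i (u + v) = phi i u + phi i v.
  by rewrite -[u in LHS]scale1r phiL mul1r.
have phiZ i a u : phi i (a *: u) = a * phi i u by rewrite -[_ *: _]addr0 phiL phi0 addr0.
elim: L => [|i L IH] W r c g W0 WZ WF Wg vanish; first by exists g.
have WD u v : W u -> W v -> W (u + v).
  by move=> Wu Wv; rewrite -[u]scale1r; apply: WZ.
have [||||e [[w [Ww we]] eP]] := idF (fun a => exists w, W w /\ phi i w = a).
- by exists 0; rewrite phi0.
- by move=> _ _ [u [Wu <-]] [v [Wv <-]]; exists (u + v); rewrite phiD; split=> //; apply: WD.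
- move=> a _ Fa [u [Wu <-]]; exists (a *: u); rewrite phiZ; split=> //.
  by rewrite -[_ *: _]addr0; apply: WZ.
- by move=> _ [u [Wu <-]]; apply: WF.
pose g1 k := - phi i (g k) *: w + g k.
have g1i k : phi i (g1 k) = 0.
  by rewrite phiL we mulNr mulrC eP ?addNr //; exists (g k).
have E : \sum_k c k *: g k = \sum_k c k *: g1 k.
  have phiS : phi i (\sum_k c k *: g k) = \sum_k c k * phi i (g k).
    rewrite (big_morph (phi i) (phiD i) (phi0 i)).
    by apply: eq_bigr => k _; rewrite phiZ.
  under [RHS]eq_bigr do rewrite scalerDr scalerA mulrN scaleNr.
  have v0 : phi i (\sum_k c k *: g k) = 0 by apply: vanish; exact: mem_head.
  by rewrite big_split /= sumrN -scaler_suml -phiS v0 scale0r oppr0 add0r.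
have [|||||g' [Wg' g'L E']] := IH (fun u => W u /\ phi i u = 0) r c g1.
- by rewrite phi0.
- by move=> a u v Fa [Wu u0] [Wv v0]; rewrite phiL u0 v0 mulr0 addr0; split=> //; apply: WZ.
- by move=> i' u [Wu _]; apply: WF.
- by move=> k; split=> //; apply: WZ => //; apply: FN; apply: WF.
- by move=> i' Li'; rewrite -E; apply: vanish; rewrite inE Li' orbT.
exists g'; split.
- by move=> k; have [] := Wg' k.
- move=> k i'; rewrite inE => /orP [/eqP ->|Li']; first by case: (Wg' k).
  exact: g'L.
- by rewrite E E'.
Qed.

(** * The tensor square *)

(* The polynomial ring over K in variables indexed by the elements of K, with its
   evaluation at the tautological point. *)
Record taut_poly_ring (K : comNzRingType) := TautPolyRing {
  tp_mon : eqType;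
  tp_one : tp_mon;
  tp_mul : tp_mon -> tp_mon -> tp_mon;
  tp_gen : K -> tp_mon;
  tp_deg : tp_mon -> K -> nat;
  tp_ring : comAlgType K;
  tp_coef : tp_mon -> tp_ring -> K;
  tp_mono : tp_mon -> tp_ring;
  tp_ev : {rmorphism tp_ring -> K};
  tp_deg_one : forall u, tp_deg tp_one u = 0%N;
  tp_deg_gen : forall u m, tp_deg (tp_mul (tp_gen u) m) u = (tp_deg m u).+1;
  tp_coefD : forall m p q, tp_coef m (p + q) = tp_coef m p + tp_coef m q;
  tp_coefZ : forall m c p, tp_coef m (c *: p) = c * tp_coef m p;
  tp_coef_mono : forall m m', tp_coef m (tp_mono m') = (m' == m)%:R;
  tp_coefM : forall (F : K -> Prop) p q, is_subring F ->
    (forall m, F (tp_coef m p)) -> (forall m, F (tp_coef m q)) ->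
    forall m, F (tp_coef m (p * q));
  tp_coef_ext : forall p q, (forall m, tp_coef m p = tp_coef m q) -> p = q;
  tp_supp : forall p, exists s : seq tp_mon, forall m, m \notin s -> tp_coef m p = 0;
  tp_mono1 : tp_mono tp_one = 1;
  tp_monoM : forall m m', tp_mono m * tp_mono m' = tp_mono (tp_mul m m');
  tp_sum : forall p, exists s : seq tp_mon, p = \sum_(m <- s) tp_coef m p *: tp_mono m;
  tp_evZ : forall c p, tp_ev (c *: p) = c * tp_ev p;
  tp_ev_gen : forall u, tp_ev (tp_mono (tp_gen u)) = u
}.

Section TautPolyRing.
Import (canonicals, coercions) finmap monalg.
Variable K : comNzRingType.

Let mon := monalg.cmonom K.
Let Pi : comAlgType K := monalg.malg mon K.
Let coef (m : mon) (Q : Pi) : K := monalg.mcoeff m Q.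
Let mono (m : mon) : Pi := monalg.mkmalgU m 1.
Let mmul (m m' : mon) : mon := monalg.mul m m'.
Let var (u : K) : Pi := mono (monalg.ucm u).

Let evm (m : mon) : K := \prod_(u <- finmap.finsupp (monalg.cmonom_val m)) u ^+ m u.

(** The supports of a product and of its factors differ, so multiplicativity is checked on a common
    larger index set. *)
Let evmw (m : mon) (d : finmap.finset_of (Phant K)) :
  finmap.fsubset (finmap.finsupp (monalg.cmonom_val m)) d -> evm m = \prod_(u <- d) u ^+ m u.
Proof.
move=> sub; apply: finmap.big_fset_incl => // u _.
by rewrite -monalg.cmE_eq0 => /eqP ->; rewrite expr0.
Qed.

Let evm_morph : monalg.mmorphism evm.
Proof.
split=> [m m'|]; last by rewrite /evm monalg.mdom1 finmap.big_seq_fset0.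
rewrite -/(mmul m m') (@evmw (mmul m m') _ (finmap.fsubset_refl _)).
rewrite (@evmw m _ (finmap.fsubsetUl _ (finmap.finsupp (monalg.cmonom_val m')))).
rewrite (@evmw m' _ (finmap.fsubsetUr (finmap.finsupp (monalg.cmonom_val m)) _)).
rewrite monalg.mdomD -big_split; apply: eq_bigr => u _.
by rewrite monalg.cmM exprD.
Qed.

Let evm_mm : monalg.MMorphism.type mon K :=
  monalg.MMorphism.Pack (monalg.MMorphism.Class (monalg.isMultiplicative.Axioms_ K evm evm_morph)).

Let ev : {rmorphism Pi -> K} := monalg.mmap (idfun : {rmorphism K -> K}) evm_mm.

Let evZ c Q : ev (c *: Q) = c * ev Q.
Proof. exact: monalg.mmapZ. Qed.

Let ev_var u : ev (var u) = u.
Proof.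
rewrite /ev /= monalg.mmapU /= mul1r /evm monalg.mdomU finmap.big_seq_fset1.
by rewrite monalg.cmUU expr1.
Qed.

Let coefL m a u v : coef m (a *: u + v) = a * coef m u + coef m v.
Proof. by rewrite /coef monalg.mcoeffD monalg.mcoeffZ. Qed.

Let coefD m u v : coef m (u + v) = coef m u + coef m v.
Proof. exact: monalg.mcoeffD. Qed.
Let coefB m u v : coef m (u - v) = coef m u - coef m v.
Proof. exact: monalg.mcoeffB. Qed.
Let coef0' m : coef m 0 = 0.
Proof. exact: monalg.mcoeff0. Qed.
Let coefZ' m c u : coef m (c *: u) = c * coef m u.
Proof. exact: monalg.mcoeffZ. Qed.
Let coef_mono m m' : coef m (mono m') = (m' == m)%:R.
Proof. exact: monalg.mcoeffU1. Qed.
Let monoM m m' : mono m * mono m' = mono (mmul m m').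
Proof. by rewrite /mono monalg.malgM_def monalg.fgmulUU mul1r. Qed.
Let mono1 : mono monalg.one = 1.
Proof. by []. Qed.
Let coef_ext p q : (forall m, coef m p = coef m q) -> p = q.
Proof. by move=> H; apply/monalg.malgP. Qed.
Let supp_ex p : exists s : seq mon, forall m, m \notin s -> coef m p = 0.
Proof. by exists (monalg.msupp p) => m; exact: monalg.mcoeff_outdom. Qed.
Let coefM_F (F : K -> Prop) p q : is_subring F -> (forall m, F (coef m p)) -> (forall m, F (coef m q)) ->
  forall m, F (coef m (p * q)).
Proof.
move=> subF Fp Fq m; rewrite /coef monalg.mcoeffMl.
apply: big_ind => [||m1 _]; [exact: (subring0 subF) | exact: (subringD subF) |].
apply: big_ind => [||m2 _]; [exact: (subring0 subF) | exact: (subringD subF) |].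
case: eqP => _; last exact: (subring0 subF).
by apply: (subringM subF); [apply: Fp | apply: Fq].
Qed.
Let mono_sum p : exists s : seq mon, p = \sum_(m <- s) coef m p *: mono m.
Proof.
exists (monalg.msupp p); rewrite {1}[p]monalg.monalgE; apply: eq_bigr => m _.
apply/monalg.malgP => m'; rewrite monalg.mcoeffU -[RHS]/(coef m' (coef m p *: mono m)).
by rewrite (coefZ' m' (coef m p) (mono m)) (coef_mono m' m) mulr_natr.
Qed.

Lemma taut_poly : taut_poly_ring K.
Proof.
apply: (@TautPolyRing K mon monalg.one mmul (@monalg.ucm K) (fun m u => m u) Pi coef mono ev).
- exact: monalg.cm1.
- by move=> u m; rewrite /mmul monalg.cmM monalg.cmUU.
- exact: coefD.
- exact: coefZ'.
- exact: coef_mono.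
- exact: coefM_F.
- exact: coef_ext.
- exact: supp_ex.
- exact: mono1.
- exact: monoM.
- exact: mono_sum.
- exact: evZ.
- exact: ev_var.
Qed.
End TautPolyRing.

(* K (x)_F K is presented as the quotient of the polynomial ring T by the ideal
   generated by the polynomials over F which vanish at the tautological point. *)
Section TensorSquare.
Variables (K : comNzRingType) (F : K -> Prop).
Hypotheses (subF : is_subring F) (idF : idem_gen F)
  (regF : forall y, F y -> exists z, F z /\ quasi_inverse y z)
  (invF : forall n, exists2 d, F d & d * n.+1%:R = 1)
  (sep : forall z : K, z != 0 -> exists (M : fieldType) (f : {rmorphism K -> M}), f z != 0).
Variable T : taut_poly_ring K.

Notation mon := (tp_mon T).
Notation Pi := (tp_ring T).
Notation coef := (@tp_coef K T).
Notation mono := (@tp_mono K T).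
Notation mmul := (@tp_mul K T).
Notation var u := (mono (tp_gen T u)).
Notation ev := (tp_ev T).

Let coefL m a u v : coef m (a *: u + v) = a * coef m u + coef m v.
Proof. by rewrite tp_coefD tp_coefZ. Qed.
Let coefN m u : coef m (- u) = - coef m u.
Proof. by rewrite -scaleN1r tp_coefZ mulN1r. Qed.
Let coefB m u v : coef m (u - v) = coef m u - coef m v.
Proof. by rewrite tp_coefD coefN. Qed.
Let coef0' m : coef m 0 = 0.
Proof. by rewrite -(scale0r 0) tp_coefZ mul0r. Qed.

Let rel (g : Pi) := (forall m, F (coef m g)) /\ ev g = 0.
(** Scalars from [K] suffice: relations over [F] are stable under multiplication by monomials, so
    their [K]-span is already an ideal. *)
Let inI (p : Pi) := exists2 s : seq (K * Pi), (forall z, z \in s -> rel z.2) &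
  p = \sum_(z <- s) z.1 *: z.2.

Let inI_rel g : rel g -> inI g.
Proof.
move=> rg; exists [:: (1, g)]; first by move=> z; rewrite inE => /eqP ->.
by rewrite big_seq1 scale1r.
Qed.

Let F_nat (b : bool) : F b%:R.
Proof. by case: b; [exact: (subring1 subF) | exact: (subring0 subF)]. Qed.

Let inI_ideal : is_ideal inI.
Proof.
split; first by exists [::] => //; rewrite big_nil.
have ID p q : inI p -> inI q -> inI (p + q).
  move=> [s sP ->] [t tP ->]; exists (s ++ t); last by rewrite big_cat.
  by move=> z; rewrite mem_cat => /orP [/sP|/tP].
split=> // r p [s sP ->]; have [t ->] := tp_sum r.
rewrite mulr_suml; elim: t => [|m t IH].
  by rewrite big_nil; exists [::] => //; rewrite big_nil.
rewrite big_cons; apply: ID => //.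
exists [seq (coef m r * z.1, mono m * z.2) | z <- s].
  move=> _ /mapP [z /sP [zF z0] ->] /=; split; last by rewrite rmorphM /= z0 mulr0.
  by move=> m'; apply: (tp_coefM subF) => // {}m'; rewrite tp_coef_mono; exact: F_nat.
rewrite big_map mulr_sumr; apply: eq_bigr => z _ /=.
by rewrite -scalerAr -scalerAl scalerA mulrC.
Qed.

Let rel_varB u v : rel (var (u - v) - (var u - var v)).
Proof.
split; last by rewrite !rmorphB /= !tp_ev_gen subrr.
by move=> m; rewrite !coefB !tp_coef_mono; do !apply: (subringB subF); exact: F_nat.
Qed.

Let rel_varM u v : rel (var (u * v) - var u * var v).
Proof.
split; last by rewrite rmorphB rmorphM /= !tp_ev_gen subrr.
by move=> m; rewrite coefB tp_monoM !tp_coef_mono; apply: (subringB subF); exact: F_nat.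
Qed.

Let rel_var1 : rel (var 1 - 1).
Proof.
split; last by rewrite rmorphB rmorph1 /= tp_ev_gen subrr.
by move=> m; rewrite coefB -tp_mono1 !tp_coef_mono; apply: (subringB subF); exact: F_nat.
Qed.

Let rel_varF f : F f -> rel (var f - f%:A).
Proof.
move=> Ff; split; last by rewrite rmorphB /= tp_evZ rmorph1 mulr1 tp_ev_gen subrr.
move=> m; rewrite coefB tp_coefZ -tp_mono1 !tp_coef_mono; apply: (subringB subF); first exact: F_nat.
by apply: (subringM subF) => //; exact: F_nat.
Qed.

Variable x : K.
Let pw (j : nat) : mon := iter j (mmul (tp_gen T x)) (tp_one T).

Let pwE j : mono (pw j) = var x ^+ j.
Proof. by elim: j => [|j IH]; [exact: tp_mono1 | rewrite exprS -IH tp_monoM]. Qed.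

Let pw_inj : injective pw.
Proof.
have pwx j : tp_deg (pw j) x = j.
  elim: j => [|j IH]; first by rewrite /pw /= tp_deg_one.
  by rewrite /pw iterS -/(pw j) tp_deg_gen IH.
by move=> i j /(congr1 (fun m => tp_deg m x)); rewrite !pwx.
Qed.

Notation Th := (horner_alg (var x)).

Let ThE g : Th g = \sum_(j < size g) g`_j *: mono (pw j).
Proof.
rewrite -{1}[g]coefK poly_def linear_sum; apply: eq_bigr => j _.
by rewrite linearZ /= rmorphXn /= horner_algX pwE -scalerAl mul1r.
Qed.

Let ev_Th g : ev (Th g) = g.[x].
Proof.
rewrite ThE rmorph_sum horner_coef; apply: eq_bigr => j _.
by rewrite /= tp_evZ pwE rmorphXn /= tp_ev_gen.
Qed.

Let coef_Th g j : coef (pw j) (Th g) = g`_j.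
Proof.
rewrite ThE (big_morph _ (@tp_coefD K T (pw j)) (coef0' _)).
under eq_bigr => i _ do rewrite tp_coefZ tp_coef_mono (inj_eq pw_inj).
have [lt|le] := ltnP j (size g); last first.
  rewrite nth_default // big1 // => i _; case: eqP => [ij|_]; last by rewrite mulr0.
  by have := ltn_ord i; rewrite ij ltnNge le.
rewrite (bigD1 (Ordinal lt)) //= eqxx mulr1 big1 ?addr0 // => i /eqP ij.
by case: eqP => [E|_]; [case: ij; apply: val_inj | rewrite mulr0].
Qed.

Let coef_Th_out g m : (forall j, m != pw j) -> coef m (Th g) = 0.
Proof.
move=> mpw; rewrite ThE (big_morph _ (@tp_coefD K T m) (coef0' _)) big1 // => i _.
by rewrite tp_coefZ tp_coef_mono eq_sym (negbTE (mpw _)) mulr0.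
Qed.

Let supp_bound (s : seq Pi) : exists L : seq mon,
  forall p, p \in s -> forall m, m \notin L -> coef m p = 0.
Proof.
elim: s => [|q s [L LP]]; first by exists [::].
have [t tP] := tp_supp q; exists (t ++ L) => p; rewrite inE => /orP [/eqP ->|ps] m.
  by rewrite mem_cat negb_or => /andP [/tP].
by rewrite mem_cat negb_or => /andP [_]; apply: LP.
Qed.

(** A power of [var x - x%:A] involves only the monomials that are powers of [var x]. Eliminating
    all other monomials leaves relations over [F] in one variable that vanish at [x], and
    [nilpotent_diff_in_subring] applies. *)
Let nilpotent_in n : inI ((var x - x%:A) ^+ n) -> F x.
Proof.
move=> [s sP E].
have ETh : (var x - x%:A) ^+ n = Th (('X - x%:P) ^+ n).
  by rewrite rmorphXn rmorphB /= horner_algX horner_algC.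
have [L LP] := supp_bound [seq z.2 | z <- s].
pose c k := (tnth (in_tuple s) k).1; pose g k := (tnth (in_tuple s) k).2.
have gs k : tnth (in_tuple s) k \in s by exact: mem_tnth.
have Eg : (var x - x%:A) ^+ n = \sum_k c k *: g k.
  by rewrite E big_tnth.
pose L' := [seq m <- L | `[< forall j, m != pw j >]].
pose W (p : Pi) := rel p /\ forall m, m \notin L -> coef m p = 0.
have [|||||g' [Wg' g'L E']] := @eliminate_coords K F Pi mon coef L' subF idF coefL W (size s) c g.
- split; last by move=> m _.
  by split; [move=> m; rewrite coef0'; exact: (subring0 subF) | rewrite rmorph0].
- move=> a u v Fa [[uF u0] uL] [[vF v0] vL]; split; last first.
    by move=> m mL; rewrite coefL uL // vL // mulr0 addr0.
  split; last by rewrite rmorphD /= tp_evZ u0 v0 mulr0 addr0.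
  by move=> m; rewrite coefL; apply: (subringD subF) => //; apply: (subringM subF).
- by move=> m u [[uF _] _].
- by move=> k; split; [apply: sP | apply: LP; apply: map_f].
- move=> m; rewrite mem_filter => /andP [/asboolP mpw _].
  by rewrite -Eg ETh coef_Th_out.
have [D DP] : exists D, forall j, (D <= j)%N -> pw j \notin L.
  elim: (L) => [|m t [D DP]]; first by exists 0%N.
  case: (pselect (exists j, m = pw j)) => [[j ->]|nj].
    exists (maxn D j.+1) => i; rewrite geq_max => /andP [Di ji]; rewrite inE negb_or DP // andbT.
    by rewrite (inj_eq pw_inj) gtn_eqF.
  exists D => i Di; rewrite inE negb_or DP // andbT.
  by apply: contra_notN nj => /eqP <-; exists i.
pose h k : {poly K} := \poly_(j < D) coef (pw j) (g' k).
have hE k j : (h k)`_j = coef (pw j) (g' k).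
  rewrite coef_poly; case: ltnP => // Dj; have [_ ->] := Wg' k => //; exact: DP.
have Thh k : Th (h k) = g' k.
  apply: tp_coef_ext => m; case: (pselect (exists j, m = pw j)) => [[j ->]|nj].
    by rewrite coef_Th hE.
  have mpw j : m != pw j by apply: contra_notN nj => /eqP ->; exists j.
  rewrite coef_Th_out //; case: (boolP (m \in L)) => mL; last by have [_ ->] := Wg' k.
  rewrite g'L //; rewrite mem_filter mL andbT; exact/asboolP.
apply: (@nilpotent_diff_in_subring K F x n (size s) c h) => //.
- by move=> k i; rewrite hE; have [[]] := Wg' k.
- by move=> k; rewrite -ev_Th Thh; have [[]] := Wg' k.
apply/polyP => j; rewrite -coef_Th -ETh Eg E' coef_sum.
rewrite (big_morph _ (@tp_coefD K T (pw j)) (coef0' _)); apply: eq_bigr => k _.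
by rewrite tp_coefZ coefZ hE.
Qed.

(** Modulo a prime that contains the relations but not [var x - x%:A], the scalars give [j1] and the
    variables give [j2]. *)
Lemma two_embeddings : ~ F x ->
  exists (M : fieldType) (j1 j2 : {rmorphism K -> M}),
    (forall f, F f -> j1 f = j2 f) /\ j1 x != j2 x.
Proof.
move=> nFx.
have [|P [prP [IP nP]]] := @exists_prime_avoiding Pi inI (var x - x%:A) inI_ideal.
  by move=> n /nilpotent_in.
have [M [p pP]] := prime_ideal_field_hom prP.
have p0 g : rel g -> p g = 0 by move=> rg; apply/pP; apply: IP; apply: inI_rel.
have p2 g h : rel (g - h) -> p g = p h.
  by move=> /p0 /eqP; rewrite rmorphB subr_eq0 => /eqP.
have [|u w w'||||j1 j1P] := @rmorph_of_rel K M (fun u w => w = p u%:A).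
- by move=> u; exists (p u%:A).
- by move=> -> ->.
- by rewrite scale1r rmorph1.
- by move=> u w u' w' -> ->; rewrite scalerBl rmorphB.
- by move=> u w u' w' -> ->; rewrite -rmorphM -scalerAl mul1r scalerA.
have [|u w w'||||j2 j2P] := @rmorph_of_rel K M (fun u w => w = p (var u)).
- by move=> u; exists (p (var u)).
- by move=> -> ->.
- by rewrite (p2 _ _ rel_var1) rmorph1.
- by move=> u w u' w' -> ->; rewrite -rmorphB; apply/esym/p2/rel_varB.
- by move=> u w u' w' -> ->; rewrite -rmorphM; apply/esym/p2/rel_varM.
exists M, j1, j2; split; first by move=> f Ff; rewrite j1P j2P; apply/esym/p2/rel_varF.
rewrite j1P j2P; apply/eqP => E; apply: nP; apply/pP.
by rewrite rmorphB E subrr.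
Qed.
End TensorSquare.

(** * Polynomials in the entries of a matrix *)

Notation evmx f M := (mmap f (fun j => mxvec M 0 j)).

Lemma evmx_hom (C S T : comNzRingType) (n : nat) (f : {rmorphism C -> S})
    (g : {rmorphism S -> T}) (M : 'M[S]_n) (p : {mpoly C[n * n]}) :
  g (evmx f M p) = evmx (g \o f) (map_mx g M) p.
Proof.
rewrite /mmap rmorph_sum; apply: eq_bigr => m _; rewrite rmorphM; congr (_ * _).
rewrite /mmap1 rmorph_prod; apply: eq_bigr => j _.
by rewrite rmorphXn -map_mxvec mxE.
Qed.

Lemma evmx_eqf (C S : comNzRingType) (n : nat) (f g : C -> S) (M : 'M[S]_n)
    (p : {mpoly C[n * n]}) : f =1 g -> evmx f M p = evmx g M p.
Proof. by move=> fg; apply: eq_bigr => m _; rewrite fg. Qed.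

Lemma evmx_map (B C S : comNzRingType) (n : nat) (h : {rmorphism B -> C})
    (f : {rmorphism C -> S}) (M : 'M[S]_n) (p : {mpoly B[n * n]}) :
  evmx f M (map_mpoly h p) = evmx (f \o h) M p.
Proof.
rewrite /map_mpoly {2}/mmap rmorph_sum; apply: eq_bigr => m _.
by rewrite rmorphM /= mmapC mmap1_id mmapX.
Qed.

Definition genmx (S : comNzRingType) (n : nat) : 'M[{mpoly S[n * n]}]_n :=
  vec_mx (\row_j 'X_j).

Lemma evmx_gen (C S : comNzRingType) (n : nat) (f : {rmorphism C -> S}) (M : 'M[S]_n) :
  map_mx (evmx f M) (genmx C n) = M.
Proof.
apply: (can_inj mxvecK); rewrite -map_mxvec vec_mxK.
by apply/rowP => j; rewrite !mxE mmapX mmap1U.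
Qed.

Lemma evmx_det (C S : comNzRingType) (n : nat) (f : {rmorphism C -> S}) (M : 'M[S]_n) :
  evmx f M (\det (genmx C n)) = \det M.
Proof. by rewrite -det_map_mx evmx_gen. Qed.

Lemma evmx_entry (C S : comNzRingType) (n : nat) (f : {rmorphism C -> S}) (M : 'M[S]_n) i j :
  evmx f M (genmx C n i j) = M i j.
Proof. by have /matrixP /(_ i j) := evmx_gen f M; rewrite mxE. Qed.

(* Q(U Z), as a polynomial in the entries of the generic matrix Z. *)
Definition lsubst (S : comNzRingType) (n : nat) (U : 'M[S]_n) (Q : {mpoly S[n * n]}) :
    {mpoly S[n * n]} :=
  evmx (@mpolyC (n * n) S) (map_mx (@mpolyC (n * n) S) U *m genmx S n) Q.

Lemma evmx_lsubst (S T : comNzRingType) (n : nat) (U : 'M[S]_n) (g : {rmorphism S -> T})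
    (M : 'M[T]_n) (Q : {mpoly S[n * n]}) :
  evmx g M (lsubst U Q) = evmx g (map_mx g U *m M) Q.
Proof.
rewrite /lsubst evmx_hom map_mxM evmx_gen.
have -> : map_mx (evmx g M) (map_mx (@mpolyC (n * n) S) U) = map_mx g U.
  by apply/matrixP => i j; rewrite !mxE mmapC.
by apply: evmx_eqf => c /=; rewrite mmapC.
Qed.

(** In an expansion of minimal length the coefficients are independent, since a dependence would
    eliminate one of them. *)
Lemma mpoly_expand (k C : fieldType) (K : comNzRingType) (N : nat) (hC : {rmorphism C -> K})
    (D : {mpoly K[N]}) :
  exists (r : nat) (e : 'I_r -> K) (Q : 'I_r -> {mpoly C[N]}),
    (forall la : 'I_r -> C, \sum_i hC (la i) * e i = 0 -> forall i, la i = 0) /\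
    D = \sum_i e i *: map_mpoly hC (Q i).
Proof.
have [|r [[e [Q ED]] min]] := @classical_min nat (fun r => exists (e : 'I_r -> K) (Q : 'I_r -> {mpoly C[N]}),
    D = \sum_i e i *: map_mpoly hC (Q i)) id.
  exists (size (msupp D)), (fun i => D@_(tnth (in_tuple (msupp D)) i)).
  exists (fun i => 'X_[tnth (in_tuple (msupp D)) i]).
  rewrite {1}[D]mpolyE big_tnth; apply: eq_bigr => i _; congr (_ *: _).
  by rewrite map_mpolyX.
exists r, e, Q; split=> // la la0; apply: contrapT => /existsNP [j /eqP laj].
case: r e Q ED min la la0 j laj => [|r] e Q ED min la la0 j laj; first by case: j laj.
suff /min : exists (e' : 'I_r -> K) (Q' : 'I_r -> {mpoly C[N]}),
    D = \sum_i e' i *: map_mpoly hC (Q' i) by rewrite /= ltnn.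
pose mu i := - (la (lift j i) / la j).
have ej : e j = \sum_i hC (mu i) * e (lift j i).
  have lV : hC (la j)^-1 * hC (la j) = 1 by rewrite -rmorphM mulVf // rmorph1.
  have : hC (la j)^-1 * \sum_i hC (la i) * e i = 0 by rewrite la0 mulr0.
  rewrite (bigD1_ord j) //= mulrDr mulrA lV mul1r => /eqP.
  rewrite addr_eq0 => /eqP ->; rewrite mulr_sumr -sumrN; apply: eq_bigr => i _.
  by rewrite /mu rmorphN rmorphM mulrA mulNr; congr (- (_ * _)); rewrite mulrC.
exists (fun i => e (lift j i)), (fun i => mu i *: Q j + Q (lift j i)).
rewrite ED (bigD1_ord j) //= {1}ej scaler_suml -big_split; apply: eq_bigr => i _ /=.
rewrite rmorphD /= scalerDr; congr (_ + _).
by rewrite -[mu i *: _]mul_mpolyC rmorphM /= map_mpolyC mul_mpolyC scalerA mulrC.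
Qed.

(** * Complexification *)

Section CpxMaps.
Variables S T : comNzRingType.

Lemma cpx_addE (a b c d : S) : (Complex a b : cpx S) + Complex c d = Complex (a + c) (b + d).
Proof. by []. Qed.
Lemma cpx_oppE (a b : S) : - (Complex a b : cpx S) = Complex (- a) (- b).
Proof. by []. Qed.
Lemma cpx_subE (a b c d : S) : (Complex a b : cpx S) - Complex c d = Complex (a - c) (b - d).
Proof. by []. Qed.
Lemma cpx_mulE (a b c d : S) :
  (Complex a b : cpx S) * Complex c d = Complex (a * c - b * d) (a * d + b * c).
Proof. by []. Qed.
Lemma cpx_zeroE : (0 : cpx S) = Complex 0 0.
Proof. by []. Qed.
Lemma cpx_oneE : (1 : cpx S) = Complex 1 0.
Proof. by []. Qed.

Variable f : {rmorphism S -> T}.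

Lemma cpx_map_is_zmod_morphism : zmod_morphism (cpx_map f : cpx S -> cpx T).
Proof. by move=> [a b] [c d]; rewrite cpx_subE /cpx_map !rmorphB. Qed.

Lemma cpx_map_is_monoid_morphism : monoid_morphism (cpx_map f : cpx S -> cpx T).
Proof.
split; first by rewrite cpx_oneE /cpx_map rmorph1 rmorph0.
by move=> [a b] [c d]; rewrite cpx_mulE /cpx_map !rmorphB !rmorphD !rmorphM.
Qed.
End CpxMaps.

HB.instance Definition _ (S T : comNzRingType) (f : {rmorphism S -> T}) :=
  GRing.isZmodMorphism.Build (cpx S) (cpx T) (cpx_map f) (cpx_map_is_zmod_morphism f).
HB.instance Definition _ (S T : comNzRingType) (f : {rmorphism S -> T}) :=
  GRing.isMonoidMorphism.Build (cpx S) (cpx T) (cpx_map f) (cpx_map_is_monoid_morphism f).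

Section CpxOf.
Variable S : comNzRingType.
Definition cre (a : S) : cpx S := cpx_of 0 a.

Lemma cre_is_zmod_morphism : zmod_morphism cre.
Proof. by move=> a b; rewrite /cre /cpx_of cpx_subE subr0. Qed.
Lemma cre_is_monoid_morphism : monoid_morphism cre.
Proof.
split; first by [].
by move=> a b; rewrite /cre /cpx_of cpx_mulE !mul0r mulr0 subr0 addr0.
Qed.
HB.instance Definition _ := GRing.isZmodMorphism.Build S (cpx S) cre cre_is_zmod_morphism.
HB.instance Definition _ := GRing.isMonoidMorphism.Build S (cpx S) cre cre_is_monoid_morphism.

Definition cim : cpx S := Complex 0 1.

Lemma cpx_decomp (a b : S) : (Complex a b : cpx S) = cre a + cim * cre b.
Proof. by rewrite /cre /cpx_of /cim cpx_mulE cpx_addE !mul0r mulr0 mul1r subr0 addr0 !add0r. Qed.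

Lemma cre_inj : injective cre.
Proof. by move=> a b []. Qed.

Definition cconj (z : cpx S) : cpx S := let: Complex a b := z in Complex a (- b).

Lemma cconj_is_zmod_morphism : zmod_morphism cconj.
Proof. by move=> [a b] [c d]; rewrite cpx_subE /cconj cpx_subE opprD. Qed.
Lemma cconj_is_monoid_morphism : monoid_morphism cconj.
Proof.
split; first by rewrite cpx_oneE /= oppr0.
by move=> [a b] [c d]; rewrite cpx_mulE /cconj cpx_mulE mulrNN mulrN mulNr opprD.
Qed.
HB.instance Definition _ := GRing.isZmodMorphism.Build (cpx S) (cpx S) cconj cconj_is_zmod_morphism.
HB.instance Definition _ := GRing.isMonoidMorphism.Build (cpx S) (cpx S) cconj cconj_is_monoid_morphism.

Lemma cconjK : involutive cconj.
Proof. by move=> [a b] /=; rewrite opprK. Qed.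

Lemma cconj_cre a : cconj (cre a) = cre a.
Proof. by rewrite /cconj /cre /cpx_of oppr0. Qed.

Lemma mul_cconj (a b : S) : (Complex a b : cpx S) * Complex a (- b) = cre (a * a + b * b).
Proof. by rewrite cpx_mulE /cre /cpx_of mulrN opprK mulrN [a * b]mulrC addNr. Qed.

Lemma cim2 : cim * cim = -1.
Proof. by rewrite /cim cpx_mulE cpx_oneE cpx_oppE !mul0r mulr0 mul1r sub0r addr0 oppr0. Qed.
End CpxOf.

Lemma cpx_map_cre (S T : comNzRingType) (f : {rmorphism S -> T}) a :
  cpx_map f (cre a) = cre (f a).
Proof. by rewrite /cre /cpx_of /= rmorph0. Qed.

Lemma cpx_map_cim (S T : comNzRingType) (f : {rmorphism S -> T}) :
  cpx_map f (cim S) = cim T.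
Proof. by rewrite /= rmorph0 rmorph1. Qed.

Lemma cpx_extend (S T : comNzRingType) (f : {rmorphism S -> T}) (j : T) : j * j = -1 ->
  exists g : {rmorphism cpx S -> T}, forall a b, g (Complex a b) = f a + j * f b.
Proof.
move=> jj.
have [|z w w'||||g gP] := @rmorph_of_rel (cpx S) T (fun z w => forall a b, z = Complex a b -> w = f a + j * f b).
- by move=> [a b]; exists (f a + j * f b) => _ _ [<- <-].
- by case: z => a b H H'; rewrite (H a b) // (H' a b).
- by move=> _ _ [<- <-]; rewrite rmorph1 rmorph0 mulr0 addr0.
- move=> [a b] w [a' b'] w' /(_ a b erefl) -> /(_ a' b' erefl) -> c d.
  by rewrite cpx_subE => -[<- <-]; rewrite !rmorphB; ring.
- move=> [a b] w [a' b'] w' /(_ a b erefl) -> /(_ a' b' erefl) -> c d.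
  rewrite cpx_mulE => -[<- <-]; rewrite rmorphB rmorphD !rmorphM.
  transitivity (f a * f a' + (j * j) * (f b * f b') + j * (f a * f b' + f b * f a')); first by ring.
  by rewrite jj mulN1r.
by exists g => a b; rewrite (gP (Complex a b) a b).
Qed.

(** * Simple Noetherian difference rings *)

Section SimpleNoetherian.
Variables (R : comNzRingType) (phi : {rmorphism R -> R}).
Hypotheses (phi_surj : forall x, exists y, x = phi y) (phi_inj : injective phi).
Hypotheses (simR : simple_diff_ring phi) (noR : noetherian R).

(** Otherwise there is a sequence with strictly growing annihilators, with [c n] killing [a n.+1]
    but not [a n]. The chain condition puts some [c n] in the ideal of the earlier ones, all of
    which kill [a n]. *)
Lemma maximal_annihilator : exists a : R, a != 0 /\
  forall b, b != 0 -> (forall x, x * a = 0 -> x * b = 0) -> forall x, x * b = 0 -> x * a = 0.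
Proof.
apply: contrapT => nex.
have ex_next (a : R) : exists bc : R * R, a != 0 ->
    [/\ bc.1 != 0, forall x, x * a = 0 -> x * bc.1 = 0, bc.2 * bc.1 = 0 & bc.2 * a != 0].
  have [->|a0] := eqVneq a 0; first by exists 0; rewrite eqxx.
  apply: contrapT => nbc; apply: nex; exists a; split=> // b b0 ab c cb.
  by apply/eqP/negPn/negP => ca; apply: nbc; exists (b, c).
have [nx nxP] := choice ex_next.
pose a n := iter n (fun a => (nx a).1) 1.
have a0 n : a n != 0.
  by elim: n => [|n IH]; [exact: oner_neq0 | rewrite /a iterS; have [] := nxP _ IH].
have aS n x : x * a n = 0 -> x * a n.+1 = 0.
  by have [_ H _ _] := nxP _ (a0 n); apply: H.
have amono n m x : (n <= m)%N -> x * a n = 0 -> x * a m = 0.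
  by move=> /subnK <-; elim: (m - n)%N => [//|d IH] /IH; apply: aS.
pose c n := (nx (a n)).2.
have [n cn] := noR c.
have : c n * a n = 0.
  apply: (cn (fun x => x * a n = 0)).
    split; first by rewrite mul0r.
    by split=> [x y x0 y0|r x x0]; rewrite ?mulrDl ?x0 ?y0 ?addr0 // -mulrA x0 mulr0.
  move=> _ [i ilt ->]; apply: (amono i.+1) => //.
  by have [_ _ H _] := nxP _ (a0 i).
by have [_ _ _ /eqP] := nxP _ (a0 n).
Qed.

(* The translates under phi of an element with prime annihilator generate the
   unit ideal, so finitely many of these primes intersect in 0. *)
Lemma prime_components : exists (r : nat) (a : 'I_r -> R),
  [/\ forall i j, i != j -> a i * a j = 0,
      forall x, (forall i, x * a i = 0) -> x = 0 &
      forall i x y, a i * (x * y) = 0 -> a i * x = 0 \/ a i * y = 0].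
Proof.
have [a [a0 amax]] := maximal_annihilator.
have aprime x y : a * (x * y) = 0 -> a * x = 0 \/ a * y = 0.
  move=> axy; have [ya|ya] := eqVneq (y * a) 0; first by right; rewrite mulrC.
  left; rewrite mulrC; apply: (amax (y * a)) => //.
    by move=> z za; rewrite mulrCA za mulr0.
  by rewrite mulrA mulrC.
pose s n := iter n phi a.
have s0 n : s n != 0.
  elim: n => [//|n IH]; apply: contraNneq IH => E.
  by apply/eqP/phi_inj; rewrite rmorph0.
have sprime n x y : s n * (x * y) = 0 -> s n * x = 0 \/ s n * y = 0.
  elim: n x y => [|n IH] x y; first exact: aprime.
  have [x' ->] := phi_surj x; have [y' ->] := phi_surj y.
  have -> : s n.+1 = phi (s n) by [].
  move=> E; have /IH [E'|E'] : s n * (x' * y') = 0.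
  - by apply: phi_inj; rewrite rmorph0 !rmorphM.
  - by left; rewrite -rmorphM E' rmorph0.
  - by right; rewrite -rmorphM E' rmorph0.
have idg N := ideal_gen_ideal (fun y => exists2 i, (i < N)%N & y = s i).
have [N genN] : exists N, ideal_gen (fun y => exists2 i, (i < N)%N & y = s i) 1.
  pose J x := exists N, ideal_gen (fun y => exists2 i, (i < N)%N & y = s i) x.
  have mono N N' x : (N <= N')%N -> ideal_gen (fun y => exists2 i, (i < N)%N & y = s i) x ->
      ideal_gen (fun y => exists2 i, (i < N')%N & y = s i) x.
    move=> le; apply: ideal_gen_mono => _ [i ilt ->]; apply: ideal_gen_sub.
    by exists i => //; apply: leq_trans le.
  have [| |J0|J1] := simR (I := J); last exact: J1.
  - split; first by exists 0%N; case: (idg 0%N).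
    split=> [x y [M Mx] [M' My]|r x [M Mx]]; last by exists M; apply: (idg M).2.2.
    exists (maxn M M'); apply: (idg _).2.1.
      exact: mono (leq_maxl _ _) Mx.
    exact: mono (leq_maxr _ _) My.
  - move=> x [M Mx]; exists M.+1.
    apply: (Mx (fun x => ideal_gen (fun y => exists2 i, (i < M.+1)%N & y = s i) (phi x))).
      split; first by rewrite rmorph0; case: (idg M.+1).
      split=> [y z|r y]; rewrite ?rmorphD ?rmorphM; first exact: (idg _).2.1.
      exact: (idg _).2.2.
    by move=> _ [i ilt ->]; apply: ideal_gen_sub; exists i.+1.
  - have E : a = 0 by apply: J0; exists 1%N; apply: ideal_gen_sub; exists 0%N.
    by rewrite E eqxx in a0.
have annP x : (forall i, (i < N)%N -> x * s i = 0) -> x = 0.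
  move=> xs; rewrite -[x]mulr1; apply: (genN (fun y => x * y = 0)).
    split; first by rewrite mulr0.
    by split=> [y z xy xz|r y xy]; rewrite ?mulrDr ?xy ?xz ?addr0 // mulrCA xy mulr0.
  by move=> _ [i ilt ->]; apply: xs.
(* If s m * s n is nonzero, primeness puts the annihilator of [s m] inside that of [s n], so [s n]
   adds nothing to the intersection and is replaced by 0. The terms that remain are pairwise
   orthogonal. *)
pose first (n : 'I_N) := `[< forall m, (m < n)%N -> s m * s n = 0 >].
exists N, (fun n => if first n then s n else 0); split.
- move=> i j; wlog lt : i j / (i < j)%N.
    move=> H ij; case: (ltngtP i j) => [lt|lt|E]; first exact: H.
      by rewrite mulrC; apply: H => //; rewrite eq_sym.
    by rewrite (val_inj E) eqxx in ij.
  move=> _; case: ifP => _; last by rewrite mul0r.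
  by case: ifP => [/asboolP H|_]; [exact: H | rewrite mulr0].
- move=> x xs; apply: (annP x) => i; elim/ltn_ind: i => i IH iN.
  have := xs (Ordinal iN); case: ifP => // /asboolPn nf _.
  have /existsNP [m /not_implyP [/= mi smi]] := nf.
  have xm := IH m mi (ltn_trans mi iN).
  have [||] := sprime i (s m) x; first by rewrite [s m * x]mulrC xm mulr0.
    by rewrite mulrC => /smi.
  by rewrite mulrC.
- by move=> i x y; case: ifP => _; [apply: sprime | rewrite !mul0r; left].
Qed.
End SimpleNoetherian.

(** * The total ring of fractions as a finite product of fields *)

Section TotalFractions.
Variables (R K : comNzRingType) (iR : {rmorphism R -> K}).
Hypothesis totK : total_ring_of_fractions iR.
Variables (r : nat) (a : 'I_r -> R).
Hypotheses (orth : forall i j, i != j -> a i * a j = 0)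
  (annP : forall x, (forall i, x * a i = 0) -> x = 0)
  (prim : forall i x y, a i * (x * y) = 0 -> a i * x = 0 \/ a i * y = 0).

(** The sum of the [a j] is a non-zero-divisor, because the annihilators intersect in zero and [R]
    is reduced; dividing each [a i] by this sum gives the idempotents. *)
Lemma fractions_field_dec : exists e : 'I_r -> K, field_dec e.
Proof.
have [injR [invR fracR]] := totK.
have red (x : R) : x * x = 0 -> x = 0.
  by move=> xx; apply: (annP _) => i; rewrite mulrC; have [] := @prim i x x; rewrite ?xx ?mulr0.
have nzdP t : (forall i, a i != 0 -> a i * t != 0) -> nzd t.
  move=> nt y ty; apply: (annP _) => i; have [->|ai] := eqVneq (a i) 0; first by rewrite mulr0.
  have [||] := @prim i t y; first by rewrite ty mulr0.
    by move=> E; have := nt i ai; rewrite E eqxx.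
  by rewrite mulrC.
have aa i : a i != 0 -> a i * a i != 0 by apply: contra_neq => /red.
have sumE i (f : 'I_r -> R) : a i * \sum_j a j * f j = a i * a i * f i.
  rewrite mulr_sumr (bigD1 i) //= big1 ?addr0 ?mulrA // => j ji.
  by rewrite mulrA orth ?mul0r // eq_sym.
pose s := \sum_j a j * 1.
have nzs : nzd s by apply: nzdP => i ai; rewrite sumE mulr1 aa.
have [u su] := invR s nzs.
pose e i := iR (a i) * u.
have e_orth i j : i != j -> e i * e j = 0.
  by move=> ij; rewrite /e mulrACA -rmorphM orth // rmorph0 mul0r.
have e_sum : \sum_i e i = 1.
  rewrite -su /s rmorph_sum mulr_suml; apply: eq_bigr => i _.
  by rewrite mulr1.
have e_id i : e i * e i = e i.
  rewrite -[RHS]mulr1 -e_sum mulr_sumr (bigD1 i) //= big1 ?addr0 // => j ji.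
  by apply: e_orth; rewrite eq_sym.
exists e; split=> //.
  by move=> i j; case: eqP => [<-|/eqP]; [exact: e_id | exact: e_orth].
move=> i x ex; have [p [q [nzq xq]]] := fracR x.
have [q' qq'] := invR q nzq.
have aip : a i * p != 0.
  apply: contraNneq ex => aip.
  apply/eqP; rewrite /e -[x]mulr1 -qq'; transitivity (u * (iR (a i) * (x * iR q)) * q'); first by ring.
  by rewrite xq -rmorphM aip rmorph0 mulr0 mul0r.
(* Up to the factors [a j], this is [p] in component [i] and 1 in the others, hence a
   non-zero-divisor whose inverse serves to invert [x] in component [i]. *)
pose t := \sum_j a j * (if j == i then p else 1).
have [|v tv] := invR t.
  apply: nzdP => j aj; rewrite sumE; have [->|_] := eqVneq j i; last by rewrite mulr1 aa.
  rewrite -mulrA; apply/eqP => /prim [E|E]; last by rewrite E eqxx in aip.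
  have /eqP := aip; apply; have ->: a i = 0 by apply: red.
  by rewrite mul0r.
exists (iR q * iR (a i) * v).
have et : e i * iR t = e i * (iR (a i) * iR p).
  transitivity (iR (a i * t) * u); first by rewrite rmorphM /e; ring.
  by rewrite sumE eqxx !rmorphM /e; ring.
transitivity (e i * (iR (a i) * (x * iR q)) * v); first by ring.
by rewrite xq -et -mulrA tv mulr1.
Qed.
End TotalFractions.

(** * Reality, and K[i] as a product of fields *)

Section RealDec.
Variables (K : comNzRingType) (r : nat) (e : 'I_r -> K).
Hypotheses (dec : field_dec e) (realK : real_tot_ring K).

Lemma dec_real i u v : e i * (u * u + v * v) = 0 -> e i * u = 0 /\ e i * v = 0.
Proof.
move=> E; have [ei|ei] := eqVneq (e i) 0; first by rewrite ei !mul0r.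
have [_ _ fld] := dec; have eid := dec_id dec i.
have fac : ideal_factor_is_field (e i).
  split=> //; split=> // x /fld [y ey]; exists y.
  by transitivity (e i * (e i * x * y)); [ring | rewrite ey].
have one w : e i * (w * w) = 0 -> e i * w = 0.
  move=> ww; apply/eqP/negPn/negP => ew.
  have := realK fac (s := [:: w]) isT; rewrite /= ew => /(_ isT).
  rewrite big_seq1 expr2; have -> : e i * w * (e i * w) = e i * (e i * (w * w)) by ring.
  by rewrite ww mulr0 eqxx.
have [eu|eu] := eqVneq (e i * u) 0.
  split=> //; apply: one; move: E; rewrite mulrDr.
  by rewrite mulrA eu mul0r add0r.
have [ev|ev] := eqVneq (e i * v) 0.
  split=> //; apply: one; move: E; rewrite mulrDr [e i * (v * v)]mulrA ev mul0r addr0 //.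
have := realK fac (s := [:: u; v]) isT; rewrite /= eu ev => /(_ isT).
rewrite big_cons big_seq1 !expr2.
have -> : e i * u * (e i * u) + e i * v * (e i * v) = e i * (e i * (u * u + v * v)) by ring.
by rewrite E mulr0 eqxx.
Qed.

(** In a real factor a^2 + b^2 vanishes only if a and b do, so a + ib is inverted by its conjugate
    divided by its norm. *)
Lemma cpx_field_dec : field_dec (fun i => cre (e i)).
Proof.
have [orth e1 fld] := dec; split.
- by move=> i j; rewrite -rmorphM orth; case: ifP; rewrite ?rmorph0.
- by rewrite -rmorph_sum e1.
move=> i [a b]; rewrite /cre /cpx_of cpx_mulE !mul0r subr0 addr0 => n0.
have [|y ey] := fld i (a * a + b * b).
  apply: contraNneq n0 => /dec_real [-> ->]; exact: eqxx.
exists (Complex (a * y) (- (b * y))); rewrite cpx_mulE.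
by congr Complex; [rewrite -[RHS]ey; ring | ring].
Qed.

End RealDec.

Section CmorDef.
Variables (C : rcfType) (T : comNzRingType) (f : {rmorphism C -> T}).
Definition cmor (z : complex C) : cpx T := let: Complex a b := z in Complex (f a) (f b).

Lemma cmor_is_zmod_morphism : zmod_morphism cmor.
Proof.
move=> [a b] [c d]; transitivity (Complex (f (a - c)) (f (b - d)) : cpx T) => //.
by rewrite !rmorphB.
Qed.
Lemma cmor_is_monoid_morphism : monoid_morphism cmor.
Proof.
split; first by rewrite /cmor /= rmorph1 rmorph0.
move=> [a b] [c d].
transitivity (Complex (f (a * c - b * d)) (f (a * d + b * c)) : cpx T) => //.
by rewrite rmorphB rmorphD !rmorphM.
Qed.
HB.instance Definition _ := GRing.isZmodMorphism.Build (complex C) (cpx T) cmor cmor_is_zmod_morphism.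
HB.instance Definition _ := GRing.isMonoidMorphism.Build (complex C) (cpx T) cmor cmor_is_monoid_morphism.
End CmorDef.

Lemma complex_root_closed (C : rcfType) : root_closed (complex C).
Proof.
move=> p sp; apply/closed_rootP; rewrite neq_ltn sp orbT //.
Qed.

(** * Picard-Vessiot extensions *)

Section PV.
Variables (k : fieldType) (phik : {rmorphism k -> k}) (C : rcfType) (iC : {rmorphism C -> k}).
Hypotheses (char0k : char0 k) (HC : forall x : k, phik x = x <-> exists c : C, x = iC c).
Variables (n : nat) (A : 'M[k]_n).
Variables (R : comNzRingType) (phiR : {rmorphism R -> R}) (ik : {rmorphism k -> R}).
Variables (U V : 'M[R]_n) (d : R).
Hypotheses (phi_surj : forall x, exists y, x = phiR y) (phi_inj : injective phiR).
Hypothesis phi_ik : forall c, phiR (ik c) = ik (phik c).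
Hypotheses (UV : U *m V = 1%:M) (VU : V *m U = 1%:M).
Hypothesis phiU : map_mx phiR U = map_mx ik A *m U.
Hypothesis dU : d * \det U = 1.
Hypothesis genR : forall P : R -> Prop, is_subring P -> (forall c, P (ik c)) ->
  (forall i j, P (U i j)) -> P d -> forall x, P x.
Hypothesis simR : simple_diff_ring phiR.
Variables (K : comNzRingType) (iR : {rmorphism R -> K}) (phiK : {rmorphism K -> K}).
Hypotheses (totK : total_ring_of_fractions iR) (phiK_iR : forall x, phiK (iR x) = iR (phiR x)).
Hypothesis realK : real_tot_ring K.

(** * The constants of [R] and of [K] *)

Let gensR : seq R := d :: [seq U p.1 p.2 | p <- enum (('I_n * 'I_n)%type : finType)].

Lemma gensRP : generated_over ik gensR.
Proof.
move=> P subP Pk Py; apply: genR => //; last by apply: Py; rewrite mem_head.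
move=> i j; apply: Py; rewrite inE; apply/orP; right.
by apply/mapP; exists (i, j) => //; rewrite mem_enum.
Qed.

Lemma decK : exists r (e : 'I_r -> K), field_dec e.
Proof.
have noR := noetherian_fg gensRP.
have [r [a [orth annP prim]]] := prime_components phi_surj phi_inj simR noR.
by exists r; apply: (fractions_field_dec totK orth annP prim).
Qed.

Lemma iR_inj : injective iR. Proof. by case: totK. Qed.

Lemma const_unit x : phiR x = x -> x != 0 -> exists y, y * x = 1.
Proof.
move=> px x0; have [||J0|J1] := simR (I := fun z => exists y, y * x = z).
- split; first by exists 0; rewrite mul0r.
  split=> [_ _ [y <-] [z <-]|z _ [y <-]]; first by exists (y + z); rewrite mulrDl.
  by exists (z * y); rewrite mulrA.
- by move=> _ [y <-]; exists (phiR y); rewrite rmorphM px.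
- by have := J0 x (ex_intro _ 1 (mul1r x)) => /eqP; rewrite (negbTE x0).
- exact: J1.
Qed.

Let ev (x : R) (g : {poly k}) : R := (map_poly ik g).[x].

Let evD x : {morph ev x : g h / g - h}.
Proof. by move=> g h; rewrite /ev rmorphB hornerD hornerN. Qed.
Let evM x : {morph ev x : g h / g * h}.
Proof. by move=> g h; rewrite /ev rmorphM hornerM. Qed.
Let ev1 x : ev x 1 = 1.
Proof. by rewrite /ev rmorph1 hornerC. Qed.

(** If [x] were transcendental, some integer m would allow the specialization X -> m of k[X] to
    extend to the image of [R] in one component. It would send x - m to 0, although x - m is a
    nonzero constant and hence a unit. *)
Lemma const_algebraic x : phiR x = x -> exists g, g != 0 /\ ev x g = 0.
Proof.
move=> px; apply: contrapT => ntr.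
have [r [e dec]] := decK.
(* If [x] satisfied a relation in every component, the product of these relations would hold in
   [R]. *)
have [i ei] : exists i, forall g, g != 0 -> e i * iR (ev x g) != 0.
  apply: contrapT => nex.
  have ex_g i : exists g, g != 0 /\ e i * iR (ev x g) = 0.
    apply: contrapT => ng; apply: nex; exists i => g g0; apply/eqP => E.
    by apply: ng; exists g.
  have [g gP] := choice ex_g; apply: ntr; exists (\prod_i g i); split.
    by apply/prodf_neq0 => i _; case: (gP i).
  apply: iR_inj; rewrite rmorph0; apply: (dec_ext dec) => i; rewrite mulr0.
  by rewrite (bigD1 i) //= evM rmorphM mulrA (gP i).2 mul0r.
have [|M [p pP]] := dec_component dec (i := i).
  have := ei 1 (oner_neq0 _); rewrite ev1 rmorph1 mulr1 //.
have [B [f [injf imf]]] : exists (B : idomainType) (f : {rmorphism B -> M}), injective f /\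
    forall y, (exists r, y = p (iR r)) <-> exists b, y = f b.
  apply: subring_idomain; split; first by exists 0; rewrite !rmorph0.
  split; first by exists 1; rewrite !rmorph1.
  split=> _ _ [a ->] [b ->]; first by exists (a - b); rewrite !rmorphB.
  by exists (a * b); rewrite !rmorphM.
have [|a b b'||||rho rhoP] := @rmorph_of_rel R B (fun a b => f b = p (iR a)).
- move=> a; have /imf [b E] : exists r, p (iR a) = p (iR r) by exists a.
  by exists b.
- by move=> <- /injf.
- by rewrite !rmorph1.
- by move=> a b a' b'; rewrite !rmorphB => -> ->.
- by move=> a b a' b'; rewrite !rmorphM => -> ->.
have rho_surj b : exists a, b = rho a.
  have /imf [a E] : exists b', f b = f b' by exists b.
  by exists a; apply: injf; rewrite rhoP.
have [|g b b'||||iB iBP] := @rmorph_of_rel {poly k} B (fun g b => b = rho (ev x g)).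
- by move=> g; exists (rho (ev x g)).
- by move=> -> ->.
- by rewrite ev1 rmorph1.
- by move=> g b g' b' -> ->; rewrite evD rmorphB.
- by move=> g b g' b' -> ->; rewrite evM rmorphM.
have injB : injective iB.
  move=> g g' E; apply/eqP; rewrite -subr_eq0; apply/negPn/negP => /ei /eqP; apply.
  by apply/pP; rewrite -rhoP -iBP rmorphB E subrr rmorph0.
have genB : generated_over iB [seq rho y | y <- gensR].
  move=> P subP Pi Py b; have [a ->] := rho_surj b.
  have [P0 [P1 [PB PM]]] := subP.
  apply: (gensRP (P := fun a => P (rho a))).
  - split; first by rewrite rmorph0.
    split; first by rewrite rmorph1.
    by split=> u v Pu Pv; rewrite ?rmorphB ?rmorphM; [apply: PB | apply: PM].
  - move=> c; have -> : ik c = ev x c%:P by rewrite /ev map_polyC hornerC.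
    by rewrite -iBP.
  - by move=> y yg; apply: Py; apply: map_f.
have [alpha [a0 ext]] := hom_ext injB genB (oner_neq0 B).
have [m am] := char0_nonroot char0k a0.
have [Om [io [psi [psiE psi1 _]]]] := ext k (horner_eval m%:R) char0k am.
have [||y yx] := const_unit (x := x - m%:R).
- by rewrite rmorphB rmorph_nat px.
- apply/negP => /eqP E; apply: ntr; exists ('X - m%:R%:P); split; first by rewrite polyXsubC_eq0.
  by rewrite /ev rmorphB /= map_polyX map_polyC hornerD hornerN hornerX hornerC /= rmorph_nat.
have := psiE ('X - m%:R%:P); rewrite /= /horner_eval hornerXsubC subrr rmorph0 iBP.
rewrite /ev rmorphB /= map_polyX map_polyC hornerD hornerN hornerX hornerC /= rmorph_nat => E.
have := congr1 (psi \o rho) yx; rewrite /= !rmorphM E mulr0 !rmorph1 => /esym /eqP.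
by rewrite oner_eq0.
Qed.

(** The monic polynomial of least degree over [k] that kills [x] is mapped by [phik] to another one,
    so its coefficients are constants. *)
Lemma const_algebraic_C x : phiR x = x ->
  exists h : {poly C}, h != 0 /\ (map_poly (ik \o iC) h).[x] = 0.
Proof.
move=> px; have [g [[g0 gx] min]] := classical_min (fun g : {poly k} => size g) (const_algebraic px).
have lg0 : lead_coef g != 0 by rewrite lead_coef_eq0.
pose g1 := (lead_coef g)^-1 *: g.
have g1x : ev x g1 = 0 by rewrite /g1 -mul_polyC evM gx mulr0.
have sg1 : size g1 = size g by rewrite size_scale // invr_eq0.
have lg1 : g1`_(size g).-1 = 1 by rewrite coefZ -lead_coefE mulVf.
have pg1x : ev x (map_poly phik g1) = 0.
  rewrite /ev -map_poly_comp -[RHS](rmorph0 phiR) -g1x /ev -horner_map px -map_poly_comp.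
  by congr (_.[_]); apply: eq_map_poly => c /=; rewrite phi_ik.
have E : map_poly phik g1 = g1.
  apply/eqP; rewrite -subr_eq0; apply/negPn/negP => n0.
  have := min _ (conj n0 _); rewrite evD pg1x g1x subrr => /(_ erefl).
  rewrite leqNgt => /negP; apply.
  have sg : (0 < size g)%N by rewrite size_poly_gt0.
  rewrite -(prednK sg) ltnS; apply/leq_sizeP => j; rewrite leq_eqVlt => /orP [/eqP <-|lt].
    by rewrite coefB coef_map /= lg1 rmorph1 subrr.
  have le : (size g <= j)%N by rewrite -(prednK sg).
  by rewrite coefB coef_map /= nth_default ?rmorph0 ?subrr // sg1.
have ex_c j : exists c, g1`_j = iC c by apply/HC; rewrite -[in RHS]E coef_map.
have [c cP] := choice ex_c.
exists (\poly_(j < size g) c j).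
have Eh : map_poly iC (\poly_(j < size g) c j) = g1.
  apply/polyP => j; rewrite coef_map coef_poly /=; case: ltnP => // le.
  by rewrite rmorph0 nth_default // sg1.
split; last by rewrite map_poly_comp Eh.
by rewrite -(map_poly_eq0 iC) Eh -size_poly_gt0 sg1 size_poly_gt0.
Qed.

(** The polynomial h splits over C[i]. If [x] were outside [C], each factor x - (a + ib) would be a
    unit of R[i], its norm being a constant that is nonzero by reality; yet the product of the
    factors is zero. *)
Lemma const_R x : phiR x = x -> exists c, x = ik (iC c).
Proof.
move=> px; have [h [h0 hx]] := const_algebraic_C px.
apply: contrapT => nex.
have unit_fac z : exists w, w * (cre x - cmor (ik \o iC) z) = 1 :> cpx R.
  case: z => a b /=; rewrite /cre /cpx_of cpx_subE sub0r.
  set u := x - _; set v := ik _.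
  have pu : phiR u = u by rewrite rmorphB px phi_ik (HC _).2 //; exists a.
  have pv : phiR v = v by rewrite phi_ik (HC _).2 //; exists b.
  have [||y yuv] := const_unit (x := u * u + v * v); first by rewrite rmorphD !rmorphM pu pv.
    apply/eqP => E; have [r [e dec]] := decK.
    have iRu : iR u = 0.
      apply: (dec_ext dec) => i; rewrite mulr0.
      have [] := dec_real dec realK (i := i) (u := iR u) (v := iR v) => //.
      by have := congr1 iR E; rewrite rmorphD !(rmorphM iR) rmorph0 => ->; rewrite mulr0.
    apply: nex; exists a; apply/eqP; rewrite -subr_eq0; apply/eqP/iR_inj.
    by rewrite rmorph0.
  exists (Complex (y * u) (y * v)); rewrite cpx_mulE cpx_oneE.
  by congr Complex; [rewrite -yuv; ring | ring].
have [rs Ers] := closed_field_poly_normal (map_poly (real_complex C) h).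
have lh0 : lead_coef (map_poly (real_complex C) h) != 0 by rewrite lead_coef_eq0 map_poly_eq0.
have Eh : (map_poly (cmor (ik \o iC)) (map_poly (real_complex C) h)).[cre x] = 0.
  rewrite -map_poly_comp -[RHS](rmorph0 (@cre R)) -hx -horner_map -map_poly_comp.
  by congr (_.[_]); apply: eq_map_poly => c; rewrite /= /cre /cpx_of !rmorph0.
move: Eh; rewrite Ers -mul_polyC rmorphM hornerM /= map_polyC hornerC /=.
rewrite rmorph_prod horner_prod => Eh.
have : cmor (ik \o iC) (lead_coef (map_poly (real_complex C) h))^-1 *
   cmor (ik \o iC) (lead_coef (map_poly (real_complex C) h)) = 1.
  by rewrite -rmorphM mulVf // rmorph1.
have : exists w : cpx R, w * \prod_(z <- rs) (map_poly (cmor (ik \o iC)) ('X - z%:P)).[cre x] = 1.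
  elim: (rs) => [|z s [w ws]]; first by exists 1; rewrite big_nil mul1r.
  have [w' w'z] := unit_fac z; exists (w' * w); rewrite big_cons rmorphB /= map_polyX map_polyC.
  by rewrite hornerD hornerN hornerX hornerC /= mulrACA w'z mul1r ws.
move=> [w ws] lc; have key (a b w' p : cpx R) : a * b = 1 -> w' * p = 1 -> b * p = 0 -> False.
  move=> ab wp bp; have /eqP := oner_neq0 (cpx R); apply.
  transitivity ((a * b) * (w' * p)); first by rewrite ab wp mul1r.
  by transitivity (a * w' * (b * p)); [ring | rewrite bp mulr0].
exact: key lc ws Eh.
Qed.

(** The denominators of a constant form a stable ideal of [R], so 1 is one of them. *)
Lemma const_K x : phiK x = x -> exists c, x = iR (ik (iC c)).
Proof.
move=> px; have [_ [invR fracR]] := totK.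
have [a [s [nzs xs]]] := fracR x.
suff [r Er] : exists r, x = iR r.
  have [|c Ec] := const_R (x := r); last by exists c; rewrite -Ec.
  by apply: iR_inj; rewrite -phiK_iR -Er.
have [||J0|J1] := simR (I := fun t => exists r, x * iR t = iR r).
- split; first by exists 0; rewrite rmorph0 mulr0.
  split=> [u v [r Er] [r' Er']|u v [r Er]].
    by exists (r + r'); rewrite !rmorphD mulrDr Er Er'.
  by exists (u * r); rewrite !rmorphM mulrCA Er.
- by move=> t [r Er]; exists (phiR r); rewrite -!phiK_iR -Er rmorphM px.
- have s0 : s = 0 by apply: J0; exists a.
  by have := nzs 1; rewrite s0 mul0r => /(_ erefl) /eqP; rewrite oner_eq0.
- by have [r Er] := J1 1; exists r; rewrite -Er rmorph1 mulr1.
Qed.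

Arguments cre : simpl never.
Arguments cconj : simpl never.
Arguments cpx_map : simpl never.
Arguments cmor : simpl never.

(** * The ring R[i], and extension of its automorphisms to K[i] *)

Lemma hom_eqR (T : comNzRingType) (f g : {rmorphism R -> T}) :
  (forall c, f (ik c) = g (ik c)) -> (forall i j, f (U i j) = g (U i j)) -> f =1 g.
Proof.
move=> fgk fgU; apply: genR => //.
- split; first by rewrite !rmorph0.
  split; first by rewrite !rmorph1.
  by split=> x y fx fy; rewrite ?rmorphB ?rmorphM fx fy.
- have fg_det : f (\det U) = g (\det U).
    by rewrite -!det_map_mx; congr (\det _); apply/matrixP => i j; rewrite !mxE.
  have fd : f d * f (\det U) = 1 by rewrite -rmorphM dU rmorph1.
  have gd : g d * g (\det U) = 1 by rewrite -rmorphM dU rmorph1.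
  transitivity (f d * (g d * g (\det U))); first by rewrite gd mulr1.
  by rewrite -fg_det mulrCA fd mulr1.
Qed.

Lemma poly_rep x : exists (Q : {mpoly k[n * n]}) m, x * \det U ^+ m = evmx ik U Q.
Proof.
apply: (genR (P := fun x => exists (Q : {mpoly k[n * n]}) m, x * \det U ^+ m = evmx ik U Q)).
- split; first by exists 0, 0%N; rewrite mul0r rmorph0.
  split; first by exists 1, 0%N; rewrite mulr1 rmorph1.
  split=> u v [Q [m E]] [Q' [m' E']].
    exists (Q * \det (genmx k n) ^+ m' - Q' * \det (genmx k n) ^+ m), (m + m')%N.
    rewrite rmorphB !rmorphM !rmorphXn /= evmx_det -E -E' exprD; ring.
  exists (Q * Q'), (m + m')%N; rewrite rmorphM /= -E -E' exprD; ring.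
- by move=> c; exists c%:MP, 0%N; rewrite mulr1 mmapC.
- by move=> i j; exists (genmx k n i j), 0%N; rewrite mulr1 evmx_entry.
- by exists 1, 1%N; rewrite expr1 dU rmorph1.
Qed.

(** The real parts of the elements of an ideal form a stable ideal of [R]. If 1 is one of them, say
    1 + ib is in the ideal, so is the norm 1 + b^2, which is nonzero by reality; hence the trace of
    the ideal on [R] is all of [R]. *)
Lemma cpx_simple : simple_diff_ring (cpx_map phiR : cpx R -> cpx R).
Proof.
move=> I idI Iphi.
have [I0 [ID IM]] := idI.
have [||J0|J1] := simR (I := fun a => exists b, I (Complex a b)).
- split; first by exists 0.
  split=> [a a' [b Iab] [b' Iab']|r a [b Iab]].
    by exists (b + b'); rewrite -cpx_addE; apply: ID.
  have := IM (cre r) _ Iab; rewrite /cre /cpx_of cpx_mulE mul0r subr0 => H.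
  by eexists; exact: H.
- by move=> a [b /Iphi Iab]; exists (phiR b).
- left=> -[a b] Iab; have a0 : a = 0 by apply: J0; exists b.
  have b0 : - b = 0.
    apply: J0; have := IM (cim R) _ Iab.
    rewrite /cim cpx_mulE mul0r sub0r mul1r => H; by eexists; exact: H.
  by rewrite a0 -[b]opprK b0 oppr0.
have [b Ib] := J1 1.
have [||J0|J1'] := simR (I := fun a => I (cre a)).
- split; first by rewrite rmorph0.
  by split=> [a a' Ia Ia'|r a Ia]; rewrite ?rmorphD ?rmorphM; [apply: ID | apply: IM].
- by move=> a /Iphi; rewrite cpx_map_cre.
- have E : 1 * 1 + b * b = 0 :> R.
    by apply: J0; rewrite -mul_cconj mulrC; apply: IM.
  have [r [e dec]] := decK.
  have [i ei] := dec_neq0 dec (oner_neq0 K).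
  have [] := dec_real dec realK (i := i) (u := 1) (v := iR b).
    by have := congr1 iR E; rewrite rmorphD !(rmorphM iR) rmorph0 rmorph1 => ->; rewrite mulr0.
  by move=> e0; rewrite e0 eqxx in ei.
right=> z; have := IM z _ (J1' 1); by rewrite rmorph1 mulr1.
Qed.

Definition unit_in (T : comNzRingType) (w : T) := exists y, w * y = 1.

Lemma nzd_cre (s : R) : nzd s -> nzd (cre s).
Proof.
move=> nzs [a b]; rewrite /cre /cpx_of cpx_mulE !mul0r subr0 addr0 => -[sa sb].
by rewrite (nzs _ sa) (nzs _ sb).
Qed.

Lemma nzd_cpx_unit (w : cpx R) : nzd w -> unit_in (cpx_map iR w).
Proof.
case: w => a b nzw; have [_ [invR _]] := totK.
have [|y Ey] := invR (a * a + b * b).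
  move=> y ny; have : (Complex a b : cpx R) * ((Complex a (- b) : cpx R) * cre y) = 0.
    by rewrite mulrA mul_cconj -rmorphM ny rmorph0.
  move=> /nzw E.
  have Ec : cconj (Complex a (- b) : cpx R) = Complex a b by rewrite /cconj opprK.
  have /nzw E' : (Complex a b : cpx R) * cre y = 0.
    by rewrite -Ec -[cre y]cconj_cre -rmorphM E rmorph0.
  by apply: (@cre_inj R); rewrite E' rmorph0.
exists (cpx_map iR (Complex a (- b) : cpx R) * cre y).
by rewrite mulrA -rmorphM mul_cconj /= cpx_map_cre -rmorphM Ey rmorph1.
Qed.

Lemma nzd_bij (T : comNzRingType) (s : {rmorphism T -> T}) w : bijective s -> nzd w -> nzd (s w).
Proof.
move=> [s' sK s'K] nzw y E; rewrite -[y]s'K (nzw (s' y)) ?rmorph0 //.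
by apply: (can_inj sK); rewrite rmorphM s'K E rmorph0.
Qed.

Lemma frac_cpx (z : cpx K) : exists (ze : cpx R) s, nzd s /\ z * cre (iR s) = cpx_map iR ze.
Proof.
have [_ [_ fracR]] := totK.
case: z => a b; have [p [s [nzs Es]]] := fracR a; have [q [t [nzt Et]]] := fracR b.
exists (Complex (p * t) (q * s)), (s * t); split.
  by move=> y; rewrite -mulrA => /nzs /nzt.
rewrite /cre /cpx_of cpx_mulE !mulr0 subr0 add0r /cpx_map.
by rewrite !rmorphM -Es -Et; congr Complex; ring.
Qed.

Lemma cpx_map_iR_inj : injective (cpx_map iR : cpx R -> cpx K).
Proof. by move=> [a b] [a' b'] [/iR_inj -> /iR_inj ->]. Qed.

(** [fixes_in_K] quantifies over the extensions of an automorphism, so their existence keeps it from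
    being vacuous. Denominators are taken in [R], where both parts of an element of K[i] have a
    common one. *)
Lemma extend_to_fractions (s : {rmorphism cpx R -> cpx R}) : bijective s ->
  exists tau : {rmorphism cpx K -> cpx K}, forall z, tau (cpx_map iR z) = cpx_map iR (s z).
Proof.
move=> bs.
have su t : nzd t -> unit_in (cpx_map iR (s (cre t))).
  by move=> nzt; apply: nzd_cpx_unit; apply: nzd_bij => //; apply: nzd_cre.
pose Rel (z w : cpx K) := exists (ze : cpx R) t,
  [/\ nzd t, z * cre (iR t) = cpx_map iR ze & w * cpx_map iR (s (cre t)) = cpx_map iR (s ze)].
have nz1 : nzd (1 : R) by move=> y; rewrite mul1r.
have Rel_iR z : Rel (cpx_map iR z) (cpx_map iR (s z)).
  by exists z, 1; rewrite !rmorph1 !mulr1.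
have nzM (t t' : R) : nzd t -> nzd t' -> nzd (t * t').
  by move=> nt nt' y; rewrite -mulrA => /nt /nt'.
have [|z w w'||||tau tauP] := @rmorph_of_rel (cpx K) (cpx K) Rel.
- move=> z; have [ze [t [nzt Et]]] := frac_cpx z; have [y ty] := su t nzt.
  exists (cpx_map iR (s ze) * y), ze, t; split=> //.
  by rewrite -mulrA [y * _]mulrC ty mulr1.
- move=> [ze [t [nzt E1 E2]]] [ze' [t' [nzt' E1' E2']]].
  have E : ze * cre t' = ze' * cre t.
    apply: cpx_map_iR_inj; rewrite !rmorphM /= -E1 -E1' -!cpx_map_cre; ring.
  have [y ty] := su t nzt; have [y' ty'] := su t' nzt'.
  have := congr1 (cpx_map iR \o s) E; rewrite /= !rmorphM /= -E2 -E2' => E3.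
  rewrite -[w]mulr1 -[w']mulr1 -[X in w * X]mulr1 -{1}ty -{1}ty'.
  transitivity (w * cpx_map iR (s (cre t)) * cpx_map iR (s (cre t')) * (y * y')); first by ring.
  rewrite E3; transitivity (w' * (cpx_map iR (s (cre t')) * y') * (cpx_map iR (s (cre t)) * y)).
    by ring.
  by rewrite ty ty' !mulr1.
- by have := Rel_iR 1; rewrite !rmorph1.
- move=> z w z' w' [ze [t [nzt E1 E2]]] [ze' [t' [nzt' E1' E2']]].
  exists (ze * cre t' - ze' * cre t), (t * t'); split; first exact: nzM.
    by rewrite rmorphB !rmorphM /= -E1 -E1' !cpx_map_cre; ring.
  by rewrite !rmorphB !rmorphM /= -E2 -E2'; ring.
- move=> z w z' w' [ze [t [nzt E1 E2]]] [ze' [t' [nzt' E1' E2']]].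
  exists (ze * ze'), (t * t'); split; first exact: nzM.
    by rewrite !rmorphM /= -E1 -E1'; ring.
  by rewrite !rmorphM /= -E2 -E2'; ring.
exists tau => z; have [ze [t [nzt E1 E2]]] := tauP (cpx_map iR z).
have E : ze = z * cre t.
  by apply: cpx_map_iR_inj; rewrite rmorphM /= -E1 cpx_map_cre.
have [y ty] := su t nzt.
rewrite E !rmorphM in E2.
have := congr1 (fun v => v * y) E2; by rewrite -!mulrA ty !mulr1.
Qed.

(** * Galois automorphisms and their matrices *)

Notation hR := (cmor (ik \o iC)).
Notation hK := (cmor (iR \o ik \o iC)).
Notation cU := (map_mx (@cre R) U).
Notation cUK := (map_mx (@cre K) (map_mx iR U)).
Notation gal s M := (is_real_gal phiR ik s /\ realizes iC ik U s M).
Notation extends tau s := (forall z : cpx R, tau (cpx_map iR z) = cpx_map iR (s z)).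

Lemma realizesE (s : {rmorphism cpx R -> cpx R}) M : realizes iC ik U s M ->
  map_mx s cU = cU *m map_mx hR M.
Proof. by []. Qed.

Lemma gal_unitmx s M : gal s M -> M \in unitmx.
Proof.
move=> [_ /realizesE E]; rewrite unitmxE unitfE; apply/eqP => M0.
have Ed : s (cre (\det U)) = cre (\det U) * hR (\det M).
  by rewrite -!det_map_mx E det_mulmx.
have : s (cre d) * s (cre (\det U)) = 1 by rewrite -!rmorphM dU !rmorph1.
by rewrite Ed M0 rmorph0 !mulr0 => /esym /eqP; rewrite oner_eq0.
Qed.

Lemma hR_fixed s : is_real_gal phiR ik s -> forall z, s (hR z) = hR z.
Proof. by move=> [_ [_ sk]] [a b]; apply: sk. Qed.

Lemma ik_fixed s : is_real_gal phiR ik s -> forall c, s (cre (ik c)) = cre (ik c).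
Proof. by move=> [_ [_ sk]] c; rewrite /cre /cpx_of -(rmorph0 ik); apply: sk. Qed.

Lemma cpx_map_hR z : cpx_map iR (hR z) = hK z.
Proof. by case: z. Qed.

Section Tau.
Variables (s : {rmorphism cpx R -> cpx R}) (M : 'M[complex C]_n).
Variable tau : {rmorphism cpx K -> cpx K}.
Hypotheses (gs : gal s M) (ext : extends tau s).

Lemma tau_hK z : tau (hK z) = hK z.
Proof. by rewrite -cpx_map_hR ext hR_fixed //; case: gs. Qed.

Lemma tau_U : map_mx tau cUK = cUK *m map_mx hK M.
Proof.
have [_ /realizesE E] := gs.
have EU : cUK = map_mx (cpx_map iR) cU.
  by apply/matrixP => i j; rewrite !mxE cpx_map_cre.
have H : map_mx tau (map_mx (cpx_map iR) cU) = map_mx (cpx_map iR) (map_mx s cU).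
  by apply/matrixP => i j; rewrite !mxE ext.
rewrite EU H E map_mxM; congr (_ *m _).
by apply/matrixP => i j; rewrite !mxE /= cpx_map_hR.
Qed.

Lemma tau_k c : tau (cre (iR (ik c))) = cre (iR (ik c)).
Proof. by rewrite -cpx_map_cre ext ik_fixed //; case: gs. Qed.

Lemma tau_inj : injective tau.
Proof.
have [[bs _] _] := gs.
move=> z z' E; apply/eqP; rewrite -subr_eq0; apply/eqP.
have {E} : tau (z - z') = 0 by rewrite rmorphB E subrr.
move: (z - z') => {z z'} z tz.
have [ze [t [nzt Et]]] := frac_cpx z.
have ze0 : ze = 0.
  have E : cpx_map iR (s ze) = cpx_map iR 0 by rewrite -ext -Et rmorphM tz mul0r rmorph0.
  by apply: (bij_inj bs); rewrite rmorph0; exact: cpx_map_iR_inj E.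
have [y ty] := nzd_cpx_unit (nzd_cre nzt).
rewrite -[z]mulr1 -ty cpx_map_cre mulrA Et ze0 rmorph0 mul0r //.
Qed.

Lemma tau_phi z : tau (cpx_map phiK z) = cpx_map phiK (tau z).
Proof.
have [[bs [sphi _]] _] := gs.
have phi_iR (w : cpx R) : cpx_map phiK (cpx_map iR w) = cpx_map iR (cpx_map phiR w).
  by case: w => a b; rewrite /cpx_map !phiK_iR.
have [ze [t [nzt Et]]] := frac_cpx z.
have [y ty] : unit_in (tau (cpx_map phiK (cre (iR t)))).
  rewrite -cpx_map_cre phi_iR ext sphi -phi_iR.
  have [w Ew] := nzd_cpx_unit (nzd_bij bs (nzd_cre nzt)).
  by exists (cpx_map phiK w); rewrite -rmorphM Ew rmorph1.
have E : tau (cpx_map phiK z) * tau (cpx_map phiK (cre (iR t))) =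
         cpx_map phiK (tau z) * tau (cpx_map phiK (cre (iR t))).
  transitivity (tau (cpx_map phiK (z * cre (iR t)))); first by rewrite !rmorphM.
  rewrite Et phi_iR ext sphi -phi_iR -ext -Et !rmorphM /=; congr (_ * _).
  by rewrite -cpx_map_cre ext !phi_iR ext sphi.
by have := congr1 (fun v => v * y) E; rewrite -!mulrA ty !mulr1.
Qed.

(** On values of polynomials with fixed coefficients, [tau] acts as left multiplication of the
    matrix by [M]. Stability of G(K/F) under products and inverses rests on this. *)
Lemma tau_evmx (Q : {mpoly K[n * n]}) N : (forall m, tau (cre Q@_m) = cre Q@_m) ->
  tau (evmx (@cre K) (cUK *m map_mx hK N) Q) = evmx (@cre K) (cUK *m map_mx hK (M *m N)) Q.
Proof.
move=> Qfix; rewrite evmx_hom map_mxM tau_U.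
have -> : map_mx tau (map_mx hK N) = map_mx hK N.
  by rewrite -map_mx_comp; apply: eq_map_mx => z /=; rewrite tau_hK.
rewrite -mulmxA -map_mxM /mmap; apply: eq_bigr => m _ /=.
by rewrite Qfix.
Qed.
End Tau.

Notation evU M Q := (evmx (@cre K) (cUK *m map_mx hK M) Q).

Lemma evU1 Q : evU 1%:M Q = cre (evmx idfun (map_mx iR U) Q).
Proof. by rewrite map_mx1 mulmx1 evmx_hom; apply: evmx_eqf. Qed.

Lemma evU_k M (Q : {mpoly k[n * n]}) :
  evU M (map_mpoly (iR \o ik) Q) = cpx_map iR (evmx (@cre R \o ik) (cU *m map_mx hR M) Q).
Proof.
rewrite evmx_map evmx_hom map_mxM -!map_mx_comp.
have -> : map_mx (cpx_map iR \o @cre R) U = map_mx (@cre K \o iR) U.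
  by apply: eq_map_mx => z /=; rewrite cpx_map_cre.
have -> : map_mx (cpx_map iR \o hR) M = map_mx hK M.
  by apply: eq_map_mx => z /=; rewrite cpx_map_hR.
by apply: evmx_eqf => c /=; rewrite cpx_map_cre.
Qed.

(** The relations over [k] make U -> U M well defined on [R]. The rest follows: compatibility with
    phi because [M] is constant, injectivity because R[i] is simple, surjectivity because [U] is the
    image of U M^-1. *)
Lemma gal_of_mx M : M \in unitmx ->
  (forall Q : {mpoly k[n * n]}, evmx ik U Q = 0 ->
     evmx (@cre R \o ik) (cU *m map_mx hR M) Q = 0) ->
  exists s, gal s M.
Proof.
move=> uM relM.
pose W := cU *m map_mx hR M.
have detW : \det W = cre (\det U) * hR (\det M) by rewrite det_mulmx !det_map_mx.
have [w Ew] : unit_in (\det W).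
  exists (cre d * hR (\det M)^-1).
  have Ed : cre d * cre (\det U) = 1 by rewrite -rmorphM dU rmorph1.
  have EM : hR (\det M) * hR (\det M)^-1 = 1.
    by rewrite -rmorphM mulfV ?rmorph1 // -unitfE -unitmxE.
  rewrite detW; transitivity ((cre d * cre (\det U)) * (hR (\det M) * hR (\det M)^-1)).
    by ring.
  by rewrite Ed EM mulr1.
have Wn m : \det W ^+ m * w ^+ m = 1 by rewrite -exprMn Ew expr1n.
pose ev' (Q : {mpoly k[n * n]}) := evmx (@cre R \o ik) W Q.
(* Elements of [R] are polynomials in [U] over powers of det U; numerator and denominator are
   evaluated at [W] instead. *)
pose Rel x y := exists (Q : {mpoly k[n * n]}) m, x * \det U ^+ m = evmx ik U Q /\ y * \det W ^+ m = ev' Q.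
pose D := \det (genmx k n).
have DU m : evmx ik U (D ^+ m) = \det U ^+ m by rewrite rmorphXn /= evmx_det.
have DW m : ev' (D ^+ m) = \det W ^+ m by rewrite /ev' rmorphXn /= evmx_det.
have evM' Q Q' : ev' (Q * Q') = ev' Q * ev' Q' by rewrite /ev' rmorphM.
have evB' Q Q' : ev' (Q - Q') = ev' Q - ev' Q' by rewrite /ev' rmorphB.
have [|x y y'||||s0 s0P] := @rmorph_of_rel R (cpx R) Rel.
- move=> x; have [Q [m E]] := poly_rep x; exists (ev' Q * w ^+ m), Q, m; split=> //.
  by rewrite -mulrA [w ^+ m * _]mulrC Wn mulr1.
- move=> [Q [m [E1 E2]]] [Q' [m' [E1' E2']]].
  have : ev' (Q * D ^+ m' - Q' * D ^+ m) = 0.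
    apply: relM; rewrite rmorphB !rmorphM /= !DU -E1 -E1'; ring.
  rewrite evB' !evM' !DW -E2 -E2' => E.
  have E3 : (y - y') * (\det W ^+ m * \det W ^+ m') = 0 by rewrite -E; ring.
  apply/eqP; rewrite -subr_eq0; apply/eqP.
  transitivity ((y - y') * (\det W ^+ m * w ^+ m) * (\det W ^+ m' * w ^+ m')).
    by rewrite !Wn !mulr1.
  transitivity ((y - y') * (\det W ^+ m * \det W ^+ m') * (w ^+ m * w ^+ m')); first by ring.
  by rewrite E3 mul0r.
- by exists 1, 0%N; rewrite !expr0 !mulr1 /ev' !rmorph1.
- move=> x y x' y' [Q [m [E1 E2]]] [Q' [m' [E1' E2']]].
  exists (Q * D ^+ m' - Q' * D ^+ m), (m + m')%N; split.
    by rewrite rmorphB !rmorphM /= !DU -E1 -E1' exprD; ring.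
  by rewrite evB' !evM' !DW -E2 -E2' exprD; ring.
- move=> x y x' y' [Q [m [E1 E2]]] [Q' [m' [E1' E2']]].
  exists (Q * Q'), (m + m')%N; split.
    by rewrite !rmorphM /= -E1 -E1' exprD; ring.
  by rewrite evM' -E2 -E2' exprD; ring.
have s0E x Q m : x * \det U ^+ m = evmx ik U Q -> s0 x * \det W ^+ m = ev' Q.
  move=> E; have [Q' [m' [E1' E2']]] := s0P x.
  have : ev' (Q * D ^+ m' - Q' * D ^+ m) = 0.
    apply: relM; rewrite rmorphB !rmorphM /= !DU -E -E1'; ring.
  rewrite evB' !evM' !DW -E2' => E3.
  rewrite -[LHS]mulr1 -[RHS]mulr1 -(Wn m') !mulrA; congr (_ * _).
  by apply/eqP; rewrite eq_sym -subr_eq0 -E3; apply/eqP; ring.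
have s0k c : s0 (ik c) = cre (ik c).
  have := s0E (ik c) c%:MP 0%N; rewrite !expr0 !mulr1 mmapC => /(_ erefl) ->.
  by rewrite /ev' mmapC.
have s0U i j : s0 (U i j) = W i j.
  have := s0E (U i j) (genmx k n i j) 0%N; rewrite !expr0 !mulr1 evmx_entry => /(_ erefl) ->.
  by rewrite /ev' evmx_entry.
have [s sE] := cpx_extend s0 (cim2 R).
have s_cre x : s (cre x) = s0 x by rewrite sE rmorph0 mulr0 addr0.
have s_cim : s (cim R) = cim R by rewrite sE rmorph0 rmorph1 mulr1 add0r.
have sk a b : s (Complex (ik a) (ik b)) = Complex (ik a) (ik b).
  by rewrite sE !s0k -cpx_decomp.
have sU : map_mx s cU = W.
  by apply/matrixP => i j; rewrite mxE [cU i j]mxE s_cre s0U.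
have shR z : s (hR z) = hR z by case: z => a b; apply: sk.
have sphi z : s (cpx_map phiR z) = cpx_map phiR (s z).
  suff H x : s0 (phiR x) = cpx_map phiR (s0 x).
    case: z => a b; have -> : cpx_map phiR (Complex a b : cpx R) = Complex (phiR a) (phiR b) by [].
    rewrite !sE !H.
    by rewrite rmorphD rmorphM /= cpx_map_cim.
  apply: (hom_eqR (f := s0 \o phiR) (g := cpx_map phiR \o s0)) => [c|i j] /=.
    by rewrite phi_ik !s0k cpx_map_cre phi_ik.
  have EW : map_mx (cpx_map phiR) W = map_mx (@cre R \o ik) A *m W.
    rewrite map_mxM -!map_mx_comp.
    have -> : map_mx (cpx_map phiR \o @cre R) U = map_mx (@cre R) (map_mx ik A *m U).
      by rewrite -phiU -map_mx_comp; apply: eq_map_mx => z' /=; rewrite cpx_map_cre.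
    have -> : map_mx (cpx_map phiR \o hR) M = map_mx hR M.
      apply: eq_map_mx => -[a b] /=; rewrite /cmor /cpx_map /= !phi_ik.
      by rewrite ((HC (iC a)).2 (ex_intro _ a erefl)) ((HC (iC b)).2 (ex_intro _ b erefl)).
    by rewrite map_mxM -map_mx_comp mulmxA.
  have EU : map_mx s0 (map_mx phiR U) = map_mx (@cre R \o ik) A *m W.
    rewrite phiU map_mxM -map_mx_comp; congr (_ *m _).
      by apply: eq_map_mx => c /=.
    by apply/matrixP => i' j'; rewrite mxE s0U.
  transitivity ((map_mx (@cre R \o ik) A *m W) i j); last by rewrite -EW mxE s0U.
  by rewrite -EU mxE [map_mx phiR U i j]mxE.
have s_inj : injective s.
  move=> z z' E; apply/eqP; rewrite -subr_eq0; apply/eqP.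
  have [||H|H] := cpx_simple (I := fun z => s z = 0).
  - split; first exact: rmorph0.
    by split=> [u v su sv|r u su]; rewrite ?rmorphD ?rmorphM su ?sv ?addr0 ?mulr0.
  - by move=> u su; rewrite sphi su rmorph0.
  - by apply: H; rewrite rmorphB E subrr.
  - by have /eqP := H 1; rewrite rmorph1 oner_eq0.
have s_surj z : exists y, z = s y.
  have key x : exists y, cre x = s y.
    apply: (genR (P := fun x => exists y, cre x = s y)).
    - split; first by exists 0; rewrite !rmorph0.
      split; first by exists 1; rewrite !rmorph1.
      split=> u v [a Ea] [b Eb]; first by exists (a - b); rewrite !rmorphB /= Ea Eb.
      by exists (a * b); rewrite !rmorphM /= Ea Eb.
    - by move=> c; exists (cre (ik c)); rewrite s_cre s0k.
    - move=> i j; exists ((cU *m map_mx hR (invmx M)) i j).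
      transitivity (map_mx s (cU *m map_mx hR (invmx M)) i j); last by rewrite mxE.
      rewrite map_mxM sU -map_mx_comp.
      have -> : map_mx (s \o hR) (invmx M) = map_mx hR (invmx M).
        by apply: eq_map_mx => z' /=.
      by rewrite /W -mulmxA -map_mxM mulmxV // map_mx1 mulmx1 mxE.
    - have E : s (cre d) * (cre (\det U) * hR (\det M)) = 1.
        by rewrite -detW -sU det_map_mx -rmorphM det_map_mx -rmorphM dU !rmorph1.
      exists (cre d * hR (\det M)); rewrite rmorphM shR.
      transitivity (cre d * (s (cre d) * (cre (\det U) * hR (\det M)))); first by rewrite E mulr1.
      transitivity ((cre d * cre (\det U)) * (s (cre d) * hR (\det M))); first by ring.
      by rewrite -rmorphM dU rmorph1 mul1r.
  case: z => a b; have [y Ey] := key a; have [y' Ey'] := key b.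
  by exists (y + cim R * y'); rewrite rmorphD rmorphM s_cim -Ey -Ey' -cpx_decomp.
exists s; split; last exact: sU.
split; last by split.
have [g gP] := choice s_surj.
by exists g => [z|z]; [apply: s_inj; rewrite -gP | rewrite -gP].
Qed.

Notation fixes := (fixes_in_K phiR iC ik iR U).
Notation Gal := (Gmat phiR iC ik U).
Notation hC := (iR \o ik \o iC).
Notation UK := (map_mx iR U).
Notation VK := (map_mx iR V).
Notation evC M p := (evmx (real_complex C) M p).
Notation kpoly P := (map_mpoly (iR \o ik) P).

Lemma VUK : VK *m UK = 1%:M. Proof. by rewrite -map_mxM VU map_mx1. Qed.
Lemma UVK : UK *m VK = 1%:M. Proof. by rewrite -map_mxM UV map_mx1. Qed.

Lemma evK_k (P : {mpoly k[n * n]}) : evmx idfun UK (kpoly P) = iR (evmx ik U P).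
Proof. by rewrite evmx_map evmx_hom; apply: evmx_eqf. Qed.

Lemma evU_tau (s : {rmorphism cpx R -> cpx R}) M (tau : {rmorphism cpx K -> cpx K}) P : gal s M -> extends tau s ->
  evU M (kpoly P) = tau (cre (iR (evmx ik U P))).
Proof.
move=> gs ext; rewrite -evK_k -evU1 (tau_evmx gs ext) ?mulmx1 // => m.
by rewrite mcoeff_map_mpoly /=; apply: (tau_k gs ext).
Qed.

Lemma frac_poly f : exists P1 P2 : {mpoly k[n * n]},
  nzd (evmx ik U P2) /\ f * iR (evmx ik U P2) = iR (evmx ik U P1).
Proof.
have [_ [_ fracR]] := totK; have [a [s [nzs Es]]] := fracR f.
have [Qa [m Ea]] := poly_rep a; have [Qs [m' Es']] := poly_rep s.
pose D := \det (genmx k n).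
have DU i : evmx ik U (D ^+ i) = \det U ^+ i by rewrite rmorphXn /= evmx_det.
exists (Qa * D ^+ m'), (Qs * D ^+ m); rewrite !rmorphM /= !DU -Ea -Es'; split.
  move=> y; rewrite -!mulrA => /nzs E.
  have dn i : d ^+ i * \det U ^+ i = 1 by rewrite -exprMn dU expr1n.
  transitivity ((d ^+ m * \det U ^+ m) * (d ^+ m' * \det U ^+ m') * y).
    by rewrite !dn !mul1r.
  transitivity (d ^+ m * d ^+ m' * (\det U ^+ m' * (\det U ^+ m * y))); first by ring.
  by rewrite E mulr0.
by rewrite !rmorphM -Es; ring.
Qed.

Lemma nzd_iR s : nzd s -> exists y, iR s * y = 1.
Proof. by have [_ [invR _]] := totK; apply: invR. Qed.

(** * The relations over F as a criterion for lying in G(K/F) *)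

Section Star.
Variable F : K -> Prop.
Hypotheses (subF : is_subring F) (Fk : forall c, F (iR (ik c))).

(** For f = P1(U) / P2(U) in [F], the polynomial f P2 - P1 is itself a relation over [F], and its
    validity at U M says that f is fixed. *)
Lemma star_if M : M \in unitmx ->
  (forall Q : {mpoly K[n * n]}, (forall m, F Q@_m) -> evmx idfun UK Q = 0 -> evU M Q = 0) ->
  Gal M /\ forall f, F f -> fixes M f.
Proof.
move=> uM rel; split.
  have [|s gs] := gal_of_mx uM; last by exists s.
  move=> Q Q0; apply: cpx_map_iR_inj; rewrite -evU_k rmorph0; apply: rel.
    by move=> m; rewrite mcoeff_map_mpoly; apply: Fk.
  by rewrite evK_k Q0 rmorph0.
move=> f Ff s sgal sreal tau ext; have gs : gal s M by [].
have [P1 [P2 [nz E]]] := frac_poly f.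
have /rel : forall m, F (f *: kpoly P2 - kpoly P1)@_m.
  move=> m; rewrite mcoeffB mcoeffZ !mcoeff_map_mpoly.
  by apply: (subringB subF); [apply: (subringM subF) | ]; rewrite /= //; apply: Fk.
have evZ (T : comNzRingType) (g : {rmorphism K -> T}) (W : 'M[T]_n) c (P : {mpoly K[n * n]}) :
    evmx g W (c *: P) = g c * evmx g W P by rewrite mmapZ.
rewrite rmorphB /= evZ !evK_k E subrr => /(_ erefl).
rewrite rmorphB /= evZ !(evU_tau _ gs ext) => /eqP; rewrite subr_eq0 => /eqP E2.
have [y ty] := nzd_iR nz.
have E3 : cre f * tau (cre (iR (evmx ik U P2))) = tau (cre f) * tau (cre (iR (evmx ik U P2))).
  by rewrite E2 -E !rmorphM.
have ty' : tau (cre (iR (evmx ik U P2))) * tau (cre y) = 1 by rewrite -!rmorphM ty !rmorph1.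
by have := congr1 (fun v => v * tau (cre y)) E3; rewrite -!mulrA ty' !mulr1 => <-.
Qed.

Lemma star_mul M N : Gal M -> (forall f, F f -> fixes M f) ->
  forall Q : {mpoly K[n * n]}, (forall m, F Q@_m) -> evU N Q = 0 <-> evU (M *m N) Q = 0.
Proof.
move=> [s gs] fixM Q QF; have [tau ext] := extend_to_fractions gs.1.1.
have tQ m : tau (cre Q@_m) = cre Q@_m by apply: (fixM _ (QF m) s gs.1 gs.2 tau ext).
rewrite -(tau_evmx gs ext) //; split=> [->|E]; first by rewrite rmorph0.
by apply: (tau_inj gs ext); rewrite E rmorph0.
Qed.

Lemma star_onlyif M : Gal M -> (forall f, F f -> fixes M f) ->
  forall Q : {mpoly K[n * n]}, (forall m, F Q@_m) -> evmx idfun UK Q = 0 -> evU M Q = 0.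
Proof.
move=> GM fixM Q QF Q0; have [H _] := star_mul 1%:M GM fixM QF.
by rewrite -[M]mulmx1; apply: H; rewrite evU1 Q0 rmorph0.
Qed.
End Star.

Lemma hK_real c : hK (real_complex C c) = cre (hC c).
Proof. by rewrite /cmor /= !rmorph0. Qed.

Lemma evU_lsubst M (Q : {mpoly K[n * n]}) r (e : 'I_r -> K) (P : 'I_r -> {mpoly C[n * n]}) :
  lsubst UK Q = \sum_i e i *: map_mpoly hC (P i) ->
  evU M Q = \sum_i cre (e i) * hK (evC M (P i)).
Proof.
move=> E; rewrite -evmx_lsubst E rmorph_sum; apply: eq_bigr => i _ /=.
rewrite mmapZ evmx_map evmx_hom; congr (_ * _).
by apply: evmx_eqf => c /=; rewrite hK_real.
Qed.

Lemma cpx_indep r (e : 'I_r -> K) (z : 'I_r -> complex C) :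
  (forall la : 'I_r -> C, \sum_i hC (la i) * e i = 0 -> forall i, la i = 0) ->
  \sum_i cre (e i) * hK (z i) = 0 -> forall i, z i = 0.
Proof.
move=> indep E.
have comp : \sum_i cre (e i) * hK (z i) =
    Complex (\sum_i hC (complex.Re (z i)) * e i) (\sum_i hC (complex.Im (z i)) * e i).
  elim/big_rec3: _ => [|i y1 y2 y3 _ ->]; first by rewrite cpx_zeroE.
  case: (z i) => a b; rewrite /cre /cpx_of /cmor cpx_mulE cpx_addE !mul0r subr0 addr0 /=.
  by congr Complex; congr (_ + _); rewrite mulrC.
move: E; rewrite comp => -[/indep re0 /indep im0] i.
by case: (z i) (re0 i) (im0 i) => a b /= -> ->.
Qed.

(** * The two maps and the sets in which they take their values *)

Definition alphaM (F : K -> Prop) (M : 'M[complex C]_n) := Gal M /\ forall f, F f -> fixes M f.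
Definition betaK (H : 'M[complex C]_n -> Prop) (f : K) := forall M, H M -> fixes M f.

Lemma Gal_unitmx M : Gal M -> M \in unitmx.
Proof. by move=> [s gs]; apply: gal_unitmx gs. Qed.

Lemma alpha_lin_alg (F : K -> Prop) : is_subring F -> (forall c, F (iR (ik c))) ->
  lin_alg_subgroup_C (alphaM F).
Proof.
move=> subF Fk; split.
  split; first by move=> M [/Gal_unitmx].
  split.
    apply: (star_if subF Fk); first exact: unitmx1.
    by move=> Q _ Q0; rewrite evU1 Q0 rmorph0.
  split.
    move=> M N [GM fM] [GN fN]; apply: (star_if subF Fk).
      by rewrite unitmx_mul !Gal_unitmx.
    move=> Q QF Q0; apply: (star_mul N GM fM QF).1.
    exact: (star_onlyif GN fN QF Q0).
  move=> M [GM fM]; have uM := Gal_unitmx GM.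
  apply: (star_if subF Fk); first by rewrite unitmx_inv.
  move=> Q QF Q0; apply: (star_mul _ GM fM QF).2.
  by rewrite mulmxV // evU1 Q0 rmorph0.
(* The equations are all polynomials over [C] that vanish on [alphaM F]. By independence, the
   components P_i of each relation Q(U Z) are among them, so a common zero satisfies every
   relation. *)
exists (fun p => forall M, alphaM F M -> evC M p = 0) => M uM.
have evCE N (p : {mpoly C[n * n]}) :
    (map_mpoly (real_complex C) p).@[fun j => mxvec N 0 j] = evC N p.
  by rewrite /meval evmx_map; apply: evmx_eqf.
split=> [aM p pS|zS]; first by rewrite evCE; apply: pS.
apply: (star_if subF Fk) => // Q QF Q0.
have [r [e [P [indep E]]]] := mpoly_expand k (hC : {rmorphism C -> K}) (lsubst UK Q).
rewrite (evU_lsubst _ E) big1 // => i _.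
rewrite -evCE zS ?rmorph0 ?mulr0 // => N [GN fN].
apply: (cpx_indep (z := fun i => evC N (P i)) indep).
by rewrite -(evU_lsubst _ E); apply: (star_onlyif GN fN).
Qed.

Lemma phiK_inj : injective phiK.
Proof.
move=> x y E; apply/eqP; rewrite -subr_eq0; apply/eqP.
have {E} : phiK (x - y) = 0 by rewrite rmorphB E subrr.
move: (x - y) => z pz; have [_ [_ fracR]] := totK.
have [a [s [nzs Es]]] := fracR z; have [w sw] := nzd_iR nzs.
have a0 : a = 0.
  by apply: phi_inj; apply: iR_inj; rewrite -phiK_iR -Es rmorphM pz mul0r !rmorph0.
by rewrite -[z]mulr1 -sw mulrA Es a0 rmorph0 mul0r.
Qed.

Lemma phiK_inverse : exists psi : {rmorphism K -> K}, cancel psi phiK /\ cancel phiK psi.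
Proof.
have surj x : exists y, phiK y = x.
  have [_ [_ fracR]] := totK.
  have [a [s [nzs Es]]] := fracR x.
  have [a' Ea] := phi_surj a; have [s' Es'] := phi_surj s.
  have [|w Ew] := @nzd_iR s'.
    move=> y y0; apply: phi_inj; rewrite rmorph0; apply: nzs.
    by rewrite Es' -rmorphM y0 rmorph0.
  exists (iR a' * w); apply/eqP; rewrite rmorphM phiK_iR -Ea -Es Es' -phiK_iR -mulrA -rmorphM.
  by rewrite Ew rmorph1 mulr1.
have [//|x y y'||||psi psiP] := @rmorph_of_rel K K (fun x y => phiK y = x).
- by move=> <- /phiK_inj.
- exact: rmorph1.
- by move=> x y x' y' <- <-; rewrite rmorphB.
- by move=> x y x' y' <- <-; rewrite rmorphM.
by exists psi; split=> // x; apply: phiK_inj; rewrite psiP.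
Qed.

(** The quasi-inverse y of a fixed x is fixed by uniqueness, so 1 - x y is a fixed element killed by
    x. It vanishes as soon as x is a non-zero-divisor of the fixed ring. *)
Lemma beta_calF (H : 'M[complex C]_n -> Prop) : in_calF phiK (iR \o ik) (betaK H).
Proof.
have sub : is_subring (betaK H).
  split; first by move=> M _ s _ _ tau _; rewrite -[cpx_of 0]/(@cre K) !rmorph0.
  split; first by move=> M _ s _ _ tau _; rewrite -[cpx_of 0]/(@cre K) !rmorph1.
  split=> x y Hx Hy M HM s sg sr tau ext; have := Hx M HM s sg sr tau ext;
    have := Hy M HM s sg sr tau ext; rewrite -[cpx_of 0]/(@cre K) => Ey Ex.
    by rewrite !rmorphB /= Ex Ey.
  by rewrite !rmorphM /= Ex Ey.
split=> //; split.
  by move=> c M HM s sg sr tau ext; apply: (tau_k (conj sg sr) ext).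
split.
  move=> x Hx M HM s sg sr tau ext; rewrite -[cpx_of 0]/(@cre K) -cpx_map_cre.
  by rewrite (tau_phi (conj sg sr) ext) (Hx M HM s sg sr tau ext).
split.
  move=> x Hx M HM s sg sr tau ext; have := Hx M HM s sg sr tau ext.
  rewrite -[cpx_of 0]/(@cre K) -cpx_map_cre (tau_phi (conj sg sr) ext).
  case: (tau (cre x)) => a b [/phiK_inj -> E]; congr Complex.
  by apply: phiK_inj; rewrite E.
move=> x Hx nzx; have [r [e dec]] := decK.
have [y [xy yx]] := dec_regular dec x.
have Hy : betaK H y.
  move=> M HM s sg sr tau ext; have := Hx M HM s sg sr tau ext; rewrite -[cpx_of 0]/(@cre K) => Ex.
  apply: (@quasi_inverse_unique _ (cre x)); split.
  - by rewrite -Ex -!rmorphM xy.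
  - by rewrite -Ex -!rmorphM yx.
  - by rewrite -!rmorphM xy.
  - by rewrite -!rmorphM yx.
exists y; split=> //.
have [_ [H1 [HB HMu]]] := sub.
have H0 : betaK H (1 - x * y) by apply: HB => //; apply: HMu.
apply/eqP; rewrite eq_sym -subr_eq0; apply/eqP; apply: nzx => //.
by rewrite mulrBr mulr1 xy subrr.
Qed.

(** * The fixed ring of G(K/F) is F *)

Section FixedField.
Variable F : K -> Prop.
Hypothesis calF : in_calF phiK (iR \o ik) F.

Let subF : is_subring F. Proof. by case: calF. Qed.
Let Fk c : F (iR (ik c)). Proof. by case: calF => _ [H _]; apply: H. Qed.
Let Fphi x : F x -> F (phiK x). Proof. by case: calF => _ [_ [H _]]; apply: H. Qed.
Let Fphi' x : F (phiK x) -> F x. Proof. by case: calF => _ [_ [_ [H _]]]; apply: H. Qed.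
Let totF x : F x -> (forall y, F y -> x * y = 0 -> y = 0) -> exists z, F z /\ x * z = 1.
Proof. by case: calF => _ [_ [_ [_ H]]]; apply: H. Qed.

(* The matrix j1(U)^-1 j2(U), which is unchanged when j1 and j2 are composed with
   phi because phi U = A U. *)
Definition transfer (M : fieldType) (j1 j2 : {rmorphism K -> M}) : 'M[M]_n :=
  map_mx j1 VK *m map_mx j2 UK.

Lemma transferP (M : fieldType) (j1 j2 : {rmorphism K -> M}) :
  map_mx j1 UK *m transfer j1 j2 = map_mx j2 UK.
Proof. by rewrite mulmxA -map_mxM UVK map_mx1 mul1mx. Qed.

Lemma transfer_phi (M : fieldType) (j1 j2 : {rmorphism K -> M}) :
  (forall x, F x -> j1 x = j2 x) -> transfer (j1 \o phiK) (j2 \o phiK) = transfer j1 j2.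
Proof.
move=> j12; rewrite /transfer.
pose AK := map_mx (iR \o ik) A.
have phiUK : map_mx phiK UK = AK *m UK.
  apply/matrixP => i j; rewrite !mxE phiK_iR.
  have /matrixP /(_ i j) := phiU; rewrite !mxE => ->.
  by rewrite rmorph_sum; apply: eq_bigr => l _; rewrite !mxE rmorphM.
have EV : map_mx phiK VK *m AK = VK.
  have E : (map_mx phiK VK *m AK) *m UK = 1%:M.
    by rewrite -mulmxA -phiUK -map_mxM VUK map_mx1.
  by rewrite -[LHS]mulmx1 -UVK mulmxA E mul1mx.
have jA : map_mx j2 AK = map_mx j1 AK.
  by apply/matrixP => i j; rewrite !mxE j12 //; apply: Fk.
have -> : map_mx (j2 \o phiK) UK = map_mx j1 AK *m map_mx j2 UK.
  rewrite -jA -map_mxM -phiUK; apply/matrixP => i j; by rewrite !mxE.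
have -> : map_mx (j1 \o phiK) VK = map_mx j1 (map_mx phiK VK).
  by apply/matrixP => i j; rewrite !mxE.
by rewrite mulmxA -map_mxM EV.
Qed.

Lemma transfer_relation (Q : {mpoly K[n * n]}) r (e : 'I_r -> K) (P : 'I_r -> {mpoly C[n * n]})
    (M : fieldType) (j1 j2 : {rmorphism K -> M}) :
  (forall m, F Q@_m) -> evmx idfun UK Q = 0 ->
  (forall la : 'I_r -> C, \sum_i hC (la i) * e i = 0 -> forall i, la i = 0) ->
  lsubst UK Q = \sum_i e i *: map_mpoly hC (P i) ->
  (forall x, F x -> j1 x = j2 x) -> forall i, evmx (j1 \o hC) (transfer j1 j2) (P i) = 0.
Proof.
move=> QF Q0 indep EQ j12 i0.
have [r' [ee dec]] := decK.
pose ok (M' : fieldType) (g1 g2 : {rmorphism K -> M'}) (v : 'rV[K]_r) :=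
  \sum_i g1 (v 0 i) * evmx (g1 \o hC) (transfer g1 g2) (P i) = 0.
(* All pairs of embeddings are treated at once: precomposing a pair with [phiK] or its inverse gives
   another pair, which makes [W] stable under both. *)
pose W (v : 'rV[K]_r) := forall (M' : fieldType) (g1 g2 : {rmorphism K -> M'}),
  (forall x, F x -> g1 x = g2 x) -> ok M' g1 g2 v.
have [psi [psiK phiKpsi]] := phiK_inverse.
have phiC c : phiK (hC c) = hC c.
  by rewrite /= phiK_iR phi_ik (HC _).2 //; exists c.
have okphi (M' : fieldType) (g1 g2 : {rmorphism K -> M'}) v : (forall x, F x -> g1 x = g2 x) ->
    ok M' (g1 \o phiK) (g2 \o phiK) v -> ok M' g1 g2 (map_mx phiK v).
  move=> g12; rewrite /ok transfer_phi // => E; rewrite -[RHS]E; apply: eq_bigr => i _.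
  rewrite mxE; congr (_ * _); apply: evmx_eqf => c /=.
  by have /= -> := phiC c.
have [|||N [rowN kerN fixN]] := @normal_form K r W (dec_idem_gen dec).
- move=> M' g1 g2 g12; rewrite /ok big1 // => i _; by rewrite mxE rmorph0 mul0r.
- move=> u v Wu Wv M' g1 g2 g12; have := Wu _ _ _ g12; have := Wv _ _ _ g12; rewrite /ok => Ev Eu.
  under eq_bigr do rewrite mxE rmorphD mulrDl.
  by rewrite big_split /= Eu Ev addr0.
- move=> a u Wu M' g1 g2 g12; have := Wu _ _ _ g12; rewrite /ok => Eu.
  under eq_bigr do rewrite mxE rmorphM -mulrA.
  by rewrite -mulr_sumr Eu mulr0.
have Ntau : map_mx phiK N = N.
  apply: (fixN phiK psi psiK) => v Wv M' g1 g2 g12.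
    by apply: okphi => //; apply: Wv => x Fx /=; apply: g12; apply: Fphi.
  have g12' x : F x -> g1 (psi x) = g2 (psi x).
    by move=> Fx; apply: g12; apply: Fphi'; rewrite psiK.
  have E := Wv M' (g1 \o psi) (g2 \o psi) g12'; rewrite /ok in E.
  rewrite /ok -[RHS]E; apply: eq_bigr => i _; rewrite mxE; congr (_ * _).
  have -> : transfer (g1 \o psi) (g2 \o psi) = transfer g1 g2.
    have := transfer_phi (j1 := g1 \o psi) (j2 := g2 \o psi) g12'.
    rewrite /transfer => <-; congr (_ *m _).
      by apply/matrixP => a b; rewrite !mxE /= phiKpsi.
    by apply/matrixP => a b; rewrite !mxE /= phiKpsi.
  apply: evmx_eqf => c /=; congr (g1 _).
  by have := congr1 psi (phiC c); rewrite phiKpsi.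
have ex_c i j : exists c, N i j = hC c.
  have [c Ec] : exists c, N i j = iR (ik (iC c)).
    by apply: const_K; have /matrixP /(_ i j) := Ntau; rewrite mxE.
  by exists c.
have We : W (\row_i e i).
  move=> M' g1 g2 g12; rewrite /ok.
  transitivity (evmx g1 (transfer g1 g2) (lsubst UK Q)).
    rewrite EQ rmorph_sum; apply: eq_bigr => i _ /=.
    by rewrite mxE mmapZ evmx_map.
  rewrite evmx_lsubst transferP; transitivity (g2 (evmx idfun UK Q)); last by rewrite Q0 rmorph0.
  by rewrite evmx_hom; apply: eq_bigr => m _ /=; rewrite g12.
(* The vector of the [e i] lies in [W], hence is killed by [N], whose entries are in [C];
   independence forces [N] to vanish. Then [W] contains the standard basis vectors, and the P_i
   vanish one by one. *)
have N0 : N = 0.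
  apply/matrixP => i j; rewrite [RHS]mxE.
  have [c cP] := choice (fun i => ex_c i j).
  have /rowP /(_ j) := kerN _ We; rewrite !mxE => E.
  rewrite cP; have -> : c i = 0; last by rewrite !rmorph0.
  apply: (indep c); rewrite -[RHS]E; apply: eq_bigr => l _.
  by rewrite mxE cP mulrC.
have := rowN i0; rewrite N0 subr0 => /(_ M j1 j2 j12).
rewrite /ok (bigD1 i0) //= big1 => [|i ii0]; last by rewrite !mxE eq_sym (negbTE ii0) rmorph0 mul0r.
by rewrite !mxE eqxx rmorph1 mul1r addr0.
Qed.

Lemma char0_complex : char0 (complex C).
Proof. by move=> m; rewrite pnatr_eq0. Qed.

(** The ring generated over [C] by the entries of [Y] maps to an extension of C[i] with [b] nonzero,
    and this extension retracts onto C[i] because C[i] is root closed. *)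
Lemma specialize (M : fieldType) (j : {rmorphism C -> M}) (Y : 'M[M]_n) (b : {mpoly C[n * n]}) :
  evmx j Y b != 0 ->
  exists M0 : 'M[complex C]_n, evC M0 b != 0 /\
    forall p : {mpoly C[n * n]}, evmx j Y p = 0 -> evC M0 p = 0.
Proof.
move=> b0.
have [B [f [injf imf]]] : exists (B : idomainType) (f : {rmorphism B -> M}), injective f /\
    forall y, (exists p : {mpoly C[n * n]}, y = evmx j Y p) <-> exists x, y = f x.
  apply: subring_idomain; split; first by exists 0; rewrite rmorph0.
  split; first by exists 1; rewrite rmorph1.
  split=> _ _ [p ->] [q ->]; first by exists (p - q); rewrite rmorphB.
  by exists (p * q); rewrite rmorphM.
have ex_f y : (exists p : {mpoly C[n * n]}, y = evmx j Y p) -> exists x, f x = y.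
  by move=> /imf [x ->]; exists x.
have [|c x x'||||iB iBP] := @rmorph_of_rel C B (fun c x => f x = j c).
- by move=> c; apply: ex_f; exists c%:MP; rewrite mmapC.
- by move=> <- /injf.
- by rewrite !rmorph1.
- by move=> x y x' y'; rewrite !rmorphB => -> ->.
- by move=> x y x' y'; rewrite !rmorphM => -> ->.
have ex_Y (i : 'I_n * 'I_n) : exists x, f x = Y i.1 i.2.
  by apply: ex_f; exists (genmx C n i.1 i.2); rewrite evmx_entry.
have [y yP] := choice ex_Y.
pose YB := \matrix_(i, l) y (i, l).
have fYB : map_mx f YB = Y by apply/matrixP => i l; rewrite !mxE yP.
have fev p : f (evmx iB YB p) = evmx j Y p.
  by rewrite evmx_hom fYB; apply: evmx_eqf => c /=.
have gen : generated_over iB [seq y i | i <- enum (('I_n * 'I_n)%type : finType)].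
  move=> P subP Pi Py x.
  have [p Ep] : exists p : {mpoly C[n * n]}, f x = evmx j Y p by apply/imf; exists x.
  have -> : x = evmx iB YB p by apply: injf; rewrite fev.
  have P1 := subring1 subP; have PM := subringM subP.
  rewrite /mmap; apply: big_ind => [||m _]; [exact: (subring0 subP) | exact: (subringD subP) |].
  apply: (PM); first exact: Pi.
  rewrite /mmap1; apply: big_ind => [||l _]; [exact: P1 | exact: PM |].
  have Pl : P (mxvec YB 0 l).
    case: (mxvec_indexP l) => i1 i2; rewrite mxvecE mxE; apply: Py.
    by apply/mapP; exists (i1, i2) => //; rewrite mem_enum.
  by elim: (m l) => [|t IH]; rewrite ?expr0 // exprS; apply: PM.
have bB0 : evmx iB YB b != 0.
  by apply: contraNneq b0 => E; rewrite -fev E rmorph0.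
have [alpha [a0 ext]] := hom_ext (fmorph_inj iB) gen bB0.
have [||Om [io [psi [psiE psib cl]]]] := ext (complex C) (real_complex C).
- exact: char0_complex.
- by rewrite fmorph_eq0.
have [r rK] := cl (@complex_root_closed C).
have rinj : injective r := fmorph_inj r.
exists (map_mx (r \o psi) YB).
have thE p : evC (map_mx (r \o psi) YB) p = r (psi (evmx iB YB p)).
  transitivity ((r \o psi) (evmx iB YB p)); last by [].
  by rewrite evmx_hom; apply: evmx_eqf => c /=; rewrite psiE rK.
split; first by rewrite thE fmorph_eq0.
move=> p p0; rewrite thE; have -> : evmx iB YB p = 0 by apply: injf; rewrite fev p0 rmorph0.
by rewrite !rmorph0.
Qed.

Lemma fixed_in_F f : betaK (alphaM F) f -> F f.
Proof.
move=> bf; apply: contrapT => nFf.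
have [r [ee dec]] := decK.
have invF m : exists2 x, F x & x * m.+1%:R = 1.
  exists (iR (ik (m.+1%:R)^-1)); first exact: Fk.
  by rewrite -(rmorph_nat iR) -(rmorph_nat ik) -!rmorphM mulVf ?rmorph1 // char0k.
have [M [j1 [j2 [j12 jf]]]] := two_embeddings subF (total_subring_idem_gen dec subF totF)
  (total_subring_regular dec subF totF) invF (dec_field_hom dec) (taut_poly K) nFf.
have [P1 [P2 [nz EP]]] := frac_poly f.
(* For a group element M with extension tau, D(U M) = (tau f - f) tau(P2(U)), so [D] detects whether
   [f] is moved. At j2(U), with coefficients mapped by [j1], its value is (j2 f - j1 f) j2(P2(U)),
   which is nonzero. *)
pose D := kpoly P1 - f *: kpoly P2.
have evZ (T : comNzRingType) (g : {rmorphism K -> T}) (W : 'M[T]_n) c (P : {mpoly K[n * n]}) :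
    evmx g W (c *: P) = g c * evmx g W P by rewrite mmapZ.
have [y Ey] := nzd_iR nz.
have D0 : evmx j1 (map_mx j2 UK) D != 0.
  have kE P : evmx j1 (map_mx j2 UK) (kpoly P) = j2 (iR (evmx ik U P)).
    by rewrite -evK_k evmx_hom !evmx_map; apply: evmx_eqf => c /=; rewrite j12.
  rewrite rmorphB /= evZ !kE -EP rmorphM -mulrBl mulf_neq0 //.
    by rewrite subr_eq0 eq_sym.
  by apply/eqP => E; have := congr1 j2 Ey; rewrite rmorphM E mul0r rmorph1 => /esym /eqP; rewrite oner_eq0.
have [q [e [P [indep ED]]]] := mpoly_expand k (hC : {rmorphism C -> K}) (lsubst UK D).
pose Y := transfer j1 j2.
have [i Pi] : exists i, evmx (j1 \o hC) Y (P i) != 0.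
  apply: contrapT => nex; move/eqP: D0; apply.
  rewrite -(transferP j1 j2) -evmx_lsubst ED -/Y rmorph_sum big1 // => i _ /=.
  rewrite mmapZ evmx_map; have -> : evmx (j1 \o hC) Y (P i) = 0; last by rewrite mulr0.
  by apply/eqP/negPn/negP => n0; apply: nex; exists i.
have dY : \det Y != 0.
  apply/eqP => Y0; have /eqP := oner_neq0 M; apply.
  have : \det (map_mx j2 UK *m map_mx j2 VK) = 0.
    by rewrite -(transferP j1 j2) 2!det_mulmx -/Y Y0 mulr0 mul0r.
  by rewrite -map_mxM UVK map_mx1 det1.
(* The determinant is included so that the specialized matrix is invertible. *)
have [|M0 [M0b M0z]] := @specialize M (j1 \o hC) Y (P i * \det (genmx C n)).
  by rewrite rmorphM /= evmx_det mulf_neq0.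
move: M0b; rewrite rmorphM /= evmx_det mulf_eq0 negb_or => /andP [PM0 dM0].
have [GM0 fM0] : alphaM F M0.
  apply: (star_if subF Fk); first by rewrite unitmxE unitfE.
  move=> Q QF Q0; have [q' [e' [P' [indep' EQ]]]] := mpoly_expand k (hC : {rmorphism C -> K}) (lsubst UK Q).
  rewrite (evU_lsubst _ EQ) big1 // => l _; rewrite M0z ?rmorph0 ?mulr0 //.
  exact: (transfer_relation QF Q0 indep' EQ j12).
have [s gs] := GM0; have [tau ext] := extend_to_fractions gs.1.1.
have tf := bf M0 (conj GM0 fM0) s gs.1 gs.2 tau ext.
move/eqP: PM0; apply; apply: (cpx_indep (z := fun i => evC M0 (P i)) indep).
rewrite -(evU_lsubst _ ED) rmorphB /= evZ !(evU_tau _ gs ext) -EP !rmorphM.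
by rewrite -[tau (cre f)]/(tau (cpx_of 0 f)) tf subrr.
Qed.
End FixedField.

(** * A closed subgroup is recovered from its fixed ring *)

Section ClosedSubgroup.
Variable H : 'M[complex C]_n -> Prop.
Hypotheses (HGal : forall M, H M -> Gal M) (algH : lin_alg_subgroup_C H).

Lemma cconj_hK z : cconj (hK z) = hK (conjc z).
Proof. by case: z => a b; rewrite /cconj /cmor /= !rmorphN. Qed.

Lemma evC_conj M (p : {mpoly C[n * n]}) : evC (map_mx (@conjc C) M) p = conjc (evC M p).
Proof.
by rewrite (evmx_hom (real_complex C) (@conjc C)); apply: evmx_eqf => c /=; rewrite oppr0.
Qed.

(** The defining equations have coefficients in [C], which conjugation fixes; this is what the later
    descent from K[i] to [K] requires of [H]. *)
Lemma zariski_conj M : H M -> H (map_mx (@conjc C) M).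
Proof.
move=> HM; have [[unitH _] [S SP]] := algH.
have uM := unitH M HM.
have uM' : map_mx (@conjc C) M \in unitmx.
  by move: uM; rewrite !unitmxE det_map_mx !unitfE fmorph_eq0.
have evCE N (p : {mpoly C[n * n]}) :
    (map_mpoly (real_complex C) p).@[fun j => mxvec N 0 j] = evC N p.
  by rewrite /meval evmx_map; apply: evmx_eqf.
apply/(SP _ uM') => p pS; rewrite evCE evC_conj.
by have /(SP _ uM) /(_ p pS) := HM; rewrite evCE => ->; rewrite rmorph0.
Qed.

Lemma hom_id_fractions (g : {rmorphism cpx K -> cpx K}) :
  (forall z, g (cpx_map iR z) = cpx_map iR z) -> forall z, g z = z.
Proof.
move=> gid z; have [ze [t [nzt Et]]] := frac_cpx z.
have [y ty] := nzd_cpx_unit (nzd_cre nzt).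
have E : g z * cpx_map iR (cre t) = z * cpx_map iR (cre t).
  by rewrite -{1}gid -rmorphM cpx_map_cre Et gid.
by have := congr1 (fun v => v * y) E; rewrite -!mulrA ty !mulr1.
Qed.

Lemma extend_inverse (s : {rmorphism cpx R -> cpx R}) (tau : {rmorphism cpx K -> cpx K}) :
  is_real_gal phiR ik s -> extends tau s ->
  exists tau' : {rmorphism cpx K -> cpx K}, cancel tau' tau /\ cancel tau tau'.
Proof.
move=> [[s1 s1K sK1] _] ext.
have [z|z y y'||||s' s'P] := @rmorph_of_rel (cpx R) (cpx R) (fun z y => s y = z).
- by exists (s1 z).
- by move=> <- /(can_inj s1K).
- exact: rmorph1.
- by move=> x y x' y' <- <-; rewrite rmorphB.
- by move=> x y x' y' <- <-; rewrite rmorphM.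
have bs' : bijective s'.
  by exists s => z; [apply: s'P | apply: (can_inj s1K); apply: s'P].
have [tau' ext'] := extend_to_fractions bs'.
exists tau'; split=> z.
  by apply: (hom_id_fractions (g := tau \o tau')) => w /=; rewrite ext' ext s'P.
apply: (hom_id_fractions (g := tau' \o tau)) => w /=; rewrite ext ext'; congr cpx_map.
by apply: (can_inj s1K); rewrite s'P.
Qed.

(** The linear algebra takes place over K[i], where the monomials in the entries of U h live;
    invariance under conjugation and under [H] brings the entries of the normal form back to K^H. *)
Lemma closed_subgroup_of_beta M : alphaM (betaK H) M -> H M.
Proof.
move=> [GM fM]; have uM := Gal_unitmx GM.
have [[unitH [H1 [HMul HInv]]] [S SP]] := algH.
have evCE N (p : {mpoly C[n * n]}) :
    (map_mpoly (real_complex C) p).@[fun j => mxvec N 0 j] = evC N p.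
  by rewrite /meval evmx_map; apply: evmx_eqf.
apply/(SP _ uM) => p pS; rewrite evCE.
have pH h : H h -> evC h p = 0.
  by move=> Hh; have /(SP _ (unitH _ Hh)) /(_ p pS) := Hh; rewrite evCE.
(* This is p(U^-1 Z), so that Q(U h) = p(h). *)
pose Q := lsubst VK (map_mpoly (hC : {rmorphism C -> K}) p).
have evQ h : evU h Q = hK (evC h p).
  rewrite evmx_lsubst mulmxA -map_mxM VUK map_mx1 mul1mx evmx_map evmx_hom.
  by apply: evmx_eqf => c /=; rewrite hK_real.
suff E : evU M Q = 0.
  by apply: (fmorph_inj (hK : {rmorphism complex C -> cpx K})); rewrite rmorph0 /= -evQ.
pose L := size (msupp Q).
pose mn (l : 'I_L) := tnth (in_tuple (msupp Q)) l.
pose y h (l : 'I_L) : cpx K := mmap1 (fun j => mxvec (cUK *m map_mx hK h) 0 j) (mn l).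
pose q : 'rV[cpx K]_L := \row_l cre Q@_(mn l).
have evy h : evU h Q = \sum_l q 0 l * y h l.
  by rewrite /mmap big_tnth; apply: eq_bigr => l _; rewrite mxE.
have yE h l : y h l = evU h 'X_[mn l] by rewrite mmapX.
have tau_y (s : {rmorphism cpx R -> cpx R}) g (tau : {rmorphism cpx K -> cpx K}) h l :
    gal s g -> extends tau s -> tau (y h l) = y (g *m h) l.
  move=> gs ext; rewrite !yE (tau_evmx gs ext) // => m.
  by rewrite mcoeffX !rmorph_nat.
have conj_y h l : cconj (y h l) = y (map_mx (@conjc C) h) l.
  rewrite !yE evmx_hom map_mxM.
  have -> : map_mx (@cconj K) cUK = cUK.
    by apply/matrixP => i j; rewrite !mxE /= cconj_cre.
  have -> : map_mx (@cconj K) (map_mx hK h) = map_mx hK (map_mx (@conjc C) h).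
    by apply/matrixP => i j; rewrite !mxE /= cconj_hK.
  by apply: evmx_eqf => c /=; rewrite cconj_cre.
(* The coefficient vectors of polynomials in the monomials of [Q] that vanish on all of U H. *)
pose W (v : 'rV[cpx K]_L) := forall h, H h -> \sum_l v 0 l * y h l = 0.
have [r [ee dec]] := decK.
have [|||N [rowN kerN fixN]] := @normal_form (cpx K) L W (dec_idem_gen (cpx_field_dec dec realK)).
- by move=> h _; rewrite big1 // => l _; rewrite mxE mul0r.
- move=> u v Wu Wv h Hh; under eq_bigr do rewrite mxE mulrDl.
  by rewrite big_split /= Wu // Wv // addr0.
- move=> a u Wu h Hh; under eq_bigr do rewrite mxE -mulrA.
  by rewrite -mulr_sumr Wu // mulr0.
have Nconj : map_mx (@cconj K) N = N.
  have Wc v : W v -> W (map_mx (@cconj K) v).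
    move=> Wv h Hh.
    transitivity (cconj (\sum_l v 0 l * y (map_mx (@conjc C) h) l)); last first.
      by rewrite (Wv _ (zariski_conj Hh)) rmorph0.
    rewrite rmorph_sum; apply: eq_bigr => l _; rewrite mxE rmorphM /= conj_y -map_mx_comp.
    congr (_ * y _ l); apply/matrixP => i j; rewrite !mxE /=.
    by case: (h i j) => a b /=; rewrite opprK.
  exact: (fixN (@cconj K) (@cconj K) (@cconjK K)).
have Ntau g (s : {rmorphism cpx R -> cpx R}) (tau : {rmorphism cpx K -> cpx K}) :
    H g -> gal s g -> extends tau s -> map_mx tau N = N.
  move=> Hg gs ext; have [tau' [tK Kt]] := extend_inverse gs.1 ext.
  apply: (fixN tau tau' tK) => v Wv h Hh.
    transitivity (tau (\sum_l v 0 l * y (invmx g *m h) l)); last first.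
      by rewrite Wv ?rmorph0 //; apply: HMul => //; apply: HInv.
    rewrite rmorph_sum; apply: eq_bigr => l _.
    by rewrite mxE rmorphM (tau_y _ _ _ _ _ gs ext) mulKVmx // unitH.
  transitivity (tau' (\sum_l v 0 l * y (g *m h) l)); last first.
    by rewrite Wv ?rmorph0 //; apply: HMul.
  rewrite rmorph_sum; apply: eq_bigr => l _.
  by rewrite mxE rmorphM -(tau_y _ _ _ _ _ gs ext) Kt.
(* An entry equal to its conjugate has imaginary part b = - b, so 2 must be inverted. *)
have two_unit : exists u : K, u * 2%:R = 1.
  exists (iR (ik (2%:R)^-1)); rewrite -(rmorph_nat iR) -(rmorph_nat ik) -!rmorphM.
  by rewrite mulVf ?rmorph1 // (char0k 1).
have Nreal i j : exists c, N i j = cre c /\ betaK H c.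
  have /matrixP /(_ i j) := Nconj; rewrite mxE.
  case E : (N i j) => [a b] [Eb].
  have [u u2] := two_unit.
  have b0 : b = 0.
    rewrite -[b]mul1r -u2 -mulrA mulr_natl mulr2n -{1}Eb addNr mulr0 //.
  exists a; rewrite b0; split=> // g Hg s sg sr tau ext.
  have /matrixP /(_ i j) := Ntau g s tau Hg (conj sg sr) ext.
  by rewrite mxE E b0.
have [s gs] := GM; have [tau ext] := extend_to_fractions gs.1.1.
have tauN i j : tau (N i j) = N i j.
  by have [c [-> bc]] := Nreal i j; apply: (fM c bc s gs.1 gs.2 tau ext).
have qN : q *m N = 0.
  by apply: kerN => h Hh; rewrite -evy evQ pH // rmorph0.
(* The rows of 1 - N are relations at U, taken with h = 1; [tau] fixes [N] and turns [U] into U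
   M. *)
have NM j : y M j = \sum_l N j l * y M l.
  have := rowN j 1%:M H1 => E1.
  have : tau (\sum_l (row j (1%:M - N)) 0 l * y 1%:M l) = 0 by rewrite E1 rmorph0.
  rewrite rmorph_sum.
  under eq_bigr => l _ do rewrite rmorphM (tau_y _ _ _ _ _ gs ext) mulmx1 !mxE rmorphB tauN rmorph_nat mulrBl.
  rewrite sumrB => /eqP; rewrite subr_eq0 => /eqP <-.
  rewrite (bigD1 j) //= eqxx mul1r big1 ?addr0 // => l lj.
  by rewrite eq_sym (negbTE lj) mul0r.
(* Q(U M) is the product of [q] with the values [y M]; inserting [N] between them gives (q N) y, and
   q N = 0. *)
rewrite evy; under eq_bigr => j _ do rewrite NM mulr_sumr.
rewrite exchange_big /= big1 // => l _.
under eq_bigr => j _ do rewrite mulrA.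
rewrite -mulr_suml; have /rowP /(_ l) := qN; rewrite !mxE => ->.
by rewrite mul0r.
Qed.
End ClosedSubgroup.

(** * Assembly of the correspondence *)

Lemma galois_correspondence :
  let calF := in_calF phiK (fun c => iR (ik c)) in
  let calG := fun H : 'M[complex C]_n -> Prop =>
    (forall M, H M -> Gal M) /\ lin_alg_subgroup_C H in
  (forall F, calF F -> calG (alphaM F)) /\
  (forall H, calG H -> calF (betaK H)) /\
  (forall F, calF F -> forall f, betaK (alphaM F) f <-> F f) /\
  (forall H, calG H -> forall M, alphaM (betaK H) M <-> H M).
Proof.
move=> calF calG; split.
  move=> F [subF [Fk _]]; split; first by move=> M [].
  exact: alpha_lin_alg.
split; first by move=> H _; apply: beta_calF.
split=> [F FF f|H [HG HA] M]; split.
- exact: fixed_in_F.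
- by move=> Ff M [_ fM]; apply: fM.
- exact: closed_subgroup_of_beta.
- by move=> HM; split; [apply: HG | move=> f; apply].
Qed.
End PV.

Theorem theorem3p3
  (* the difference field (k, phik): char 0, real, constants real closed *)
  (k : fieldType) (phik : {rmorphism k -> k})
  (Hphik : bijective phik)
  (Hchar : [pchar k] =i pred0)
  (Hreal : real_field k)
  (C : rcfType) (iC : {rmorphism C -> k})
  (HC : forall x : k, phik x = x <-> exists c : C, x = iC c)
  (* the equation phi Y = A Y *)
  (n : nat) (A : 'M[k]_n) (HA : A \in unitmx)
  (* the Picard-Vessiot extension (R, phiR) with fundamental solution U *)
  (R : comNzRingType) (phiR : {rmorphism R -> R}) (ik : {rmorphism k -> R})
  (U : 'M[R]_n)
  (HPV : PV_extension phik A phiR ik U)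
  (* its total ring of fractions K with the induced automorphism *)
  (K : comNzRingType) (iR : {rmorphism R -> K}) (phiK : {rmorphism K -> K})
  (HK : total_ring_of_fractions iR)
  (HphiK : forall x : R, phiK (iR x) = iR (phiR x))
  (* R is real *)
  (HRreal : real_tot_ring K) :
  let calF := in_calF phiK (fun c => iR (ik c)) in
  let calG := fun H : 'M[complex C]_n -> Prop =>
    (forall M, H M -> Gmat phiR iC ik U M) /\ lin_alg_subgroup_C H in
  let fixes := fixes_in_K phiR iC ik iR U in
  let alpha := fun (F : K -> Prop) (M : 'M[complex C]_n) =>
    Gmat phiR iC ik U M /\ forall f, F f -> fixes M f in
  let beta := fun (H : 'M[complex C]_n -> Prop) (f : K) =>
    forall M, H M -> fixes M f in
  (forall F, calF F -> calG (alpha F)) /\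
  (forall H, calG H -> calF (beta H)) /\
  (forall F, calF F -> forall f, beta (alpha F) f <-> F f) /\
  (forall H, calG H -> forall M, alpha (beta H) M <-> H M).
Proof.
have [[psi phiK1 phiK2] [_ [phi_ik [[V [UV VU]] [phiU [[d [dU gen]] simR]]]]]] := HPV.
have char0k : char0 k.
  by move=> m; have := Hchar; rewrite pcharf0P => /(_ m.+1) ->.
have phi_surj x : exists y, x = phiR y by exists (psi x); rewrite phiK2.
have genR (P : R -> Prop) : is_subring P -> (forall c, P (ik c)) -> (forall i j, P (U i j)) ->
    P d -> forall x, P x by move=> subP Pk PU Pd; apply: gen.
exact: (galois_correspondence char0k HC phi_surj (can_inj phiK1) phi_ik UV VU phiU dU genR
  simR HK HphiK HRreal).
Qed.
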